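(* Let $\Pi=\{x+Y_x:x\in\mathbb{Z}\}$, where $\{Y_x\}_{x\in\mathbb{Z}}$ are i.i.d. real random variables with a symmetric $\alpha$-stable distribution, and let $\Pi_0=\{x+Y_x:x\in\mathbb{Z}\setminus\{0\}\}$. If $\alpha<1$, then $\Pi$ is deletion tolerant and insertion tolerant, and the laws of $\Pi$ and $\Pi_0$ are mutually absolutely continuous. If $\alpha\ge 1$, then $\Pi$ is deletion singular and rigid.
   Context: Here $0<\alpha\le 2$, and a symmetric $\alpha$-stable distribution is one with characteristic function $t\mapsto e^{-c|t|^\alpha}$ for some $c>0$. Absolute continuity and mutual singularity of two random objects always refer to their laws. For a point process $\Pi$ in $\mathbb{R}^d$ (here $d=1$), a $\Pi$-point is an $\mathbb{R}^d$-valued random variable $Z$ with $Z\in\Pi$ almost surely. $\Pi$ is deletion tolerant if for every $\Pi$-point $Z$, the law of $\Pi\setminus\{Z\}$ is absolutely continuous with respect to the law of $\Pi$. $\Pi$ is deletion singular if for every $\Pi$-point $Z$, the laws of $\Pi$ and $\Pi\setminus\{Z\}$ are mutually singular. $\Pi$ is insertion tolerant if for every Borel set $V\subset\mathbb{R}^d$ with Lebesgue measure in $(0,\infty)$, when $U$ is uniform in $V$ and independent of $\Pi$, the law of $\Pi\cup\{U\}$ is absolutely continuous with respect to the law of $\Pi$. $\Pi$ is rigid if for every ball $B\subset\mathbb{R}^d$ there is a measurable function $N_B$ on the collection of discrete point sets in $\mathbb{R}^d$ such that $N_B(\Pi\cap B^c)=|\Pi\cap B|$ almost surely. *)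

(* Defs.v *)
From HB Require Import structures.
From mathcomp Require Import all_boot all_order all_algebra.
From mathcomp Require Import all_classical all_reals all_analysis.
From mathcomp Require Import measurable_realfun.
From mathcomp Require Import finmap complex.

Set Implicit Arguments.
Unset Strict Implicit.
Unset Printing Implicit Defensive.

Import Order.TTheory GRing.Theory Num.Theory.
Import numFieldNormedType.Exports.
Local Open Scope classical_set_scope.
Local Open Scope ring_scope.

Section configurations.
Context {R : realType}.

Definition locally_finite (A : set R) :=
  forall a b : R, finite_set (A `&` `[a, b]).

Record lfset := LFSet { points :> set R; lfsetP : locally_finite points }.

Lemma locally_finite0 : locally_finite set0.
Proof. by move=> a b; rewrite set0I. Qed.

Lemma locally_finite1 z : locally_finite [set z].
Proof. by move=> a b; apply: finite_setIl; exact: finite_set1. Qed.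

Lemma locally_finite_sub (A B : set R) :
  A `<=` B -> locally_finite B -> locally_finite A.
Proof. by move=> AB lB a b; apply: sub_finite_set (lB a b); exact: setSI. Qed.

Lemma locally_finiteU (A B : set R) :
  locally_finite A -> locally_finite B -> locally_finite (A `|` B).
Proof. by move=> lA lB a b; rewrite setIUl finite_setU. Qed.

HB.instance Definition _ := gen_eqMixin lfset.
HB.instance Definition _ := gen_choiceMixin lfset.
HB.instance Definition _ := isPointed.Build lfset (LFSet locally_finite0).

Definition npoints (B : set R) (p : lfset) : \bar R := counting (p `&` B).

(* The sigma-algebra on configurations is the smallest one that makes every
   counting map [npoints B], with B a Borel set, measurable. *)
Definition count_events : set (set lfset) :=
  \bigcup_(B in @measurable _ R)
    preimage_set_system setT (npoints B) (measurable : set (set (\bar R))).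

Definition configuration : Type := g_sigma_algebraType count_events.
HB.instance Definition _ := Measurable.on configuration.

Definition restrict_conf (p : configuration) (B : set R) : configuration :=
  LFSet (locally_finite_sub (@subIsetl _ (points p) B) (lfsetP p)).

Definition remove_pt (p : configuration) (z : R) : configuration :=
  LFSet (locally_finite_sub (@subDsetl _ (points p) [set z]) (lfsetP p)).

Definition add_pt (p : configuration) (z : R) : configuration :=
  LFSet (locally_finiteU (lfsetP p) (@locally_finite1 z)).

(* A perturbed lattice is locally finite only almost surely; the value chosen
   on the exceptional event does not affect its law. *)
Definition to_configuration (A : set R) : configuration :=
  if pselect (locally_finite A) is left lfA then LFSet lfA
  else LFSet locally_finite0.

End configurations.
Arguments configuration R : clear implicits.


Section count_measurability.
Context {R : realType}.
Implicit Types (A B : set R) (n : nat).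

Lemma leq_counting A n :
  (n%:R%:E <= (counting A : \bar R))%E = (`I_n #<= A)%card.
Proof.
rewrite /counting; case: asboolP => fA.
  rewrite lee_fin ler_nat; apply/idP/idP => [|An]; last first.
    exact: leq_card_fset_set.
  have /finite_setP[m Am] := fA.
  by rewrite (card_fset_set Am) (card_le_eqr Am) card_le_II.
rewrite leey; symmetry; apply/(card_le_trans (subset_card_le _))/infiniteP => //.
Qed.

Lemma measurable_counting d (T : measurableType d) (g : T -> set R) :
  (forall n, measurable [set w | (`I_n #<= g w)%card]) ->
  measurable_fun setT (fun w => counting (g w) : \bar R).
Proof.
move=> mg _ A mA; rewrite setTI.
pose E n : set T := [set w | (`I_n #<= g w)%card].
have -> : (fun w => counting (g w) : \bar R) @^-1` A =
    \bigcup_n ((E n `\` E n.+1) `&` [set w | A n%:R%:E]) `|`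
    ((\bigcap_n E n) `&` [set w | A +oo%E]).
  apply/seteqP; split=> w /=.
  - have [fw|fw] := pselect (finite_set (g w)).
      rewrite /counting asboolT// => Aw; left.
      exists #|` fset_set (g w)| => //; split => //; split=> /=.
        by rewrite /E /= -leq_counting /counting asboolT// lexx.
      by rewrite /E /= -leq_counting /counting asboolT// lee_fin ler_nat ltnn.
    rewrite /counting asboolF// => Aw; right; split => //= n _.
    by rewrite /E /= -leq_counting /counting asboolF// leey.
  - case=> [[n _ [[En En1] An]]|[Ew Aoo]].
      move: En En1; rewrite /E /= -!leq_counting /counting.
      case: asboolP => fw; last by rewrite !leey.
      rewrite !lee_fin !ler_nat => nk /negP; rewrite -ltnNge ltnS => kn.
      suff -> : #|` fset_set (g w)| = n by [].
      by apply/eqP; rewrite eqn_leq kn nk.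
    rewrite /counting; case: asboolP => // fw.
    have := Ew #|` fset_set (g w)|.+1 I.
    by rewrite /E /= -leq_counting /counting asboolT// lee_fin ler_nat ltnn.
have mcst (b : Prop) : measurable [set _ : T | b].
  have [h|h] := pselect b.
    by rewrite (_ : [set _ | _] = setT)//; apply/seteqP; split.
  by rewrite (_ : [set _ | _] = set0)//; apply/seteqP; split.
apply: measurableU.
  apply: bigcupT_measurable => n; apply: measurableI => //.
  by apply: measurableD; exact: mg.
by apply: measurableI => //; apply: bigcap_measurableType => n _; exact: mg.
Qed.

Lemma countingD1 A (z : R) : A z ->
  (counting (A `\ z) : \bar R) = (counting A - 1)%E.
Proof.
move=> Az; rewrite /counting.
have -> : (finite_set (A `\ z)) = finite_set A.
  apply/propext; split=> fA; last exact: finite_setD.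
  by rewrite -(setD1K Az) finite_setU; split => //; exact: finite_set1.
case: asboolP => // fA; rewrite fset_setD1// (cardfsD1 z (fset_set A)).
by rewrite in_fset_set// mem_set// natrD EFinD addeAC subee// add0e.
Qed.

Lemma countingU1 A (z : R) : ~ A z ->
  (counting (A `|` [set z]) : \bar R) = (counting A + 1)%E.
Proof.
move=> Az.
have /countingD1 : (A `|` [set z]) z by right.
rewrite setDUl setDv setU0 not_setD1// => ->.
by rewrite subeK.
Qed.

Lemma counting0E A : ((counting A : \bar R) = 0)%E <-> A = set0.
Proof.
split=> [A0|->]; last by rewrite /counting asboolT// fset_set0.
move: A0; rewrite /counting; case: asboolP => // fA [] /eqP.
by rewrite pnatr_eq0 cardfs_eq0 => /eqP /fset_set_set0; apply.
Qed.

Lemma measurable_npoints B : measurable B ->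
  measurable_fun setT (npoints B : configuration R -> \bar R).
Proof.
move=> mB _ A mA; apply: sub_sigma_algebra.
by exists B => //; exists A.
Qed.

Lemma measurable_conf d (T : measurableType d) (f : T -> configuration R) :
  (forall B, measurable B -> measurable_fun setT (fun w => npoints B (f w))) ->
  measurable_fun setT f.
Proof.
move=> mf.
apply: (@measurability _ _ T (configuration R) setT f (@count_events R) erefl).
move=> _ [_ [B mB [A mA <-]] <-]; rewrite !setTI.
by have := mf B mB measurableT A mA; rewrite setTI.
Qed.

End count_measurability.

Section point_operations.
Context {R : realType}.

Lemma measurable_mem_conf :
  measurable [set pz : configuration R * R | points pz.1 pz.2].
Proof.
rewrite -[X in measurable X]setCK; apply: measurableC.
rewrite (_ : ~` _ = \bigcup_(a : rat) \bigcup_(b : rat)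
  ((npoints `]ratr a, ratr b[ @^-1` [set 0%E]) `*` `]ratr a, ratr b[)); last first.
  apply/seteqP; split=> -[p z] /=.
    move=> pz.
    have fF := lfsetP p (z - 1) (z + 1).
    have lz : z - 1 < z by rewrite ltrBlDr ltrDl.
    have gz : z < z + 1 by rewrite ltrDl.
    have [acF _] := @accessible_finite_set_closed R.
    have /closed_openC oF :=
      acF (hausdorff_accessible (@Rhausdorff R)) _ fF.
    have : nbhs z (~` (p `&` `[z - 1, z + 1])).
      by apply: open_nbhs_nbhs; split => // -[].
    move=> /nbhs_ballP[e /= e0 zeF].
    pose r := Num.min e 1.
    have r0 : 0 < r by rewrite lt_min e0 ltr01.
    have /rat_in_itvoo[a] : z - r < z by rewrite ltrBlDr ltrDl.
    rewrite in_itv/= => /andP[za az].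
    have /rat_in_itvoo[b] : z < z + r by rewrite ltrDl.
    rewrite in_itv/= => /andP[zb bz].
    exists a => //; exists b => //; split => /=; last by rewrite in_itv/= az zb.
    apply/counting0E/seteqP; split=> // x [px /=]; rewrite in_itv/= => /andP[ax xb].
    have zx : `|z - x| < r.
      rewrite ltr_norml; apply/andP; split.
        by rewrite ltrBrDl ltrBlDl addrC (lt_trans xb).
      by rewrite ltrBlDl -ltrBlDr (lt_trans za).
    apply: (zeF x).
      by rewrite /ball /= (lt_le_trans zx)// ge_min lexx.
    split => //=; rewrite in_itv/= -ler_distlC (le_trans (ltW zx))//.
    by rewrite ge_min lexx orbT.
  move=> [a _ [b _ /= [/counting0E p0 zab]]] pz.
  by have : (set0 : set R) z by rewrite -p0; split.
apply: countable_bigcupT_measurable => // a.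
apply: countable_bigcupT_measurable => // b.
apply: measurableX => //.
rewrite -[X in measurable X]setTI; exact: measurable_npoints.
Qed.

Lemma measurable_remove_pt :
  measurable_fun setT (fun pz : configuration R * R => remove_pt pz.1 pz.2).
Proof.
apply: measurable_conf => B mB.
pose E := [set pz : configuration R * R | points pz.1 pz.2] `&` (snd @^-1` B).
have mE : measurable E.
  apply: measurableI; first exact: measurable_mem_conf.
  by rewrite -[X in measurable X]setTI; exact: measurable_snd.
rewrite (_ : (fun w => _) =
    (fun w => npoints B w.1 - (\1_E w)%:E)%E); last first.
  apply/funext => -[p z] /=; rewrite /npoints /= setIDAC indicE.
  have [/set_mem[/= pz Bz]|/negP nE] := boolP ((p, z) \in E).
    by rewrite setIDA countingD1.
  rewrite sube0 setIDA not_setD1// => -[pz Bz]; apply: nE; exact/mem_set.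
apply: emeasurable_funB.
  by apply: measurableT_comp (measurable_npoints mB) measurable_fst.
by apply/measurable_EFinP; exact: measurable_indic.
Qed.

Lemma measurable_add_pt :
  measurable_fun setT (fun pz : configuration R * R => add_pt pz.1 pz.2).
Proof.
apply: measurable_conf => B mB.
pose E := ~` [set pz : configuration R * R | points pz.1 pz.2] `&` (snd @^-1` B).
have mE : measurable E.
  apply: measurableI; first by apply: measurableC; exact: measurable_mem_conf.
  by rewrite -[X in measurable X]setTI; exact: measurable_snd.
rewrite (_ : (fun w => _) =
    (fun w => npoints B w.1 + (\1_E w)%:E)%E); last first.
  apply/funext => -[p z] /=; rewrite /npoints /= setIUl indicE.
  have [/set_mem[/= pz Bz]|/negP nE] := boolP ((p, z) \in E).
    have -> : [set z] `&` B = [set z] by apply/seteqP; split=> [x []|x ->].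
    by apply: countingU1 => -[].
  rewrite adde0; congr counting; rewrite setUidl// => x [-> Bz]; split => //.
  by apply: contrapT => pz; apply: nE; exact/mem_set.
apply: emeasurable_funD.
  by apply: measurableT_comp (measurable_npoints mB) measurable_fst.
by apply/measurable_EFinP; exact: measurable_indic.
Qed.

Section random_points.
Context d (T : measurableType d) (Pi : {mfun T >-> configuration R})
  (Z : {mfun T >-> R}).

Definition remove_point (w : T) : configuration R := remove_pt (Pi w) (Z w).
Definition add_point (w : T) : configuration R := add_pt (Pi w) (Z w).

Lemma measurable_remove_point : measurable_fun setT remove_point.
Proof.
have mPZ : measurable_fun setT (fun w => (Pi w, Z w)) by exact: measurable_fun_pair.
exact: (measurableT_comp measurable_remove_pt mPZ).
Qed.

Lemma measurable_add_point : measurable_fun setT add_point.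
Proof.
have mPZ : measurable_fun setT (fun w => (Pi w, Z w)) by exact: measurable_fun_pair.
exact: (measurableT_comp measurable_add_pt mPZ).
Qed.

HB.instance Definition _ :=
  isMeasurableFun.Build _ _ _ _ remove_point measurable_remove_point.
HB.instance Definition _ :=
  isMeasurableFun.Build _ _ _ _ add_point measurable_add_point.

End random_points.
End point_operations.

Section random_set.
Context {R : realType} d (T : measurableType d) (J : countType).
Context (D : set J) (X : J -> T -> R).
Hypothesis mXT : forall i, measurable_fun setT (X i).

Let S w : set R := [set X i w | i in D].

Lemma card_ge_seqP (A : set R) n : (`I_n #<= A)%card <->
  exists l : seq R, [/\ size l = n, uniq l & forall x, x \in l -> A x].
Proof.
split=> [/card_subP[C Cn CA]|[l [ln ul lA]]].
  have fC : finite_set C by apply/finite_setP; exists n.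
  exists (fset_set C); split=> [||x]; first exact: card_fset_set.
    exact: fset_uniq.
  by rewrite in_fset_set// => /set_mem /CA.
have /card_eq_fsetP : #|` [fset x in l]%fset| = n.
  by rewrite card_fseq undup_id.
move=> /card_le_eql eqA; rewrite -eqA; apply: subset_card_le => x /=.
by rewrite !inE => /lA.
Qed.

Let measurable_uniq_in (B : set R) (s : seq J) : measurable B ->
  measurable [set w | uniq [seq X i w | i <- s] /\
                      forall i, i \in s -> D i /\ B (X i w)].
Proof.
move=> mB.
have mDB i : measurable [set w | D i /\ B (X i w)].
  have [Di|nDi] := pselect (D i).
    rewrite (_ : [set w | _] = X i @^-1` B); last by apply/seteqP; split=> w // [].
    by rewrite -[X in measurable X]setTI; exact: mXT.
  by rewrite (_ : [set w | _] = set0)//; apply/seteqP; split=> w // [].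
have mX i j : measurable [set w | X i w = X j w].
  have mB0 : measurable_fun setT (fun w => X i w - X j w).
    by apply: measurable_funB; exact: mXT.
  rewrite (_ : [set w | _] = setT `&` (fun w => X i w - X j w) @^-1` [set 0]).
    by apply: mB0 => //; exact: measurable_set1.
  rewrite setTI; apply/seteqP; split=> w /= => [->|/eqP]; first exact: subrr.
  by rewrite subr_eq0 => /eqP.
have mN i l : measurable [set w | X i w \notin [seq X j w | j <- l]].
  elim: l => [|j l IHl].
    by rewrite (_ : [set w | _] = setT)//; apply/seteqP; split.
  rewrite (_ : [set w | _] = ~` [set w | X i w = X j w] `&`
      [set w | X i w \notin [seq X k w | k <- l]]).
    by apply: measurableI => //; exact: measurableC.
  apply/seteqP; split=> w /=; rewrite in_cons negb_or.
    by move=> /andP[/eqP].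
  by move=> [/eqP -> ->].
elim: s => [|i s IHs].
  by rewrite (_ : [set w | _] = setT)//; apply/seteqP; split.
rewrite (_ : [set w | _] = ([set w | X i w \notin [seq X j w | j <- s]] `&`
    [set w | D i /\ B (X i w)]) `&`
    [set w | uniq [seq X i w | i <- s] /\
             forall i, i \in s -> D i /\ B (X i w)]).
  by apply: measurableI => //; exact: measurableI.
apply/seteqP; split=> w /=.
  move=> [/andP[wi us] DB]; do 2! split => //; first exact/DB/mem_head.
  by move=> j js; apply: DB; rewrite inE js orbT.
move=> [[-> DBi] [-> DB]]; split=> // j; rewrite inE => /predU1P[->//|].
exact: DB.
Qed.

Let measurable_card (B : set R) n : measurable B ->
  measurable [set w | (`I_n #<= S w `&` B)%card].
Proof.
move=> mB; rewrite (_ : [set w | _] = \bigcup_(s : seq J)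
    ([set w | uniq [seq X i w | i <- s] /\
              forall i, i \in s -> D i /\ B (X i w)] `&`
     [set _ | size s = n])); last first.
  apply/seteqP; split=> w /=.
    move=> /card_ge_seqP[l [ln ul lA]].
    have [s [sl sD]] : exists s, [seq X i w | i <- s] = l /\
        forall i, i \in s -> D i.
      elim: l {ln ul} lA => [|x l IHl] lA; first by exists [::].
      have [y yl|s [sl sD]] := IHl; first by apply: lA; rewrite inE yl orbT.
      have [[i Di Xi] _] := lA x (mem_head _ _).
      exists (i :: s); split=> [|j]; first by rewrite /= Xi sl.
      by rewrite inE => /predU1P[->|/sD].
    exists s => //; split; last by rewrite -ln -sl size_map.
    rewrite /= sl; split=> // i si; split; first exact: sD.
    have [|//] := lA (X i w).
    by rewrite -sl; exact: (map_f (fun i => X i w)).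
  move=> [s _ [[us sDB] sn]]; apply/card_ge_seqP.
  exists [seq X i w | i <- s]; split=> //; first by rewrite size_map.
  by move=> _ /mapP[i /sDB[Di Bi] ->]; split => //; exists i.
apply: countable_bigcupT_measurable => // s.
apply: measurableI; first exact: measurable_uniq_in.
have [->|/eqP sn] := eqVneq (size s) n.
  by rewrite (_ : [set _ | _] = setT)//; apply/seteqP; split.
by rewrite (_ : [set _ | _] = set0)//; apply/seteqP; split.
Qed.

Let measurable_finite (B : set R) : measurable B ->
  measurable [set w | finite_set (S w `&` B)].
Proof.
move=> mB; rewrite (_ : [set w | _] =
    ~` \bigcap_n [set w | (`I_n #<= S w `&` B)%card]); last first.
  apply/seteqP; split=> w /=.
    move=> /finite_setP[m Sm] /(_ m.+1 I) /=.
    by rewrite (card_le_eqr Sm) card_le_II ltnn.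
  apply: contra_notP => fS n _ /=.
  by rewrite -leq_counting /counting asboolF// leey.
by apply/measurableC/bigcap_measurableType => n _; exact: measurable_card.
Qed.

Let measurable_locally_finite : measurable [set w | locally_finite (S w)].
Proof.
rewrite (_ : [set w | _] =
    \bigcap_n [set w | finite_set (S w `&` `[- n%:R, n%:R])]); last first.
  apply/seteqP; split=> w /= lS; [by move=> n _; exact: lS|move=> a b].
  pose n := Num.bound (`|a| + `|b|).
  have abn : `|a| + `|b| < n%:R by rewrite archi_boundP// addr_ge0.
  have /= lSn := lS n I.
  apply: (@sub_finite_set _ _ (S w `&` `[- n%:R, n%:R])) => //.
  apply: setIS => x /=; rewrite !in_itv/=.
  move=> /andP[ax xb]; apply/andP; split.
    rewrite lerNl (le_trans _ (ltW abn))// (@le_trans _ _ (- a)) ?lerN2//.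
    by rewrite (le_trans (ler_norm _))// normrN lerDl.
  by rewrite (le_trans xb)// (le_trans _ (ltW abn))// (le_trans (ler_norm _))// lerDr.
by apply: bigcap_measurableType => n _; exact: measurable_finite.
Qed.

Lemma measurable_random_set : measurable_fun setT (fun w => to_configuration (S w)).
Proof.
apply: measurable_conf => B mB; apply: measurable_counting => n.
rewrite (_ : [set w | _] =
  ([set w | (`I_n #<= S w `&` B)%card] `&` [set w | locally_finite (S w)]) `|`
  ([set w | (`I_n #<= @set0 R)%card] `\` [set w | locally_finite (S w)])); last first.
  apply/seteqP; split=> w /=; rewrite /to_configuration; case: pselect => //= lS.
  - by left.
  - by rewrite set0I; right.
  - by case=> -[].
  - by rewrite set0I; case=> -[].
apply: measurableU.
  by apply: measurableI; [exact: measurable_card|exact: measurable_locally_finite].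
apply: measurableD; last exact: measurable_locally_finite.
have [h|h] := pselect (is_true (`I_n #<= @set0 R)%card).
  by rewrite (_ : [set _ | _] = setT)//; apply/seteqP; split.
by rewrite (_ : [set _ | _] = set0)//; apply/seteqP; split.
Qed.

End random_set.

Section perturbed_lattice.
Context {R : realType} d (T : measurableType d).
Context (D : set int) (Y : int -> {mfun T >-> R}).

Definition perturbed_lattice (w : T) : configuration R :=
  to_configuration [set x%:~R + Y x w | x in D].

Lemma measurable_perturbed_lattice : measurable_fun setT perturbed_lattice.
Proof.
by apply: measurable_random_set => x; apply: measurable_funD.
Qed.

HB.instance Definition _ := isMeasurableFun.Build _ _ _ _
  perturbed_lattice measurable_perturbed_lattice.

End perturbed_lattice.

Section random_variables.
Context {R : realType}.

Definition char_fun (nu : probability R R) (t : R) : R[i] :=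
  ((\int[nu]_y cos (t * y)) +i* (\int[nu]_y sin (t * y)))%C.

Definition symmetric_stable (alpha : R) (nu : probability R R) :=
  exists2 c : R, 0 < c &
    forall t, char_fun nu t = (expR (- (c * `|t| `^ alpha)))%:C%C.

Context d (T : measurableType d) (P : probability T R).

Definition mutually_independent (J : choiceType) (X : J -> {RV P >-> R}) :=
  forall (s : seq J) (A : J -> set R), uniq s ->
    (forall i, measurable (A i)) ->
    P (\bigcap_(i in [set` s]) (X i @^-1` A i)) =
    (\prod_(i <- s) P (X i @^-1` A i))%E.

Definition independent_pair d1 d2 (T1 : measurableType d1)
    (T2 : measurableType d2) (X1 : {RV P >-> T1}) (X2 : {RV P >-> T2}) :=
  forall A1 A2, measurable A1 -> measurable A2 ->
    P ((X1 @^-1` A1) `&` (X2 @^-1` A2)) =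
    (P (X1 @^-1` A1) * P (X2 @^-1` A2))%E.

Definition has_law d' (T' : measurableType d') (X : {RV P >-> T'})
    (nu : set T' -> \bar R) :=
  forall A, measurable A -> distribution P X A = nu A.

Definition uniform_in (V : set R) (U : {RV P >-> R}) :=
  has_law U (fun A => (((fine (lebesgue_measure V))^-1)%:E *
                       lebesgue_measure (A `&` V))%E).

Definition point_of (Pi : {RV P >-> configuration R}) (Z : {RV P >-> R}) :=
  {ae P, forall w, points (Pi w) (Z w)}.

End random_variables.

Definition mutually_singular d (T : measurableType d) (R : realType)
    (m1 m2 : set T -> \bar R) :=
  exists A, [/\ measurable A, m1 A = 0%E & m2 (~` A) = 0%E].

(* The tolerance properties depend only on the law [mu] of the point process.
   The process is realised on an arbitrary probability space, so that [Z] and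
   [U] may use randomness beyond that of the process. *)
Section tolerance.
Context {R : realType} (mu : probability (configuration R) R).

Definition deletion_tolerant :=
  forall d (T : measurableType d) (P : probability T R)
    (Pi : {RV P >-> configuration R}) (Z : {RV P >-> R}),
  has_law Pi mu -> point_of Pi Z ->
  distribution P (remove_point Pi Z) `<< mu.

Definition deletion_singular :=
  forall d (T : measurableType d) (P : probability T R)
    (Pi : {RV P >-> configuration R}) (Z : {RV P >-> R}),
  has_law Pi mu -> point_of Pi Z ->
  mutually_singular mu (distribution P (remove_point Pi Z)).

Definition insertion_tolerant :=
  forall V : set R, measurable V -> (0 < lebesgue_measure V < +oo)%E ->
  forall d (T : measurableType d) (P : probability T R)
    (Pi : {RV P >-> configuration R}) (U : {RV P >-> R}),
  has_law Pi mu -> uniform_in V U -> independent_pair Pi U ->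
  distribution P (add_point Pi U) `<< mu.

Definition rigid :=
  forall (c r : R), 0 < r ->
  exists2 N : configuration R -> \bar R, measurable_fun setT N &
    {ae mu, forall p, N (restrict_conf p (~` ball c r)) =
                      npoints (ball c r) p}.

End tolerance.

(* Main.v *)
Require Import Defs.
From HB Require Import structures.
From mathcomp Require Import all_boot all_order all_algebra.
From mathcomp Require Import all_classical all_reals all_analysis.
From mathcomp Require Import measurable_realfun.
From mathcomp Require Import lra ring zify.

(** The sites are X_x = x + Y_x, nu is the common law of the Y_x, and Pi_I is
    the lattice restricted to the labels in I; Pi is Pi_I with I all of Z.  The
    two regimes differ by the scale on which one site can be mistaken for
    another.

    Stable laws.  Everything about nu is read off its characteristic function
    phi through the Fejer kernel K(s) = (1 - cos s) / s^2, because the mean of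
    K(T (Y - a)) is the integral over [0, 1] of (1 - u) phi(uT) cos(uTa).
    Bounding phi there gives nu[p, q] <= C (q - p) ([stable_le_length]), and
    for alpha >= 1 the tail bound P(|Y| >= r) <= C / r ([stable_tail]).  For
    alpha < 1 two integrations by parts, where convexity of phi makes every
    term nonnegative, give a lower bound of order |a|^(-1-alpha) on the
    density away from 0 ([stable_ge_length]).

    Case alpha < 1.  Let B_k be the labels in (2^k, 2^(k+1)] and lam_k the
    uniform law on [-2^(k+1), -2^k].  By the lower bound, lam_k has a density
    of order 2^(alpha k) with respect to each X_u with u in B_k, and B_k has
    2^k elements.  Tilting Pi by the average of these densities is close to
    doing nothing, since that average is a mean of independent variables with
    expectation 1 and its variance is of order 2^(alpha k) / 2^k; but tilting
    by the density at u replaces X_u by an independent point of law lam_k.  So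
    Pi is within order 2^((alpha-1)k/2), uniformly over events, of the average
    over u in B_k of Pi_(Z - u) with a lam_k point added ([exchange]).  Doing
    this with B_k and with B_(k+1) shows that the averages over u in B_k of the
    laws of Pi_(Z - u) form a geometric Cauchy sequence; on local events their limit
    is the law of Pi, because far labels rarely visit a bounded set, hence
    they converge to it in total variation ([block_avg_close]).  Applied to
    the labels other than x, this makes Pi_(Z - x) arbitrarily close to
    Pi_(Z - x) with an independent lam_k point added, whose law is absolutely
    continuous with respect to that of Pi ([removed_null]), and makes Pi close
    to an average of laws absolutely continuous with respect to that of
    Pi_(Z - x) ([restored_null]).  Insertion tolerance follows since Lebesgue
    measure is absolutely continuous with respect to the law of X_0; deletion
    tolerance follows by a union over rational intervals isolating the deleted
    point and over its countably many possible labels.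

    Case alpha >= 1.  For a weight H on the radii, the sum of H over the
    points of Pi has variance at most the energy of H, the sum over x of
    E (H(|X_x|) - H(|x|))^2 with radii rounded down.  A linear ramp from 1 to
    0 on [r, r + L] has energy bounded uniformly in L by the tail bound, and
    two ramps on very different scales are nearly orthogonal; averaging n such
    ramps gives a weight equal to 1 up to radius r, with bounded support, and
    of energy O(1 / n) ([smooth_weight]).  Such sums are therefore nearly
    constant ([smooth_count_concentrates]), and by Borel-Cantelli a suitable
    sequence of them, minus constants, tends to 0 almost surely.  Evaluated on
    Pi with its points in a bounded set B deleted, the same limit gives, up to
    sign, the number of points deleted ([missing_counter]), which is rigidity,
    and which separates Pi from Pi minus one point. *)

Set Implicit Arguments.
Unset Strict Implicit.
Unset Printing Implicit Defensive.

Import Order.TTheory GRing.Theory Num.Theory.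
Import numFieldNormedType.Exports.
Local Open Scope classical_set_scope.
Local Open Scope ring_scope.

(** * Independence of the lattice from one perturbation *)

Section independence.
Context {R : realType} d (T : measurableType d) (P : probability T R).

Lemma joint_law d1 d2 (T1 : measurableType d1) (T2 : measurableType d2)
    (X1 : {RV P >-> T1}) (X2 : {RV P >-> T2}) :
  independent_pair X1 X2 -> forall A : set (T1 * T2), measurable A ->
  P ((fun w => (X1 w, X2 w)) @^-1` A) =
  (distribution P X1 \x distribution P X2)%E A.
Proof.
move=> indep A mA.
have mX : measurable_fun setT (fun w => (X1 w, X2 w)).
  exact: measurable_fun_pair.
pose X : {mfun T >-> (T1 * T2)%type} :=
  HB.pack (fun w => (X1 w, X2 w)) (isMeasurableFun.Build _ _ _ _ _ mX).
by symmetry; apply: (product_measure_unique (m' := distribution P X)).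
Qed.

Section families.
Variable Y : int -> {RV P >-> R}.
Hypothesis indepY : mutually_independent Y.

Definition cylinders (D : set int) : set (set T) :=
  [set E | exists (s : seq int) (A : int -> set R),
    [/\ uniq s, (forall i, i \in s -> D i), (forall i, measurable (A i)) &
        E = \bigcap_(i in [set` s]) Y i @^-1` A i]].

Lemma cylinders_setI D : setI_closed (cylinders D).
Proof.
move=> _ _ [s [A [us sD mA ->]]] [s' [A' [us' sD' mA' ->]]].
exists (undup (s ++ s')), (fun i => (if i \in s then A i else setT) `&`
  (if i \in s' then A' i else setT)); split.
- exact: undup_uniq.
- by move=> i; rewrite mem_undup mem_cat => /orP[/sD|/sD'].
- by move=> i; apply: measurableI; case: ifP.
- apply/seteqP; split=> w /=.
    move=> [h1 h2] i /=; rewrite mem_undup mem_cat => _; split.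
      by case: ifPn => // /h1.
    by case: ifPn => // /h2.
  move=> h; split=> i /= si.
    have [|] := h i; first by rewrite /= mem_undup mem_cat si.
    by rewrite /= si.
  have [|_] := h i; first by rewrite /= mem_undup mem_cat si orbT.
  by rewrite si.
Qed.

Lemma measurable_preimage d' (T' : measurableType d') (f : {mfun T >-> T'}) A :
  measurable A -> measurable (f @^-1` A).
Proof. by move=> mA; rewrite -[X in measurable X]setTI; exact: measurable_funP. Qed.

Lemma cylinders_measurable D E : <<s cylinders D >> E -> measurable E.
Proof.
apply: smallest_sub; first exact: sigma_algebra_measurable.
move=> _ [s [A [us sD mA ->]]].
by apply: fin_bigcap_measurable => // i _; exact: measurable_preimage.
Qed.

(** Mutual independence is a statement on finite families; the cylinders form a
    pi-system, and Dynkin's theorem extends it to everything they generate. *)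
Lemma indep_cylinders D j E B : ~ D j -> <<s cylinders D >> E -> measurable B ->
  (P (E `&` Y j @^-1` B) = P E * P (Y j @^-1` B))%E.
Proof.
move=> Dj DE mB.
have mYB : measurable (Y j @^-1` B) by exact: measurable_preimage.
pose T' := g_sigma_algebraType (cylinders D).
have HC (S : set T) : measurable S ->
    (P (S `&` Y j @^-1` B) = P S * P (Y j @^-1` B))%E ->
    (P (~` S `&` Y j @^-1` B) = P (~` S) * P (Y j @^-1` B))%E.
  move=> mS IH.
  rewrite setIC -setDE measureD//; last by rewrite ltey_eq fin_num_measure.
  rewrite [X in (_ - P X)%E]setIC [in LHS]IH probability_setC// muleBl ?fin_num_measure//.
  by rewrite mul1e.
have HU (F : (set T)^nat) : (forall n, measurable (F n)) -> trivIset setT F ->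
    (forall n, P (F n `&` Y j @^-1` B) = P (F n) * P (Y j @^-1` B))%E ->
    (P (\bigcup_k F k `&` Y j @^-1` B) = P (\bigcup_k F k) * P (Y j @^-1` B))%E.
  move=> mF tF IH.
  rewrite setI_bigcupl measure_bigcup//=; first last.
  - exact: trivIset_setIr.
  - by move=> n _; exact: measurableI.
  rewrite measure_bigcup// muleC -[P (Y j @^-1` B)]fineK ?fin_num_measure//.
  rewrite -nneseriesZl//.
  by apply: eq_eseriesr => n _; rewrite IH muleC fineK ?fin_num_measure.
apply: (@dynkin_induction _ T' (cylinders D)
  (fun E => P (E `&` Y j @^-1` B) = P E * P (Y j @^-1` B))%E) DE => //.
- exact: cylinders_setI.
- by rewrite setTI probability_setT mul1e.
- move=> _ [s [A [us sD mA ->]]].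
  have jns : j \notin s by apply/negP => /sD.
  have := @indepY (j :: s) (fun i => if i == j then B else A i).
  rewrite /= jns us big_cons eqxx => /(_ isT).
  rewrite (_ : \bigcap_(i in _) _ = (\bigcap_(i in [set` s]) Y i @^-1` A i) `&` Y j @^-1` B); last first.
    apply/seteqP; split=> w /=.
      move=> h; split; last by have := h j; rewrite /= eqxx; apply; rewrite inE eqxx.
      move=> i /= si; have := h i; rewrite /= inE si orbT => /(_ isT).
      by case: eqP => // ij; move: si; rewrite ij (negbTE jns).
    move=> [h1 h2] i /=; rewrite inE; case: eqP => [->//|_ /=]; exact: h1.
  move=> ->; last by move=> i; case: ifP.
  rewrite muleC; congr (_ * _)%E.
  rewrite indepY //; apply: eq_big_seq => i si.
  by case: eqP => // ij; move: si; rewrite ij (negbTE jns).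
- by move=> S mS IH; apply: HC => //; exact: (@cylinders_measurable D S mS).
- move=> F mF tF IH; apply: HU => // n; exact: (@cylinders_measurable D (F n) (mF n)).
Qed.

Lemma measurable_Y_cylinders D i : D i ->
  measurable_fun setT (Y i : g_sigma_algebraType (cylinders D) -> R).
Proof.
move=> Di _ B mB; rewrite setTI; apply: sub_sigma_algebra.
exists [:: i], (fun=> B); split=> // [j|]; first by rewrite inE => /eqP ->.
by apply/seteqP; split=> w /= h; [move=> j /=; rewrite inE => /eqP -> | apply: (h i); rewrite /= inE].
Qed.

Lemma perturbed_lattice_cylinders D A : measurable A ->
  <<s cylinders D >> (perturbed_lattice D Y @^-1` A).
Proof.
move=> mA.
pose T' := g_sigma_algebraType (cylinders D).
pose X i : T' -> R := if pselect (D i) then fun w => i%:~R + Y i w else cst 0.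
have mX i : measurable_fun setT (X i).
  rewrite /X; case: pselect => // Di.
  apply: measurable_funD => //; exact: measurable_Y_cylinders.
have := measurable_random_set D mX.
move=> /(_ measurableT A mA); rewrite setTI.
rewrite (_ : (fun w => _) = perturbed_lattice D Y) //.
apply/funext => w; rewrite /perturbed_lattice; congr to_configuration.
by apply/seteqP; split=> _ [i Di <-] /=; exists i => //; rewrite /X; case: pselect.
Qed.

(** The lattice on [D] is a function of the perturbations with labels in [D], and
    remains so on the exceptional event where it is replaced by the empty
    configuration. *)
Lemma indep_lattice D j : ~ D j -> independent_pair (perturbed_lattice D Y) (Y j).
Proof.
move=> Dj A B mA mB; apply: (@indep_cylinders D) => //.
exact: perturbed_lattice_cylinders.
Qed.

Lemma indep_points i j : i != j -> independent_pair (Y i) (Y j).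
Proof.
move=> ij A B mA mB; apply: (@indep_cylinders [set i]) => //=.
  by move=> /esym/eqP; rewrite (negbTE ij).
by have := @measurable_Y_cylinders [set i] i erefl measurableT A mA; rewrite setTI.
Qed.

End families.
End independence.

(** * Sites of the perturbed lattice *)

(** An interval of length [2 * c] contains at most [2 * n + 1] integers. *)
Lemma count_lattice_points {R : realType} (s : seq int) (y c : R) (n : nat) :
  uniq s -> 0 <= c <= n%:R ->
  (size [seq x <- s | (`|x%:~R + y| <= c)%R] <= n.*2.+1)%N.
Proof.
move=> us /andP[c0 cn].
pose a : int := Num.ceil (- c - y).
rewrite -[X in (_ <= X)%N](size_iota 0) -(size_map (fun i : nat => a + i%:Z)).
apply: uniq_leq_size; first exact: filter_uniq.
move=> x; rewrite mem_filter => /andP[+ _]; rewrite ler_norml => /andP[xl xr].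
have ax : a <= x by rewrite /a ceil_le_int; lra.
have ha : - c - y <= a%:~R by exact: ceil_ge.
apply/mapP; exists `|x - a|%N; last by lia.
rewrite mem_iota /= add0n.
have : (x - a)%:~R <= (n.*2)%:Z%:~R :> R.
  by rewrite intrB -pmulrn -muln2 natrM; lra.
rewrite ler_int; lia.
Qed.

Lemma conf_eq {R : realType} (p q : configuration R) : points p = points q -> p = q.
Proof.
case: p q => [p hp] [q hq] /= e; case: q / e hq => hq.
by rewrite (Prop_irrelevance hp hq).
Qed.

Section lattice.
Context {R : realType} d (T : measurableType d) (P : probability T R).
Variable Y : int -> {RV P >-> R}.

Definition site (x : int) (w : T) : R := x%:~R + Y x w.

Lemma measurable_site x : measurable_fun setT (site x).
Proof. by apply: measurable_funD. Qed.

HB.instance Definition _ x := isMeasurableFun.Build _ _ _ _ (site x) (measurable_site x).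

Lemma measurable_shift (x : int) (B : set R) : measurable B ->
  measurable [set y : R | B (x%:~R + y)].
Proof.
move=> mB; rewrite -[X in measurable X]setTI.
by apply: (measurable_funD (f := cst x%:~R) (g := id)).
Qed.

Lemma site_law x (B : set R) : has_law (Y x) (distribution P (Y 0)) -> measurable B ->
  P (site x @^-1` B) = distribution P (Y 0) [set y | B (x%:~R + y)].
Proof.
move=> lawx mB; rewrite -lawx //; exact: measurable_shift.
Qed.

Lemma perturbed_latticeE D w : locally_finite [set site x w | x in D] ->
  points (perturbed_lattice D Y w) = [set site x w | x in D].
Proof. by rewrite /perturbed_lattice /to_configuration => lf; case: pselect. Qed.

Hypothesis indepY : mutually_independent Y.
Hypothesis lawY : forall x, has_law (Y x) (distribution P (Y 0)).

Lemma indep_lattice_site D x : ~ D x ->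
  independent_pair (perturbed_lattice D Y) (site x : {RV P >-> R}).
Proof.
move=> Dx A B mA mB.
apply: (indep_lattice indepY Dx (A2 := [set y | B (x%:~R + y)])) => //.
exact: measurable_shift.
Qed.

Lemma indep_sites x x' : x != x' ->
  independent_pair (site x : {RV P >-> R}) (site x' : {RV P >-> R}).
Proof.
move=> xx' A B mA mB.
exact: (indep_points indepY xx' (measurable_shift x mA) (measurable_shift x' mB)).
Qed.

(** All sites have the same perturbation law, so the expectation may be taken
    over one perturbation shared by all labels; for each of its values the
    count is a count of integers in an interval. *)
Lemma expected_count (s : seq int) (n : nat) : uniq s ->
  (\sum_(x <- s) P (site x @^-1` [set z | (`|z| <= n%:R)%R]) <= n.*2.+1%:R%:E)%E.
Proof.
move=> us.
have mB : measurable [set z : R | (`|z| <= n%:R)%R].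
  rewrite (_ : [set _ | _] = `[- n%:R, n%:R]%classic); first exact: measurable_itv.
  by apply/seteqP; split=> z /=; rewrite in_itv /= ler_norml.
have mS (x : int) : measurable [set y : R | (`|x%:~R + y| <= n%:R)%R].
  by apply: (measurable_shift x mB).
pose B (x : int) := [set y : R | (`|x%:~R + y| <= n%:R)%R].
have e x : P (site x @^-1` [set z | (`|z| <= n%:R)%R]) =
    (\int[distribution P (Y 0)]_y (\1_(B x) y)%:E)%E.
  by rewrite (integral_indic _ measurableT (mS x)) setIT site_law.
rewrite (eq_bigr _ (fun x _ => e x)).
rewrite -ge0_integral_sum //; last first.
  by move=> x; apply/measurable_EFinP; apply: measurable_indic; exact: mS.
apply: (@le_trans _ _ (\int[distribution P (Y 0)]_y (n.*2.+1%:R%:E))%E); last first.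
  by rewrite integral_cst // [X in (_ * X)%E](@probability_setT _ _ _ (distribution P (Y 0))) mule1.
apply: ge0_le_integral => //.
- by move=> y _; apply: sume_ge0.
- by apply: emeasurable_sum => x; apply/measurable_EFinP; apply: measurable_indic; exact: mS.
- move=> y _; rewrite sumEFin lee_fin.
  rewrite (eq_bigr (fun x : int => ((`|x%:~R + y| <= n%:R)%R : nat)%:R)); last first.
    by move=> x _; rewrite indicE; congr (_%:R); congr nat_of_bool; apply/idP/idP => [/set_mem|h]; [by []|exact/mem_set].
  rewrite -natr_sum ler_nat (_ : \sum_(_ <- s) _ = size [seq x <- s | (`|x%:~R + y| <= n%:R)%R])%N; last first.
    by rewrite size_filter -sum1_count [RHS]big_mkcond; apply: eq_bigr => i _; case: (_ <= _).
  have := @count_lattice_points R s y n%:R n us.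
  by rewrite lexx ler0n; apply.
Qed.

Definition visits (n k : nat) : set T :=
  [set w | (`|site k%:Z w| <= n%:R)%R] `|` [set w | (`|site (- k%:Z) w| <= n%:R)%R].

Lemma measurable_near_site n x : measurable [set w | (`|site x w| <= n%:R)%R].
Proof.
rewrite (_ : [set _ | _] = site x @^-1` `[- n%:R, n%:R]).
  by apply: measurable_preimage; exact: measurable_itv.
by apply/seteqP; split=> z /=; rewrite in_itv /= ler_norml.
Qed.

Lemma measurable_visits n k : measurable (visits n k).
Proof. by apply: measurableU; exact: measurable_near_site. Qed.

Lemma visits_summable n : (\sum_(k <oo) P (visits n k) < +oo)%E.
Proof.
apply: (@le_lt_trans _ _ (n.*2.+1%:R%:E + n.*2.+1%:R%:E)%E); last by rewrite -EFinD ltry.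
apply: lime_le; first by apply: is_cvg_nneseries.
apply: nearW => N.
apply: (@le_trans _ _ (\sum_(0 <= k < N) (P [set w | (`|site k%:Z w| <= n%:R)%R] +
   P [set w | (`|site (- k%:Z) w| <= n%:R)%R]))%E).
  apply: lee_sum => k _; exact: measureU2 (measurable_near_site _ _) (measurable_near_site _ _).
rewrite big_split /=; apply: leeD.
  rewrite -(big_map (fun k : nat => k%:Z) xpredT (fun x => P [set w | (`|site x w| <= n%:R)%R])).
  apply: expected_count; rewrite map_inj_uniq ?iota_uniq // => i j; lia.
rewrite -(big_map (fun k : nat => - k%:Z) xpredT (fun x => P [set w | (`|site x w| <= n%:R)%R])).
apply: expected_count; rewrite map_inj_uniq ?iota_uniq // => i j; lia.
Qed.

(** The visits of a window have finite total expectation, so by Borel-Cantelli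
    only finitely many labels visit it; outside a small event these come from a
    fixed finite set of labels. *)
Lemma far_sites_small n (e : R) : 0 < e -> exists N : nat, exists2 Bad : set T,
  measurable Bad /\ (P Bad <= e%:E)%E &
  forall w, ~ Bad w -> forall x : int, (N <= `|x|)%N -> (n%:R < `|site x w|)%R.
Proof.
move=> e0.
have := lim_sup_set_cvg P (visits n) (measurable_visits n).
rewrite lim_sup_set_cvg0; [|exact: measurable_visits|exact: visits_summable].
move=> /(_ _)/fine_cvgP H.
have [|_ /cvgrPdist_le/(_ e e0)[N _ /(_ N) /= HN]] := H.
  by rewrite (le_lt_trans (probability_le1 _ _)) ?ltry //; apply: bigcup_measurable => k _; exact: measurable_visits.
have mB : measurable (\bigcup_(k >= N) visits n k).
  by apply: bigcup_measurable => k _; exact: measurable_visits.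
exists N, (\bigcup_(k >= N) visits n k).
  split=> //; rewrite -[P _]fineK ?fin_num_measure // lee_fin.
  by have := HN (leqnn N); rewrite sub0r normrN ger0_norm // fine_ge0.
move=> w nB x Nx; rewrite ltNge; apply/negP => xn; apply: nB.
exists `|x|%N => //=; case: x xn {Nx} => k /= xn; [by left|right].
by rewrite /= -NegzE.
Qed.

Lemma ae_locally_finite D : {ae P, forall w, locally_finite [set site x w | x in D]}.
Proof.
suff : {ae P, forall w, forall n : nat, exists N : nat, forall x : int,
    (N <= `|x|)%N -> (n%:R < `|site x w|)%R}.
  apply: filterS => w H a b.
  have [N HN] := H (Num.bound (`|a| + `|b|)).
  apply: (@sub_finite_set _ _ ((fun k => site k%:Z w) @` `I_N `|` (fun k => site (- k%:Z) w) @` `I_N)).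
    move=> _ [[x _ <-] /=]; rewrite in_itv /= => /andP[ax xb].
    have xN : (`|x| < N)%N.
      rewrite ltnNge; apply/negP => /HN; apply/negP; rewrite -leNgt.
      have : `|a| + `|b| < (Num.bound (`|a| + `|b|))%:R by rewrite archi_boundP // addr_ge0.
      have := ler_norm b; have := lerNnormlW (lexx `|a|).
      rewrite ler_norml; have := normr_ge0 a; have := normr_ge0 b; lra.
    case: x xN {ax xb} => k /= xN; [left|right]; first by exists k.
    by exists k.+1 => //; rewrite -NegzE.
  by rewrite finite_setU; split; apply: finite_image; exact: finite_II.
apply: ae_foralln => n.
exists (lim_sup_set (visits n)); split.
- apply: bigcap_measurable => // k _; apply: bigcup_measurable => j _; exact: measurable_visits.
- apply: lim_sup_set_cvg0; [exact: measurable_visits|exact: visits_summable].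
- move=> w; apply: contra_notP => nl.
  have [N nN] : exists N, ~ (\bigcup_(k >= N) visits n k) w.
    by apply/existsNP => h; apply: nl => k _; exact: h.
  exists N => x Nx; rewrite ltNge; apply/negP => xn; apply: nN.
  exists `|x|%N => //=; case: x xn {Nx} => k /= xn; [by left|right].
  by rewrite /= -NegzE.
Qed.

Lemma ae_lattice_insert (I : set int) u : I u ->
  {ae P, forall w, perturbed_lattice I Y w =
    add_pt (perturbed_lattice (I `\ u) Y w) (site u w)}.
Proof.
move=> Iu; have := ae_locally_finite I; apply: filterS => w lf.
have lf' : locally_finite [set site x w | x in I `\ u].
  by apply: locally_finite_sub lf => _ [x [Ix _] <-]; exists x.
apply: conf_eq => /=; rewrite !perturbed_latticeE //.
apply/seteqP; split => [_ [x Ix <-]|z].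
  by have [->|/eqP xu] := eqVneq x u; [right|left; exists x].
by move=> [[x [Ix _] <-]|->]; [exists x|exists u].
Qed.

(** The pairs for which inserting the second component into the first gives a
    configuration in [A]; every law of a configuration with an extra independent
    point is the measure of such an event under a product. *)
Definition insert_event (A : set (configuration R)) : set (configuration R * R) :=
  (fun pz => add_pt pz.1 pz.2) @^-1` A.

Lemma measurable_insert_event A : measurable A -> measurable (insert_event A).
Proof. by move=> mA; rewrite -[X in measurable X]setTI; exact: measurable_add_pt. Qed.

Lemma lattice_insert (I : set int) u A : I u -> measurable A ->
  P (perturbed_lattice I Y @^-1` A) =
  (distribution P (perturbed_lattice (I `\ u) Y) \x
   distribution P (site u : {RV P >-> R}))%E (insert_event A).
Proof.
move=> Iu mA.
have mI := measurable_insert_event mA.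
have nIu : ~ (I `\ u) u by move=> [_ /(_ erefl)].
rewrite -(joint_law (indep_lattice_site nIu) mI).
have mpre (D : set T) : measurable D -> forall N, measurable N -> P N = 0%E ->
    forall D', measurable D' -> D `<=` D' `|` N -> (P D <= P D')%E.
  move=> mD N mN N0 D' mD' sub.
  apply: (@le_trans _ _ (P (D' `|` N))).
    by apply: le_measure sub; apply: mem_set => //; exact: measurableU.
  by apply: (le_trans (measureU2 _ mD' mN)); rewrite [X in (_ + X <= _)%E]N0 adde0.
have [N [mN N0 NS]] := ae_lattice_insert Iu.
set D' := _ @^-1` insert_event A.
have mD' : measurable D'.
  rewrite -[X in measurable X]setTI.
  by apply: (measurable_fun_pair (measurable_funP (perturbed_lattice (I `\ u) Y)) (measurable_site u)).
have mD : measurable (perturbed_lattice I Y @^-1` A) by exact: measurable_preimage.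
have eqN w : ~ N w -> perturbed_lattice I Y w =
    add_pt (perturbed_lattice (I `\ u) Y w) (site u w).
  by move=> nN; apply: contrapT => h; apply: nN; exact: NS.
apply/eqP; rewrite eq_le; apply/andP; split.
  apply: (mpre _ mD N mN N0 _ mD') => w Aw.
  have [Nw|nNw] := pselect (N w); [by right|left].
  by rewrite /D' /insert_event /= -(eqN _ nNw).
apply: (mpre _ mD' N mN N0 _ mD) => w Aw.
have [Nw|nNw] := pselect (N w); [by right|left].
by rewrite /preimage /= (eqN _ nNw).
Qed.

Hypothesis nu_atomless : forall a : R, distribution P (Y 0) [set a] = 0%E.

(** Two sites coincide with probability the product measure of a diagonal, which
    vanishes because each section is a single point. *)
Lemma ae_sites_distinct : {ae P, forall w, injective (fun x => site x w)}.
Proof.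
suff : {ae P, forall w, forall k : nat, forall x y : int,
    @choice.unpickle (int * int)%type k = Some (x, y) -> x != y -> site x w <> site y w}.
  apply: filterS => w h x y /= exy; apply/eqP; apply: contrapT => /negP xy.
  by have := h (choice.pickle (x, y)) x y (choice.pickleK _) xy.
apply: ae_foralln => k.
case: (choice.unpickle k) => [[x y]|]; last by apply: aeW.
have [->|xy] := eqVneq x y.
  by apply: aeW => w x0 y0 [<- <-]; rewrite eqxx.
have mD : measurable [set z : R * R | z.1 = z.2].
  rewrite (_ : [set _ | _] = (fun z : R * R => z.1 - z.2) @^-1` [set 0]).
    rewrite -[X in measurable X]setTI.
    by apply: measurable_funB => //; exact: measurable_set1.
  by apply/seteqP; split=> z /= => [->|/eqP]; rewrite ?subrr // subr_eq0 => /eqP.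
exists ((fun w => (site x w, site y w)) @^-1` [set z : R * R | z.1 = z.2]); split.
- rewrite -[X in measurable X]setTI.
  by apply: (measurable_fun_pair (measurable_site x) (measurable_site y)).
- etransitivity; first exact: (joint_law (indep_sites xy) mD).
  rewrite /product_measure1 /=; apply: integral0_eq => z _.
  rewrite (_ : xsection _ z = [set z]); last first.
    by rewrite xsectionE; apply/seteqP; split=> t /= ->.
  rewrite /distribution /pushforward /= site_law //.
  rewrite (_ : [set _ | _] = [set z - y%:~R]) //.
  by apply/seteqP; split=> t /= => [<-|->]; rewrite ?addrK ?[_%:~R + t]addrC ?addrK // addrC subrK.
- move=> w /= h; apply: contrapT => exy; apply: h => _ _ [<- <-] _.
  by [].
Qed.

End lattice.

(** * Integration tools *)

Section real_integrals.
Context {R : realType}.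
Notation mu := (@lebesgue_measure R).

Lemma integrable_bounded d (T : measurableType d)
    (m : {measure set T -> \bar R}) (D : set T) (f : T -> R) (M : R) :
  measurable D -> (m D < +oo)%E -> measurable_fun D f ->
  (forall x, D x -> `|f x| <= M) -> m.-integrable D (EFin \o f).
Proof.
move=> mD Doo mf fM; apply: measurable_bounded_integrable => //.
exists M; split; first by rewrite num_real.
by move=> N MN x Dx /=; exact: le_trans (fM x Dx) (ltW MN).
Qed.

Lemma probability_integrable d (T : measurableType d) (P : probability T R)
    (f : T -> R) (M : R) : measurable_fun setT f ->
  (forall y, `|f y| <= M) -> P.-integrable setT (EFin \o f).
Proof.
move=> mf fM; apply: (@integrable_bounded _ _ _ _ _ M) => //.
by rewrite [X in (X < _)%E](@probability_setT _ _ _ P) ltry.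
Qed.

Lemma lebesgue_itv_lty (p q : R) : (mu `[p, q] < +oo)%E.
Proof. by rewrite lebesgue_measure_itv /=; case: ifP => _; rewrite -?EFinD ltry. Qed.

Lemma Rintegral_fubini d1 d2 (T1 : measurableType d1) (T2 : measurableType d2)
    (m : {sigma_finite_measure set T1 -> \bar R}) (nu : probability T2 R)
    (D : set T1) (f : T1 * T2 -> R) (M : R) :
  measurable D -> (m D < +oo)%E ->
  measurable_fun setT f -> (forall u y, D u -> `|f (u, y)| <= M) ->
  [/\ measurable_fun setT (fun y => \int[m]_(u in D) f (u, y)),
      m.-integrable D (EFin \o (fun u => \int[nu]_y f (u, y))) &
      \int[nu]_y (\int[m]_(u in D) f (u, y)) =
      \int[m]_(u in D) (\int[nu]_y f (u, y))].
Proof.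
move=> mD Doo mf fM.
pose A := D `*` [set: T2].
have mA : measurable A by exact: measurableX.
have mfu u : measurable_fun setT (fun y => f (u, y)).
  exact: (measurableT_comp mf (measurable_pair1 u)).
have mfy y : measurable_fun setT (fun u => f (u, y)).
  exact: (measurableT_comp mf (measurable_pair2 y)).
have iA : (m \x nu)%E.-integrable A (EFin \o f).
  apply: (@integrable_bounded _ _ _ _ _ M) => //; last 2 first.
  - exact: measurable_funS mf.
  - by move=> [u y] [/= uA _]; exact: fM.
  have e : (m \x nu)%E A = (m D * nu setT)%E by exact: product_measure1E.
  by rewrite [X in (X < _)%E]e [X in (_ * X)%E](@probability_setT _ _ _ nu) mule1.
have iu u : D u -> nu.-integrable setT (fun y => (f (u, y))%:E).
  move=> Du.
  apply: (@integrable_bounded _ _ nu setT (fun y => f (u, y)) M) => //; last by move=> y _; exact: fM.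
  by rewrite [X in (X < _)%E](@probability_setT _ _ _ nu) ltry.
have iy y : m.-integrable D (fun u => (f (u, y))%:E).
  apply: (@integrable_bounded _ _ m D (fun u => f (u, y)) M) => //.
  - exact: measurable_funS (mfy y).
  - by move=> u; exact: fM.
have iAT := (integrable_mkcond (EFin \o f) mA).1 iA.
have slice y : (\int[m]_x ((EFin \o f) \_ A) (x, y))%E =
    (\int[m]_(u in D) (f (u, y))%:E)%E.
  rewrite [RHS]integral_mkcond; apply: eq_integral => x _.
  by rewrite !patchE /A in_setX in_setT andbT.
split.
- have := measurable_fubini_G iAT; rewrite /fubini_G => mG.
  apply: (@measurableT_comp _ _ _ _ _ _ fine _ (fun y => (\int[m]_(u in D) (f (u, y))%:E)%E)).
    by [].
  by apply: eq_measurable_fun mG => y _; rewrite slice.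
- have iF := integrable_fubini_F iAT.
  apply/(integrable_mkcond _ mD); apply: eq_integrable iF => // u _.
  rewrite /fubini_F patchE; case: ifPn => uA.
    rewrite /= /Rintegral fineK; last first.
      by apply: integrable_fin_num (iu u _) => //; move/set_mem: uA.
    by apply: eq_integral => y _; rewrite patchE /A in_setX uA in_setT.
  by apply: integral0_eq => y _; rewrite patchE /A in_setX (negbTE uA).
have := Fubini iAT.
rewrite /fubini_F /fubini_G => FF.
rewrite /Rintegral.
rewrite (_ : (\int[nu]_y (fine (\int[m]_(u in D) (f (u, y))%:E))%:E)%E =
   (\int[nu]_y \int[m]_x ((EFin \o f) \_ A) (x, y))%E); last first.
  apply: eq_integral => y _; rewrite slice fineK //.
  exact: integrable_fin_num (iy y).
rewrite -FF [in RHS]integral_mkcond; congr fine.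
apply: eq_integral => u _; rewrite patchE.
case: ifPn => [uA|uA].
  rewrite fineK; last first.
    by apply: integrable_fin_num (iu u _) => //; move/set_mem: uA.
  by apply: eq_integral => y _; rewrite !patchE /A in_setX uA in_setT.
apply: integral0_eq => y _.
by rewrite patchE /A in_setX (negbTE uA).
Qed.

Lemma FTC2 (f F : R -> R) (a b : R) : a < b ->
  (forall x, a <= x <= b -> is_derive x 1 F (f x)) ->
  {within `[a, b], continuous f} ->
  \int[mu]_(x in `[a, b]) f x = F b - F a.
Proof.
move=> ab dF cf.
have cF x : a <= x <= b -> {for x, continuous F}.
  move=> /dF dFx; apply: differentiable_continuous; apply/derivable1_diffP.
  exact: ex_derive.
rewrite /Rintegral (continuous_FTC2 ab cf (F := F)) //.
  split.
  - move=> x /[!in_itv]/= /andP[/ltW ax /ltW xb]; apply: ex_derive; apply: dF; exact/andP.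
  - by apply: cvg_at_right_filter; apply: cF; rewrite lexx ltW.
  - by apply: cvg_at_left_filter; apply: cF; rewrite lexx ltW.
move=> x /[!in_itv]/= /andP[/ltW ax /ltW xb].
have dFx : is_derive x 1 F (f x) by apply: dF; exact/andP.
by rewrite derive1E derive_val.
Qed.

Lemma continuous_itv_integrable (f : R -> R) (a b : R) :
  {within `[a, b], continuous f} -> mu.-integrable `[a, b] (EFin \o f).
Proof. by move=> cf; apply: continuous_compact_integrable => //; exact: segment_compact. Qed.

Lemma abs_sin_le (x : R) : `|sin x| <= `|x|.
Proof.
wlog x0 : x / 0 <= x.
  move=> h; have [/h//|/ltW x0] := leP 0 x.
  by rewrite -normrN -sinN -(normrN x); apply: h; rewrite oppr_ge0.
move: x0; rewrite le_eqVlt => /predU1P[<-|x0]; first by rewrite sin0.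
have [//|z _] := @MVT R sin cos 0 x x0.
  by apply: continuous_subspaceT => y; exact: continuous_sin.
rewrite sin0 !subr0 => ->; rewrite normrM ler_piMl // ler_norml.
by rewrite cos_geN1 cos_le1.
Qed.

Lemma cos_le_sq (x : R) : 1 - cos x <= x ^+ 2.
Proof.
have -> : cos x = 1 - 2 * sin (x / 2) ^+ 2.
  rewrite [in LHS](splitr x) cosD -!expr2 cos2sin2; ring.
have : sin (x / 2) ^+ 2 <= (x / 2) ^+ 2.
  rewrite -(real_normK (num_real (sin _))) -(real_normK (num_real (x / 2))).
  by rewrite lerXn2r ?nnegrE //; exact: abs_sin_le.
have -> : (x / 2) ^+ 2 = x ^+ 2 / 4 by field.
by have := sqr_ge0 x; lra.
Qed.

End real_integrals.

(** * The Fejer kernel *)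

Section fejer_kernel.
Context {R : realType}.
Notation mu := (@lebesgue_measure R).

(** The integral of [(1 - u) * cos (u * s)] over the unit interval is
    [(1 - cos s) / s ^+ 2]; the integral form has no singularity at 0 and is the
    one that Fubini's theorem applies to. *)
Definition fejer (s : R) : R := \int[mu]_(u in `[0, 1]) ((1 - u) * cos (u * s)).

Lemma continuous_fejer_integrand (s : R) : continuous (fun u : R => (1 - u) * cos (u * s)).
Proof.
move=> u; apply: cvgM; first by apply: cvgB; [exact: cvg_cst|exact: cvg_id].
apply: continuous_cvg; first exact: continuous_cos.
by apply: cvgM; [exact: cvg_id|exact: cvg_cst].
Qed.

Lemma fejer_integrable (s : R) :
  mu.-integrable `[0, 1] (EFin \o (fun u : R => (1 - u) * cos (u * s))).
Proof.
apply: continuous_itv_integrable; apply: continuous_subspaceT.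
exact: continuous_fejer_integrand.
Qed.

Lemma fejerE (s : R) : s != 0 -> fejer s = (1 - cos s) / s ^+ 2.
Proof.
move=> s0.
pose F (u : R) := (1 - u) * sin (u * s) / s - cos (u * s) / s ^+ 2.
have dF (x : R) : 0 <= x <= 1 -> is_derive x 1 F ((1 - x) * cos (x * s)).
  by move=> _; apply: is_derive_eq; rewrite /GRing.scale /=; field.
rewrite /fejer (FTC2 ltr01 dF).
  by rewrite /F mul1r mul0r subrr sin0 cos0; field.
apply: continuous_subspaceT; exact: continuous_fejer_integrand.
Qed.

Lemma fejer0 : fejer 0 = 2^-1.
Proof.
pose F (u : R) := u - u ^+ 2 / 2.
have dF (x : R) : 0 <= x <= 1 -> is_derive x 1 F ((1 - x) * cos (x * 0)).
  by move=> _; rewrite mulr0 cos0; apply: is_derive_eq; rewrite /GRing.scale /=; field.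
rewrite /fejer (FTC2 ltr01 dF); first by rewrite /F; field.
apply: continuous_subspaceT; exact: continuous_fejer_integrand.
Qed.

Lemma fejer_ge0 s : 0 <= fejer s.
Proof.
have [->|s0] := eqVneq s 0; first by rewrite fejer0 invr_ge0.
by rewrite fejerE // mulr_ge0 ?invr_ge0 ?sqr_ge0 // subr_ge0 cos_le1.
Qed.

Lemma fejer_le s : fejer s <= 4 / (1 + s ^+ 2).
Proof.
have s2 := sqr_ge0 s.
rewrite ler_pdivlMr; last by lra.
have [->|s0] := eqVneq s 0; first by rewrite fejer0 expr0n /=; lra.
have s20 : 0 < s ^+ 2 by rewrite exprn_even_gt0.
rewrite fejerE // mulrAC ler_pdivrMr //.
have h1 := cos_le_sq s; have h2 := cos_geN1 s; have h3 := cos_le1 s.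
have [s1|s1] := leP (s ^+ 2) 1; nra.
Qed.

Lemma fejer_le_half s : fejer s <= 2^-1.
Proof.
rewrite -fejer0; apply: le_Rintegral => //; [exact: fejer_integrable..|].
move=> u; rewrite /= in_itv /= => /andP[u0 u1].
by rewrite mulr0 cos0 mulr1 ler_piMr ?cos_le1 // subr_ge0.
Qed.

Lemma cos_decr_le (x y : R) : 0 <= x -> x <= y -> y <= 2 -> cos y <= cos x.
Proof.
move=> x0 xy y2; move: xy; rewrite le_eqVlt => /predU1P[->//|xy].
have p2 : 2 <= pi :> R by have := @pi_ge2 R.
by rewrite ltW // ltr_cos // in_itv /=; apply/andP; split; lra.
Qed.

Lemma fejer_ge s : `|s| <= 1 -> cos 1 / 2 <= fejer s.
Proof.
move=> s1.
have cl : continuous (fun u : R => (1 - u) * cos 1).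
  move=> u; apply: cvgM; last exact: cvg_cst.
  by apply: cvgB; [exact: cvg_cst|exact: cvg_id].
have -> : cos 1 / 2 = \int[mu]_(u in `[0, 1]) ((1 - u) * cos 1) :> R.
  pose F (u : R) := (u - u ^+ 2 / 2) * cos 1.
  have dF (x : R) : 0 <= x <= 1 -> is_derive x 1 F ((1 - x) * cos 1).
    by move=> _; apply: is_derive_eq; rewrite /GRing.scale /=; field.
  rewrite (FTC2 ltr01 dF); first by rewrite /F; field.
  apply: continuous_subspaceT; exact: cl.
apply: le_Rintegral => //.
- apply: continuous_itv_integrable; apply: continuous_subspaceT; exact: cl.
- exact: fejer_integrable.
move=> u; rewrite /= in_itv /= => /andP[u0 u1].
rewrite ler_wpM2l ?subr_ge0 //.
have -> : cos (u * s) = cos `|u * s|.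
  by have [h|h] := leP 0 (u * s); [rewrite ger0_norm|rewrite ltr0_norm // cosN].
apply: cos_decr_le => //; last by lra.
by rewrite normrM ger0_norm // mulr_ile1.
Qed.

Variable nu : probability R R.

Lemma measurable_cos : measurable_fun setT (@cos R).
Proof. by apply: continuous_measurable_fun => y; exact: continuous_cos. Qed.

Lemma measurable_sin : measurable_fun setT (@sin R).
Proof. by apply: continuous_measurable_fun => y; exact: continuous_sin. Qed.

Lemma cos_le1_abs (x : R) : `|cos x| <= 1.
Proof. by rewrite ler_norml cos_geN1 cos_le1. Qed.

Lemma sin_le1_abs (x : R) : `|sin x| <= 1.
Proof. by rewrite ler_norml sin_geN1 sin_le1. Qed.

Variable phi : R -> R.
Hypothesis cos_nu : forall t, \int[nu]_y cos (t * y) = phi t.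
Hypothesis sin_nu : forall t, \int[nu]_y sin (t * y) = 0.

(** The sine transform vanishes by symmetry of the law, so only the product of
    cosines survives in the addition formula. *)
Lemma char_shift t a : \int[nu]_y cos (t * (y - a)) = phi t * cos (t * a).
Proof.
have mt : measurable_fun setT (fun y : R => t * y).
  by apply: measurable_funM.
have -> : (fun y => cos (t * (y - a))) =
    (fun y => cos (t * a) * cos (t * y) + sin (t * a) * sin (t * y)).
  by apply/funext => y; rewrite mulrBr cosB; ring.
have ic : nu.-integrable setT (EFin \o (fun y => cos (t * y))).
  apply: (@probability_integrable _ _ _ nu _ 1); last by move=> y; exact: cos_le1_abs.
  exact: measurableT_comp measurable_cos mt.
have is' : nu.-integrable setT (EFin \o (fun y => sin (t * y))).
  apply: (@probability_integrable _ _ _ nu _ 1); last by move=> y; exact: sin_le1_abs.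
  exact: measurableT_comp measurable_sin mt.
rewrite RintegralD //=.
- by rewrite !RintegralZl // cos_nu sin_nu mulr0 addr0 mulrC.
- exact: (integrableZl measurableT (cos (t * a)) ic).
- exact: (integrableZl measurableT (sin (t * a)) is').
Qed.

(** Fubini's theorem turns the mean of the kernel into an integral of the
    characteristic function over a compact interval, from which the mass near
    [a] at scale [T^-1] can be bounded on both sides. *)
Lemma fejer_expectation (T a : R) :
  measurable_fun setT (fun y : R => fejer (T * (y - a))) /\
  \int[nu]_y fejer (T * (y - a)) =
  \int[mu]_(u in `[0, 1]) ((1 - u) * (phi (u * T) * cos (u * T * a))).
Proof.
pose f (z : measurableTypeR R * R) : R := (1 - z.1) * cos (z.1 * (T * (z.2 - a))).
have mf : measurable_fun setT f.
  apply: measurable_funM.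
    by apply: measurable_funB.
  apply: measurableT_comp measurable_cos _.
  apply: measurable_funM => //.
  by apply: measurable_funM => //; exact: measurable_funB.
have [|m1 _ e1] := @Rintegral_fubini _ _ _ _ _ mu nu `[0, 1]%classic f 1 (measurable_itv _) (lebesgue_itv_lty 0 1) mf.
  move=> u y; rewrite /= in_itv /= => /andP[u0 u1]; rewrite /f /= normrM mulr_ile1 //; last exact: cos_le1_abs.
  by rewrite ger0_norm; lra.
split; first exact: m1.
rewrite e1; apply: eq_Rintegral => u _; rewrite /f /=.
under eq_Rintegral do rewrite mulrA.
rewrite RintegralZl // ?char_shift //.
apply: (@probability_integrable _ _ _ nu _ 1); last by move=> y; exact: cos_le1_abs.
apply: measurableT_comp measurable_cos _.
by apply: measurable_funM => //; exact: measurable_funB.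
Qed.

End fejer_kernel.

(** * Upper bounds for stable laws *)

Section stable_laws.
Context {R : realType}.
Notation mu := (@lebesgue_measure R).
Variable nu : probability R R.
Variables alpha c : R.
Hypothesis alpha0 : 0 < alpha.
Hypothesis c0 : 0 < c.

Definition stable_cf (t : R) : R := expR (- (c * `|t| `^ alpha)).
Local Notation phi := stable_cf.

Hypothesis cos_nu : forall t, \int[nu]_y cos (t * y) = phi t.
Hypothesis sin_nu : forall t, \int[nu]_y sin (t * y) = 0.

Lemma stable_cf_le1 t : phi t <= 1.
Proof. by rewrite -expR0 ler_expR oppr_le0 mulr_ge0 ?powR_ge0 // ltW. Qed.

Lemma stable_cf_ge0 t : 0 <= phi t.
Proof. exact: expR_ge0. Qed.

Lemma measurable_stable_cf : measurable_fun setT phi.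
Proof.
apply: measurableT_comp; first exact: measurable_expR.
apply: measurableT_comp => //.
apply: measurable_funM => //.
by apply: (measurableT_comp (measurable_powR alpha)).
Qed.

(** One term of the exponential series, of order larger than [2 / alpha], already
    beats the square of [1 + t]. *)
Lemma stable_cf_decay : exists2 C : R, 0 < C & forall t : R, 0 <= t -> phi t <= C / (1 + t) ^+ 2.
Proof.
have [m mb] : exists m : nat, 2 / alpha < m%:R.
  by exists (Num.bound (2 / alpha)); rewrite archi_boundP // divr_ge0 // ltW.
have mE : 2 <= alpha * m.+1%:R.
  move: mb; rewrite ltr_pdivrMr // => h.
  have hm : m.+1%:R = m%:R + 1 :> R by rewrite natr1.
  by apply: (le_trans (ltW h)); rewrite hm mulrDr mulr1 [leLHS]mulrC lerDl ltW.
have [K KE K0] : exists2 K : R, K = (m.+1)`!%:R / c ^+ m.+1 & 0 < K.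
  by eexists; [reflexivity|rewrite divr_gt0 // ?exprn_gt0 // ltr0n fact_gt0].
exists (4 * (1 + K)); first by lra.
move=> t t0; rewrite ler_pdivlMr; last by rewrite exprn_gt0; lra.
have [t1|t1] := leP t 1.
  have h1 := stable_cf_le1 t; have h2 := stable_cf_ge0 t.
  have : (1 + t) ^+ 2 <= 4 by nra.
  have := sqr_ge0 (1 + t); nra.
have x0 : 0 <= c * t `^ alpha by rewrite mulr_ge0 ?powR_ge0 // ltW.
have := expR_ge1Dxn m x0.
rewrite exprMn -[(t `^ alpha) ^+ _]powR_mulrn ?powR_ge0 // -powRrM => h.
have t2 : t ^+ 2 <= t `^ (alpha * m.+1%:R).
  by rewrite -powR_mulrn //; apply: ler_powR => //; exact: ltW.
have t20 : 0 < t ^+ 2 by rewrite exprn_gt0 //; lra.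
have {}h : t ^+ 2 / K <= expR (c * t `^ alpha).
  apply: le_trans h; rewrite KE invf_div mulrA [t ^+ 2 * _]mulrC.
  rewrite ler_wpDl // ler_pM2r ?invr_gt0 ?ltr0n ?fact_gt0 //.
  by rewrite ler_pM2l // exprn_gt0.
rewrite /phi ger0_norm // expRN.
have h0 : 0 < t ^+ 2 / K by rewrite divr_gt0.
have e0 := lt_le_trans h0 h.
apply: (@le_trans _ _ ((t ^+ 2 / K)^-1 * (1 + t) ^+ 2)).
  by rewrite ler_pM2r ?exprn_gt0 //; [rewrite lef_pV2 ?posrE | lra].
rewrite invf_div mulrAC ler_pdivrMr //.
have h4 : (1 + t) ^+ 2 <= 4 * t ^+ 2 by nra.
have := ler_wpM2l (ltW K0) h4; nra.
Qed.

Definition fejer_transform (T a : R) : R :=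
  \int[mu]_(u in `[0, 1]) ((1 - u) * (phi (u * T) * cos (u * T * a))).

Lemma measurable_dilation_cf T : measurable_fun (setT : set (measurableTypeR R)) (fun u => phi (u * T)).
Proof.
apply: (measurableT_comp measurable_stable_cf).
by apply: measurable_funM.
Qed.

Lemma measurable_transform_integrand T a :
  measurable_fun (setT : set (measurableTypeR R)) (fun u => (1 - u) * (phi (u * T) * cos (u * T * a))).
Proof.
apply: measurable_funM; first exact: measurable_funB.
apply: measurable_funM; first exact: measurable_dilation_cf.
apply: (measurableT_comp measurable_cos).
by do 2 apply: measurable_funM => //.
Qed.

Lemma transform_integrand_le T a u : 0 <= u <= 1 ->
  `|(1 - u) * (phi (u * T) * cos (u * T * a))| <= phi (u * T).
Proof.
move=> /andP[u0 u1]; rewrite !normrM mulrCA ger0_norm ?stable_cf_ge0 // ler_piMr ?stable_cf_ge0 //.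
by rewrite mulr_ile1 ?cos_le1_abs // ger0_norm; lra.
Qed.

Lemma transform_integrable T a (p q : R) : 0 <= p -> q <= 1 -> mu.-integrable `[p, q]
  (EFin \o (fun u => (1 - u) * (phi (u * T) * cos (u * T * a)))).
Proof.
move=> p0 q1.
apply: (@integrable_bounded _ _ _ mu _ (fun u => (1 - u) * (phi (u * T) * cos (u * T * a))) 1) => //.
- exact: lebesgue_itv_lty.
- exact: measurable_funS (measurable_transform_integrand T a).
move=> u; rewrite /= in_itv /= => /andP[pu uq].
by apply: le_trans (stable_cf_le1 (u * T)); apply: transform_integrand_le; apply/andP; split; lra.
Qed.

Lemma fejer_expectationE T a : \int[nu]_y fejer (T * (y - a)) = fejer_transform T a.
Proof. by have [] := fejer_expectation cos_nu sin_nu T a. Qed.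

Lemma fejer_nu_integrable T a : nu.-integrable setT (EFin \o (fun y => fejer (T * (y - a)))).
Proof.
apply: (@probability_integrable _ _ _ nu _ 2^-1).
  by have [] := fejer_expectation cos_nu sin_nu T a.
by move=> y; rewrite ger0_norm ?fejer_ge0 // fejer_le_half.
Qed.

Lemma transform_le : exists2 C : R, 0 < C & forall T a : R, 0 < T -> fejer_transform T a <= C / T.
Proof.
have [C C0 hC] := stable_cf_decay; exists C => // T a T0.
pose F (u : R) := C * u / (1 + u * T).
have pos (u : R) : 0 <= u -> 0 < 1 + u * T by move=> u0; have := mulr_ge0 u0 (ltW T0); lra.
have dF (u : R) : 0 <= u <= 1 -> is_derive u 1 F (C / (1 + u * T) ^+ 2).
  move=> /andP[u0 u1]; have p0 := pos u u0.
  have n0 : (fun u : R => 1 + u * T) u != 0 by rewrite gt_eqF.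
  have d1 : is_derive u 1 (fun u : R => 1 + u * T) T.
    by apply: is_derive_eq; rewrite /GRing.scale /=; ring.
  have d2 := @is_deriveV R (fun u : R => 1 + u * T) u T 1 n0 d1.
  have d3 : is_derive u 1 (fun u : R => C * u) C.
    by apply: is_derive_eq; rewrite /GRing.scale /=; ring.
  have := is_deriveM d3 d2 => d4; apply: is_derive_eq d4 _.
  by rewrite /GRing.scale /=; field.
have cf : {within `[0, 1], continuous (fun u : R => C / (1 + u * T) ^+ 2)}.
  apply: continuous_in_subspaceT => u /set_mem; rewrite /= in_itv /= => /andP[u0 _].
  apply: cvgM; first exact: cvg_cst.
  apply: cvgV; first by rewrite expf_neq0 // gt_eqF // pos.
  rewrite !expr2; apply: cvgM; (apply: cvgD; first exact: cvg_cst);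
    (apply: cvgM; [exact: cvg_id|exact: cvg_cst]).
apply: (@le_trans _ _ (F 1 - F 0)).
  rewrite -(FTC2 ltr01 dF cf); apply: le_Rintegral => //.
  - exact: transform_integrable.
  - exact: continuous_itv_integrable.
  move=> u; rewrite /= in_itv /= => /andP[u0 u1].
  apply: le_trans (ler_norm _) _; apply: le_trans (hC (u * T) _).
    by apply: transform_integrand_le; rewrite u0.
  by rewrite mulr_ge0 // ltW.
rewrite /F mulr0 mul0r subr0 mulr1 mul1r ler_pM2l // lef_pV2 ?posrE //; lra.
Qed.

Lemma prob_le_Rintegral (A : set R) (f : R -> R) (k : R) : measurable A ->
  nu.-integrable setT (EFin \o f) -> (forall y, 0 <= f y) -> 0 <= k ->
  (forall y, A y -> k <= f y) -> k * fine (nu A) <= \int[nu]_y f y.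
Proof.
move=> mA fi f0 k0 kf.
have -> : k * fine (nu A) = \int[nu]_y (k * \1_A y).
  rewrite RintegralZl //.
    by rewrite /Rintegral integral_indic // setIT.
  apply: (@probability_integrable _ _ _ nu _ 1); first exact: measurable_indic.
  by move=> y; rewrite indicE; case: (_ \in _); rewrite ?normr1 ?normr0.
apply: le_Rintegral => //.
  apply: (@probability_integrable _ _ _ nu _ k).
    by apply: measurable_funM => //; exact: measurable_indic.
  by move=> y; rewrite normrM (ger0_norm k0) ler_piMr // indicE; case: (_ \in _); rewrite ?normr1 ?normr0.
move=> y _; rewrite indicE; case: (boolP (y \in A)) => [/set_mem Ay|_]; rewrite ?mulr1 ?mulr0 //.
exact: kf.
Qed.

(** Take the kernel centred at the middle of the interval with [T] the inverse
    length: it is bounded below on the interval, while its mean is at most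
    [C / T]. *)
Lemma stable_le_length : exists2 C : R, 0 < C &
  forall p q : R, p < q -> fine (nu `[p, q]%classic) <= C * (q - p).
Proof.
have [C C0 hC] := transform_le.
have k0 : 0 < cos 1 / 2 :> R by rewrite divr_gt0 // cos1_gt0.
exists (C / (cos 1 / 2)); first by rewrite divr_gt0.
move=> p q pq; rewrite mulrAC ler_pdivlMr // mulrC.
have T0 : 0 < (q - p)^-1 by rewrite invr_gt0 subr_gt0.
have := hC _ ((p + q) / 2) T0; rewrite invrK; apply: le_trans.
rewrite -fejer_expectationE; apply: prob_le_Rintegral => //.
- exact: fejer_nu_integrable.
- by move=> y; exact: fejer_ge0.
- exact: ltW.
move=> y; rewrite /= in_itv /= => /andP[py yq]; apply: fejer_ge.
rewrite normrM gtr0_norm // mulrC ler_pdivrMr ?subr_gt0 // mul1r ler_norml; apply/andP; split; lra.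
Qed.

Lemma stable_atomless a : nu [set a] = 0%E.
Proof.
have [C C0 hC] := stable_le_length.
have nf : (nu [set a]) \is a fin_num by exact: fin_num_measure.
rewrite -(fineK nf); congr EFin; apply/eqP; rewrite eq_le; apply/andP; split; last exact: fine_ge0.
apply/ler_addgt0Pr => e e0; rewrite add0r.
have eC : 0 < e / C by rewrite divr_gt0.
apply: (@le_trans _ _ (fine (nu `[a, a + e / C]%classic))).
  apply: fine_le => //; first exact: fin_num_measure.
  apply: le_measure; [exact: mem_set|exact: mem_set|].
  by move=> x /= ->; rewrite in_itv /= lexx lerDl ltW.
rewrite [leRHS](_ : e = C * (a + e / C - a)); last by field; rewrite gt_eqF.
by apply: hC; rewrite ltrDl.
Qed.

(** The kernel falls below its value [2^-1] at 0 by a fixed amount once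
    [T * `|y|] is at least 3, and the mean of that defect is at most
    [c * T `^ alpha]; with [T = 3 / r] and [alpha] at least 1 this is of order
    [r^-1]. *)
Lemma stable_tail : 1 <= alpha ->
  exists2 C : R, 0 < C & forall r : R, 1 <= r -> fine (nu [set y | r <= `|y|]) <= C / r.
Proof.
move=> alpha1.
exists (4 * c * 3 `^ alpha); first by rewrite !mulr_gt0 // powR_gt0.
move=> r r1.
have [T TE T0] : exists2 T : R, T = 3 / r & 0 < T.
  by eexists; [reflexivity|rewrite divr_gt0 //; lra].
have Ta : T `^ alpha <= 3 `^ alpha / r.
  rewrite TE powRM // ?invr_ge0; last by lra.
  rewrite ler_pM2l ?powR_gt0 // -powR_inv1; last by lra.
  rewrite -powRrM mulN1r powRN powR_inv1; last by lra.
  have r0 : 0 < r by lra.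
  rewrite lef_pV2 ?posrE ?powR_gt0 //.
  rewrite -[leLHS]powRr1; last by lra.
  exact: ler_powR.
have i1 : nu.-integrable setT (EFin \o (fun y => 2^-1 - fejer (T * (y - 0)))).
  apply: (@probability_integrable _ _ _ nu _ 2^-1).
    by apply: measurable_funB => //; have [] := fejer_expectation cos_nu sin_nu T 0.
  by move=> y; have := fejer_ge0 (T * (y - 0)); have := fejer_le_half (T * (y - 0));
    rewrite ler_norml => ? ?; apply/andP; split; lra.
have h1 : \int[nu]_y (2^-1 - fejer (T * (y - 0))) <= c * T `^ alpha.
  rewrite RintegralB //; first last.
  - exact: fejer_nu_integrable.
  - by apply: (@probability_integrable _ _ _ nu _ 2^-1) => // y; rewrite ger0_norm.
  rewrite fejer_expectationE.
  rewrite [X in X - _](_ : _ = \int[mu]_(u in `[0, 1]) ((1 - u) * cos (u * 0))); last first.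
    rewrite -/(fejer 0) fejer0 Rintegral_cst // [X in fine X](@probability_setT _ _ _ nu) /=.
    by rewrite mulr1.
  rewrite -RintegralB //; [|exact: fejer_integrable|exact: transform_integrable].
  have -> : c * T `^ alpha = \int[mu]_(u in `[0, 1]) (c * T `^ alpha).
    have m1 : mu `[0, 1]%classic = 1%E.
      by rewrite lebesgue_measure_itv /= lte_fin ltr01 oppr0 adde0.
    by rewrite Rintegral_cst // [X in fine X]m1 mulr1.
  apply: le_Rintegral => //.
  - by apply: eq_integrable (integrableB _ (fejer_integrable 0) (transform_integrable T 0 (lexx 0) (lexx 1))).
  - apply: continuous_itv_integrable; apply: continuous_subspaceT => u; exact: cvg_cst.
  move=> u; rewrite /= in_itv /= => /andP[u0 u1].
  rewrite !mulr0 cos0 !mulr1 -[X in X - _]mulr1 -mulrBr.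
  have : 1 - phi (u * T) <= c * T `^ alpha.
    apply: (@le_trans _ _ (c * (u * T) `^ alpha)).
      have := expR_ge1Dx (- (c * `|u * T| `^ alpha)); rewrite -/(phi (u * T)).
      have uT0 : 0 <= u * T by apply: mulr_ge0 => //; exact: ltW.
      by rewrite ger0_norm // => h1; rewrite lerBlDl -lerBlDr.
    rewrite ler_pM2l // ge0_ler_powR ?nnegrE ?mulr_ge0 ?(ltW T0) ?(ltW alpha0) //.
    by rewrite ler_piMl // ltW.
  apply: le_trans; rewrite ler_piMl // ?subr_ge0 ?stable_cf_le1 //; by rewrite gerBl.
have h2 : 4^-1 * fine (nu [set y | r <= `|y|]) <= \int[nu]_y (2^-1 - fejer (T * (y - 0))).
  apply: prob_le_Rintegral => //.
  - have mn : measurable_fun setT (fun y : R => `|y|) by [].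
    rewrite (_ : [set _ | _] = (fun y : R => `|y|) @^-1` `[r, +oo[).
      by rewrite -[X in measurable X]setTI; exact: mn.
    by apply/seteqP; split=> y /=; rewrite in_itv /= andbT.
  - by move=> y; rewrite subr_ge0 fejer_le_half.
  move=> y /= ry; rewrite subr0.
  have Ty : 9 <= (T * y) ^+ 2.
    have : 3 <= `|T * y|.
      by rewrite normrM (gtr0_norm T0) TE mulrAC ler_pdivlMr; [rewrite ler_pM2l|lra].
    rewrite -(real_normK (num_real (T * y))) => h; nra.
  have n0 : T * y != 0 by apply/eqP => e; move: Ty; rewrite e expr0n /=; lra.
  rewrite fejerE //.
  have : (1 - cos (T * y)) / (T * y) ^+ 2 <= 2 / 9.
    rewrite ler_pdivrMr; last by lra.
    have := cos_geN1 (T * y); lra.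
  lra.
have := le_trans h2 h1; have := ler_wpM2l (ltW c0) Ta.
rewrite -!mulrA; lra.
Qed.

End stable_laws.

(** * Lower bound on the Fejer transform below exponent one *)

Section stable_lower_bound.
Context {R : realType}.
Notation mu := (@lebesgue_measure R).

Lemma is_derive_powR (a t : R) : 0 < t ->
  is_derive t 1 (fun s : R => s `^ a) (a * t `^ (a - 1)).
Proof.
move=> t0; apply: DeriveDef; first by apply: derivable_powR; rewrite in_itv /= t0.
by rewrite -derive1E; apply: powR_derive1; rewrite in_itv /= t0.
Qed.

Lemma is_derive_parts (p q r : R -> R) (T b u : R) : b != 0 ->
  is_derive u 1 p (T * q u) -> is_derive u 1 q (T * r u) ->
  is_derive u 1 (fun u => (1 - u) * p u * sin (u * b) / b -
      (- p u + (1 - u) * T * q u) * (1 - cos (u * b)) / b ^+ 2)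
    ((1 - u) * (p u * cos (u * b)) -
      (- 2 * T * q u + (1 - u) * T ^+ 2 * r u) * (1 - cos (u * b)) / b ^+ 2).
Proof.
move=> b0 dp dq; apply: is_derive_eq; rewrite /GRing.scale /=; field.
by [].
Qed.

(** Two integrations by parts against [cos (u * b)], stopped at [eps] because the
    characteristic function is singular at 0.  The antiderivative [1 - cos] is
    chosen in the second one so that the new integrand keeps the sign of the
    second derivative. *)
Lemma integral_parts (p q r : R -> R) (T b eps : R) : b != 0 ->
  (forall u : R, 0 < u -> is_derive u 1 p (T * q u)) ->
  (forall u : R, 0 < u -> is_derive u 1 q (T * r u)) ->
  (forall u : R, 0 < u -> {for u, continuous p}) ->
  (forall u : R, 0 < u -> {for u, continuous q}) ->
  (forall u : R, 0 < u -> {for u, continuous r}) ->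
  0 < eps -> eps < 1 ->
  let F u := (1 - u) * p u * sin (u * b) / b -
      (- p u + (1 - u) * T * q u) * (1 - cos (u * b)) / b ^+ 2 in
  let psi2 u := (- 2 * T * q u + (1 - u) * T ^+ 2 * r u) * (1 - cos (u * b)) / b ^+ 2 in
  mu.-integrable `[eps, 1] (EFin \o psi2) /\
  \int[mu]_(u in `[eps, 1]) ((1 - u) * (p u * cos (u * b))) =
    F 1 - F eps + \int[mu]_(u in `[eps, 1]) psi2 u.
Proof.
move=> bn0 dp dq cp cq cr eps0 eps1 F psi2.
have dF (u : R) : eps <= u <= 1 -> is_derive u 1 F ((1 - u) * (p u * cos (u * b)) - psi2 u).
  move=> /andP[u0 u1]; have {}u0 : 0 < u by lra.
  exact: (@is_derive_parts p q r T b u bn0 (dp u u0) (dq u u0)).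
have ccos (u : R) : {for u, continuous (fun v : R => cos (v * b))}.
  apply: (@continuous_comp _ _ _ (fun v : R => v * b) cos); last exact: continuous_cos.
  by apply: cvgM; [exact: cvg_id|exact: cvg_cst].
have c1u (u : R) : {for u, continuous (fun v : R => 1 - v)}.
  by apply: cvgB; [exact: cvg_cst|exact: cvg_id].
have cpsi (u : R) : 0 < u -> {for u, continuous (fun u : R => (1 - u) * (p u * cos (u * b)))}.
  move=> u0; apply: cvgM; first exact: c1u.
  by apply: cvgM; [exact: cp|exact: ccos].
have cpsi2 (u : R) : 0 < u -> {for u, continuous psi2}.
  move=> u0; apply: cvgM; last exact: cvg_cst.
  apply: cvgM; last by apply: cvgB; [exact: cvg_cst|exact: ccos].
  apply: cvgD.
    by apply: cvgM; [exact: cvg_cst|exact: cq].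
  apply: cvgM; last exact: cr.
  by apply: cvgM; [exact: c1u|exact: cvg_cst].
have within (f : R -> R) : (forall u : R, 0 < u -> {for u, continuous f}) -> {within `[eps, 1], continuous f}.
  move=> cf; apply: continuous_in_subspaceT => u /set_mem; rewrite /= in_itv /= => /andP[u0 _].
  by apply: cf; lra.
have i1 := continuous_itv_integrable (within _ cpsi).
have i2 := continuous_itv_integrable (within _ cpsi2).
split=> //; apply/eqP; rewrite -subr_eq -RintegralB //; apply/eqP; apply: FTC2 => //.
by apply: within => u u0; apply: cvgB; [exact: cpsi|exact: cpsi2].
Qed.

(** Both boundary terms at [eps] vanish with [eps]: [sin] and [1 - cos]
    compensate the blow-up of the derivative [qe]. *)
Lemma boundary_term_le (T b eps pe qe K : R) : 0 < b -> 0 < T -> 0 < eps -> eps < 1 ->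
  0 <= pe <= 1 -> qe <= 0 -> - (T * qe) * eps <= K ->
  (1 - eps) * pe * sin (eps * b) / b -
      (- pe + (1 - eps) * T * qe) * (1 - cos (eps * b)) / b ^+ 2 <= (2 + K) * eps.
Proof.
move=> b0 T0 eps0 eps1 /andP[pe0 pe1] qe0 hK.
have e1 : (1 - eps) * pe * sin (eps * b) / b <= eps.
  rewrite ler_pdivrMr // -[leRHS]mul1r.
  apply: le_trans (ler_norm _) _; rewrite normrM; apply: ler_pM => //.
    have h0 : 0 <= 1 - eps by lra.
    rewrite ger0_norm ?mulr_ge0 //.
    by apply: mulr_ile1 => //; lra.
  apply: le_trans (abs_sin_le _) _; rewrite ger0_norm // mulr_ge0 //; exact: ltW.
have e2 : (1 - cos (eps * b)) / b ^+ 2 <= eps ^+ 2.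
  rewrite ler_pdivrMr ?exprn_gt0 // -exprMn; exact: cos_le_sq.
have cge : 0 <= (1 - cos (eps * b)) / b ^+ 2 by rewrite divr_ge0 ?sqr_ge0 // subr_ge0 cos_le1.
rewrite -[X in _ - X]mulrA; move: e2 cge.
set C := (1 - cos _) / _ => e2 cge.
have Tq : 0 <= - (T * qe) by rewrite -mulrN mulr_ge0 ?oppr_ge0 // ltW.
have h4 : - (- pe + (1 - eps) * T * qe) <= 1 - T * qe by nra.
have h5 : - ((- pe + (1 - eps) * T * qe) * C) <= (1 - T * qe) * eps ^+ 2.
  rewrite -mulNr; apply: ler_pM => //; nra.
have h6 : (1 - T * qe) * eps ^+ 2 <= eps + K * eps by nra.
rewrite mulrDl; lra.
Qed.

Lemma lebesgue_itvE (p q : R) : p <= q -> mu `[p, q]%classic = (q - p)%:E.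
Proof.
move=> pq; rewrite lebesgue_measure_itv /= lte_fin; case: ltP => //= qp.
by rewrite (le_anti (introT andP (conj pq qp))) subrr.
Qed.

Lemma Rintegral_ge_plateau (f : R -> R) (p q s t m : R) :
  p <= s -> s <= t -> t <= q -> 0 <= m ->
  mu.-integrable `[p, q] (EFin \o f) ->
  (forall u : R, p <= u <= q -> 0 <= f u) ->
  (forall u : R, s <= u <= t -> m <= f u) ->
  m * (t - s) <= \int[mu]_(u in `[p, q]) f u.
Proof.
move=> ps st tq m0 fi f0 fm.
have i3 : mu.-integrable `[p, q] (EFin \o \1_(`[s, t]%classic)).
  apply: (@integrable_bounded _ _ _ mu _ _ 1) => //.
  - exact: lebesgue_itv_lty.
  - by move=> u _; rewrite indicE; case: (_ \in _); rewrite ?normr1 ?normr0.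
have -> : m * (t - s) = \int[mu]_(u in `[p, q]) (m * \1_(`[s, t]%classic) u).
  rewrite RintegralZl //.
  congr (_ * _); rewrite /Rintegral integral_indic //.
  rewrite (_ : _ `&` _ = `[s, t]%classic); last first.
    apply/setIidPl => u /=; rewrite !in_itv /= => /andP[? ?]; apply/andP; split; lra.
  by rewrite [X in fine X]lebesgue_itvE.
apply: le_Rintegral => //.
  apply: (@integrable_bounded _ _ _ mu _ (fun u => m * \1_(`[s, t]%classic) u) m) => //.
  - exact: lebesgue_itv_lty.
  - by apply: measurable_funM => //; exact: measurable_indic.
  - move=> u _; rewrite normrM (ger0_norm m0) ler_piMr // indicE; case: (_ \in _); rewrite ?normr1 ?normr0 //.
move=> u; rewrite /= in_itv /= => uI.
rewrite indicE; case: (boolP (_ \in _)) => [/set_mem|_]; last first.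
  by rewrite mulr0 f0.
by rewrite /= in_itv /= mulr1; exact: fm.
Qed.

Lemma collect_errors (M X1 X2 I1 I2 C eps e : R) :
  M <= I2 -> X2 <= (2 + C) * eps -> 0 <= X1 -> - eps <= I1 ->
  (3 + C) * eps <= e -> M <= I1 + (X1 - X2 + I2) + e.
Proof. by rewrite !mulrDl; lra. Qed.

Variables alpha c : R.
Hypothesis alpha0 : 0 < alpha.
Hypothesis alpha1 : alpha < 1.
Hypothesis c0 : 0 < c.
Local Notation phi := (stable_cf alpha c).

Let g (t : R) : R := expR (- (c * t `^ alpha)).
Let g1 (t : R) : R := - (c * alpha * t `^ (alpha - 1)) * g t.
Let g2 (t : R) : R := (c * alpha * (1 - alpha) * t `^ (alpha - 2) +
  (c * alpha * t `^ (alpha - 1)) ^+ 2) * g t.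

Let g_phi (t : R) : 0 <= t -> phi t = g t.
Proof. by move=> t0; rewrite /stable_cf ger0_norm. Qed.

Let dg (t : R) : 0 < t -> is_derive t 1 g (g1 t).
Proof.
move=> t0; have d1 := @is_derive_powR alpha t t0.
have d2 : is_derive t 1 (fun s : R => - (c * s `^ alpha)) (- (c * (alpha * t `^ (alpha - 1)))).
  by apply: is_derive_eq; rewrite /GRing.scale /= ; ring.
have d3 := is_derive_expR (- (c * t `^ alpha)).
have := @is_derive1_comp _ expR (fun s : R => - (c * s `^ alpha)) t _ _ d3 d2.
by move=> d; apply: is_derive_eq d _; rewrite /g1 /g /=; ring.
Qed.

Let dg1 (t : R) : 0 < t -> is_derive t 1 g1 (g2 t).
Proof.
move=> t0; have d1 := @is_derive_powR (alpha - 1) t t0.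
have d2 := dg t0.
apply: is_derive_eq; rewrite /GRing.scale /= /g2 /g1.
rewrite (_ : alpha - 1 - 1 = alpha - 2); last by ring.
ring.
Qed.

Let dilation (f f' : R -> R) (T u : R) : is_derive (u * T) 1 f (f' (u * T)) ->
  is_derive u 1 (fun v => f (v * T)) (T * f' (u * T)).
Proof.
move=> df.
have d2 : is_derive u 1 (fun v : R => v * T) T.
  by apply: is_derive_eq; rewrite /GRing.scale /= ; ring.
have := @is_derive1_comp _ f (fun v : R => v * T) u _ _ df d2.
by move=> d; apply: is_derive_eq d _; rewrite mulrC.
Qed.

Let cg (t : R) : 0 < t -> {for t, continuous g}.
Proof.
move=> t0; apply: differentiable_continuous; apply/derivable1_diffP.
by have [] := dg t0.
Qed.

Let cpow a (t : R) : 0 < t -> {for t, continuous (fun s : R => s `^ a)}.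
Proof.
move=> t0; apply: differentiable_continuous; apply/derivable1_diffP.
by have [] := is_derive_powR a t0.
Qed.

Let cg1 (t : R) : 0 < t -> {for t, continuous g1}.
Proof.
move=> t0; apply: differentiable_continuous; apply/derivable1_diffP.
by have [] := dg1 t0.
Qed.

Let cg2 (t : R) : 0 < t -> {for t, continuous g2}.
Proof.
move=> t0; apply: cvgM; last exact: cg.
apply: cvgD; first by apply: cvgM; [exact: cvg_cst|exact: cpow].
rewrite !expr2; apply: cvgM; (apply: cvgM; [exact: cvg_cst|exact: cpow]).
Qed.

Let g_ge0 (t : R) : 0 <= g t. Proof. exact: expR_ge0. Qed.

Let g1_le0 (t : R) : g1 t <= 0.
Proof.
rewrite /g1 mulNr oppr_le0 mulr_ge0 // mulr_ge0 ?powR_ge0 // mulr_ge0 //; exact: ltW.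
Qed.

Let g_le1 (t : R) : g t <= 1.
Proof. by rewrite -expR0 ler_expR oppr_le0 mulr_ge0 ?powR_ge0 // ltW. Qed.

Let g1_small (eps T : R) : 0 < eps -> eps < 1 -> 0 < T ->
  - (T * g1 (eps * T)) * eps <= c * alpha * T `^ alpha.
Proof.
move=> eps0 eps1 T0; have uT0 : 0 < eps * T by rewrite mulr_gt0.
have -> : - (T * g1 (eps * T)) * eps =
    c * alpha * ((eps * T) * (eps * T) `^ (alpha - 1)) * g (eps * T).
  by rewrite /g1; ring.
rewrite mulr_powRB1 ?(ltW uT0) //.
apply: (@le_trans _ _ (c * alpha * (eps * T) `^ alpha)).
  by rewrite ler_piMr ?g_le1 // mulr_ge0 ?powR_ge0 // mulr_ge0 // ltW.
rewrite ler_pM2l ?mulr_gt0 //; apply: ge0_ler_powR; rewrite ?nnegrE ?(ltW alpha0) ?(ltW T0) ?(ltW uT0) //.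
by rewrite ler_piMl // ltW.
Qed.

Let g2_ge (eta a t : R) : 0 < eta -> eta <= a -> 0 < t -> t <= 2 / a ->
  c * alpha * (1 - alpha) * (2 / a) `^ (alpha - 2) * g (2 / eta) <= g2 t.
Proof.
move=> eta0 ae t0 ta; have a0 : 0 < a by exact: lt_le_trans ae.
have a10 : 0 < 1 - alpha by rewrite subr_gt0.
have ta0 : 0 < 2 / a by rewrite divr_gt0.
rewrite /g2; apply: ler_pM; rewrite ?g_ge0 //.
- by rewrite !mulr_ge0 ?powR_ge0 //; exact: ltW.
- rewrite ler_wpDr ?sqr_ge0 // ler_pM2l ?mulr_gt0 //.
  rewrite -[alpha - 2]opprK !(powRN _ (- (alpha - 2))) lef_pV2 ?posrE ?powR_gt0 //.
  apply: ge0_ler_powR; rewrite ?nnegrE ?(ltW t0) ?(ltW ta0) //; lra.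
- rewrite ler_expR lerN2 ler_pM2l //.
  have te : t <= 2 / eta by apply: le_trans ta _; rewrite ler_pM2l // lef_pV2 ?posrE.
  by apply: ge0_ler_powR; rewrite ?nnegrE ?(ltW alpha0) ?(ltW t0) ?(le_trans (ltW t0) te).
Qed.

Let psi2_ge0 (T u : R) : 0 < T -> 0 < u -> u <= 1 ->
  0 <= - 2 * T * g1 (u * T) + (1 - u) * T ^+ 2 * g2 (u * T).
Proof.
move=> T0 u0 u1; have a10 : 0 < 1 - alpha by rewrite subr_gt0.
have rge : 0 <= g2 (u * T).
  rewrite /g2 mulr_ge0 ?g_ge0 // addr_ge0 ?sqr_ge0 // mulr_ge0 ?powR_ge0 //.
  by rewrite !mulr_ge0 //; exact: ltW.
apply: addr_ge0; last by apply: mulr_ge0 => //; apply: mulr_ge0; rewrite ?sqr_ge0 ?subr_ge0.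
by rewrite !mulNr oppr_ge0 mulr_ge0_le0 ?g1_le0 // mulr_ge0 // ltW.
Qed.

Let psi2_ge (eta a T u : R) : 0 < eta -> eta <= a -> 0 < T -> 0 < u -> u <= 2^-1 -> u * T <= 2 / a ->
  2^-1 * T ^+ 2 * (c * alpha * (1 - alpha) * (2 / a) `^ (alpha - 2) * g (2 / eta)) <=
  - 2 * T * g1 (u * T) + (1 - u) * T ^+ 2 * g2 (u * T).
Proof.
move=> eta0 ae T0 u0 uh uTa; have uT0 : 0 < u * T by rewrite mulr_gt0.
have a0 : 0 < a by exact: lt_le_trans ae.
have a10 : 0 < 1 - alpha by rewrite subr_gt0.
apply: ler_wpDl.
  by rewrite !mulNr oppr_ge0 mulr_ge0_le0 ?g1_le0 // mulr_ge0 // ltW.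
apply: ler_pM; last exact: g2_ge uTa.
- by rewrite mulr_ge0 ?sqr_ge0.
- by rewrite !mulr_ge0 ?powR_ge0 ?g_ge0 // ltW.
- by rewrite ler_wpM2r ?sqr_ge0 //; lra.
Qed.

(** Below exponent 1 the function [t |-> exp (- c t^alpha)] is convex and
    decreasing on the half line, so after two integrations by parts every term
    is nonnegative up to an error [e].  Keeping only the range where [u * b] lies
    in [[1, 2]] bounds the integral below by the second derivative at scale
    [a^-1], which is of order [a `^ (2 - alpha)]. *)
Lemma transform_ge (eta : R) : 0 < eta -> exists2 k : R, 0 < k &
  forall T a : R, 4 / eta <= T -> eta <= a ->
    k * a `^ (- 1 - alpha) / T <= fejer_transform alpha c T a.
Proof.
move=> eta0.
have kc : 0 < 1 - cos 1 :> R.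
  have : cos 1 < cos 0 :> R.
    have := @pi_ge2 R => h.
    by rewrite ltr_cos ?in_itv /= ?lexx ?pi_ge0 //; apply/andP; split; lra.
  by rewrite cos0 subr_gt0.
have a10 : 0 < 1 - alpha by rewrite subr_gt0.
have [k kE k0] : exists2 k : R, k = 2^-1 * (c * alpha * (1 - alpha)) * 2 `^ (alpha - 2) * g (2 / eta) * (1 - cos 1) & 0 < k.
  by eexists; [reflexivity|rewrite !mulr_gt0 ?invr_gt0 ?powR_gt0 ?expR_gt0].
exists k => // T a Te ae.
have a0 : 0 < a by exact: lt_le_trans ae.
have T0 : 0 < T by apply: lt_le_trans Te; rewrite divr_gt0.
have [b bE b4] : exists2 b : R, b = T * a & 4 <= b.
  eexists; first reflexivity.
  apply: (@le_trans _ _ (4 / eta * eta)); first by rewrite divfK // gt_eqF.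
  by apply: ler_pM => //; [rewrite divr_ge0 // ltW|exact: ltW].
have b0 : 0 < b by exact: lt_le_trans b4.
have bn0 : b != 0 by rewrite gt_eqF.
have s1 : 0 < b^-1 by rewrite invr_gt0.
have s2 : 2 * b^-1 <= 2^-1.
  by rewrite -[2^-1]mul1r ler_pdivrMr // mulrAC ler_pdivlMr // mul1r -natrM.
have sb : b^-1 * b = 1 by rewrite mulVf.
apply/ler_addgt0Pr => e e0.
have [K KE K0] : exists2 K : R, K = 3 + c * alpha * T `^ alpha & 0 < K.
  eexists; first reflexivity.
  by rewrite ltr_wpDr // ?mulr_ge0 ?powR_ge0 // ltW.
(* below [b^-1] so that the range kept in the lower bound survives the
   truncation, and small enough for the boundary terms to be at most [e] *)
have [eps eps0 [epsb epsK]] : exists2 eps : R, 0 < eps & eps <= b^-1 /\ K * eps <= e.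
  exists (Num.min b^-1 (e / K)); first by rewrite lt_min s1 divr_gt0.
  split; first by rewrite ge_min lexx.
  by rewrite mulrC -ler_pdivlMr // ge_min lexx orbT.
have eps1 : eps < 1 by lra.
have cdil (f : R -> R) (u : R) : {for u * T, continuous f} -> {for u, continuous (fun v : R => f (v * T))}.
  move=> cf; apply: (@continuous_comp _ _ _ (fun v : R => v * T) f) => //.
  by apply: cvgM; [exact: cvg_id|exact: cvg_cst].
have uT0 (u : R) : 0 < u -> 0 < u * T by move=> u0; rewrite mulr_gt0.
have [i2 ftc] := @integral_parts (fun u => g (u * T)) (fun u => g1 (u * T)) (fun u => g2 (u * T))
  T b eps bn0
  (fun u u0 => dilation (dg (uT0 u u0))) (fun u u0 => dilation (dg1 (uT0 u u0)))
  (fun u u0 => cdil _ _ (cg (uT0 u u0))) (fun u u0 => cdil _ _ (cg1 (uT0 u u0)))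
  (fun u u0 => cdil _ _ (cg2 (uT0 u u0))) eps0 eps1.
have F1 : 0 <= (1 - 1) * g (1 * T) * sin (1 * b) / b -
    (- g (1 * T) + (1 - 1) * T * g1 (1 * T)) * (1 - cos (1 * b)) / b ^+ 2.
  rewrite subrr !mul0r addr0 sub0r mulNr mulNr opprK divr_ge0 ?sqr_ge0 //.
  by rewrite mulr_ge0 ?g_ge0 // subr_ge0 cos_le1.
have Feps := @boundary_term_le T b eps (g (eps * T)) (g1 (eps * T)) _ b0 T0 eps0 eps1 _ (g1_le0 _) (g1_small eps0 eps1 T0).
have {}Feps := Feps (introT andP (conj (g_ge0 _) (g_le1 _))).
have [m mE m0] : exists2 m : R, m = 2^-1 * T ^+ 2 * (c * alpha * (1 - alpha) * (2 / a) `^ (alpha - 2) * g (2 / eta)) * (1 - cos 1) / b ^+ 2 & 0 <= m.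
  eexists; first reflexivity.
  by rewrite ltW // !mulr_gt0 ?invr_gt0 ?powR_gt0 ?expR_gt0 ?exprn_gt0 // divr_gt0.
have lower : m * b^-1 <= \int[mu]_(u in `[eps, 1]) ((- 2 * T * g1 (u * T) + (1 - u) * T ^+ 2 * g2 (u * T)) * (1 - cos (u * b)) / b ^+ 2).
  rewrite (_ : m * b^-1 = m * (2 * b^-1 - b^-1)); last by ring.
  apply: Rintegral_ge_plateau => //.
  - by rewrite ler_peMl ?ler1n // ltW.
  - by apply: le_trans s2 _; rewrite invf_le1 ?ler1n.
    move=> u /andP[ue u1]; have u0 : 0 < u by exact: lt_le_trans ue.
    by rewrite divr_ge0 ?sqr_ge0 // mulr_ge0 ?subr_ge0 ?cos_le1 // psi2_ge0.
  move=> u /andP[ub1 ub2]; have u0 : 0 < u by exact: lt_le_trans ub1.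
  rewrite mE.
  rewrite ler_pM2r ?invr_gt0 ?exprn_gt0 //.
  have v1 : 1 <= u * b by rewrite -sb ler_pM2r.
  have v2 : u * b <= 2 by rewrite -ler_pdivlMr.
  apply: ler_pM.
  - by rewrite !mulr_ge0 ?invr_ge0 ?sqr_ge0 ?powR_ge0 ?g_ge0 //; exact: ltW.
  - exact: ltW.
  - apply: psi2_ge => //; first exact: le_trans ub2 s2.
    by rewrite ler_pdivlMr // -mulrA -bE.
  - by rewrite lerD2l lerN2; apply: cos_decr_le => //; exact: le_trans v1.
have mbE : m * b^-1 = k * a `^ (- 1 - alpha) / T.
  rewrite mE kE bE powRM ?invr_ge0 ?(ltW a0) // -[a^-1]powR_inv1; last exact: ltW.
  rewrite -powRrM mulN1r opprB.
  have -> : a `^ (2 - alpha) = a ^+ 3 * a `^ (- 1 - alpha).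
    rewrite -powR_mulrn; last exact: ltW.
    rewrite -powRD; last by apply/implyP => _; rewrite gt_eqF.
    by congr (_ `^ _); ring.
  by field; rewrite !gt_eqF.
have J1 : fejer_transform alpha c T a =
    \int[mu]_(u in `[0, eps]) ((1 - u) * (phi (u * T) * cos (u * T * a))) +
    \int[mu]_(u in `[eps, 1]) ((1 - u) * (g (u * T) * cos (u * b))).
  rewrite /fejer_transform.
  have it : mu.-integrable `[0, 1] (EFin \o (fun u => (1 - u) * (phi (u * T) * cos (u * T * a)))).
    exact: transform_integrable.
  have := Rintegral_itvB (x := eps) it.
  rewrite !bnd_simp => /(_ (ltW eps0) (ltW eps1)) => h.
  rewrite -[LHS](subrK (\int[mu]_(u in `[0, eps]) ((1 - u) * (phi (u * T) * cos (u * T * a))))) h.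
  rewrite addrC; congr (_ + _); rewrite Rintegral_itv_obnd_cbnd.
    apply: eq_Rintegral => u /set_mem; rewrite /= in_itv /= => /andP[u0 u1].
    by rewrite g_phi ?bE ?mulrA // mulr_ge0 ?(ltW T0) // (le_trans (ltW eps0)).
  apply: (integrableS _ _ _ it) => //.
  apply: subset_itv; rewrite !bnd_simp //; exact: ltW.
have J0 : - eps <= \int[mu]_(u in `[0, eps]) ((1 - u) * (phi (u * T) * cos (u * T * a))).
  have -> : - eps = \int[mu]_(u in `[0, eps]) (- 1).
    have m1 : mu `[0, eps]%classic = eps%:E.
      by rewrite lebesgue_measure_itv /= lte_fin eps0 oppr0 adde0.
    by rewrite Rintegral_cst // [X in fine X]m1 mulN1r.
  apply: le_Rintegral => //.
  - apply: continuous_itv_integrable; apply: continuous_subspaceT => u; exact: cvg_cst.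
  - by apply: transform_integrable => //; exact: ltW.
  move=> u; rewrite /= in_itv /= => /andP[u0 u1].
  apply: lerNnormlW; apply: (@le_trans _ _ (phi (u * T))); last exact: stable_cf_le1.
  by apply: transform_integrand_le; rewrite u0 (le_trans u1) // ltW.
rewrite -mbE J1 ftc.
by apply: (collect_errors lower Feps F1 J0); rewrite -KE.
Qed.

End stable_lower_bound.

(** * Comparison of laws through intervals *)

Section probability_integrals.
Context {R : realType} d (T : measurableType d) (P : probability T R).

Lemma prob_Rintegral_cst (k : R) : \int[P]_x k = k.
Proof. by rewrite Rintegral_cst // [X in fine X](@probability_setT _ _ _ P) mulr1. Qed.

Lemma prob_Rintegral_indic (E : set T) : measurable E -> \int[P]_x \1_E x = fine (P E).
Proof. by move=> mE; rewrite /Rintegral integral_indic // setIT. Qed.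

End probability_integrals.

Section cumulative_comparison.
Context {R : realType}.
Variables (m1 m2 : {measure set R -> \bar R}) (f1 f2 : R -> R).
Hypothesis m1E : forall a b : R, a <= b -> m1 `]a, b]%classic = (f1 b - f1 a)%:E.
Hypothesis m2E : forall a b : R, a <= b -> m2 `]a, b]%classic = (f2 b - f2 a)%:E.
Hypothesis f1_rc : right_continuous f1.
Hypothesis f2_rc : right_continuous f2.
Hypothesis f12 : forall a b : R, a <= b -> f1 b - f1 a <= f2 b - f2 a.

Let D (x : R) : R := f2 x - f1 x.

Let D_nd : nondecreasing D.
Proof. by move=> a b ab; have := f12 ab; rewrite /D; lra. Qed.

Let D_rc : right_continuous D.
Proof. by move=> a; apply: cvgB; [exact: f2_rc|exact: f1_rc]. Qed.

HB.instance Definition _ := isCumulative.Build R _ R D D_nd D_rc.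

Let L (A : set R) : \bar R := lebesgue_stieltjes_measure D A.

Let L0 : L set0 = 0%E. Proof. exact: measure0. Qed.
Let L_ge0 A : (0 <= L A)%E. Proof. exact: measure_ge0. Qed.
Let L_sigma : semi_sigma_additive L.
Proof. exact: (@measure_semi_sigma_additive _ _ _ (lebesgue_stieltjes_measure D)). Qed.

HB.instance Definition _ := isMeasure.Build _ _ _ L L0 L_ge0 L_sigma.

(** The difference of the two cumulative functions is nondecreasing and right
    continuous, hence has a Lebesgue-Stieltjes measure, which added to the
    smaller measure gives the larger one on intervals and so everywhere. *)
Lemma measure_le_of_cumulative (A : set R) : measurable A -> (m1 A <= m2 A)%E.
Proof.
move=> mA.
suff -> : m2 A = (m1 A + L A)%E by rewrite leeDl.
have -> : (m1 A + L A)%E = measure_add m1 L A.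
  by rewrite measure_addE.
apply: (@measure_unique _ _ R (@ocitv R) (fun k => `](- k%:R), k%:R]%classic)) => //.
- exact: ocitvI.
- by move=> k; exact: is_ocitv.
- apply/seteqP; split=> // x _; pose k := Num.bound `|x|.
  have : `|x| < k%:R by rewrite archi_boundP.
  rewrite ltr_norml => /andP[h1 h2]; exists k => //=.
  by rewrite in_itv /= h1 ltW.
- move=> _ [[a b] _ <-]; rewrite [RHS]measure_addE /=.
  have [ab|ba] := leP a b; last first.
    have -> : `]a, b]%classic = set0 :> set R.
      by rewrite set_itv_ge // bnd_simp -leNgt ltW.
    by rewrite L0 !measure0 adde0.
  rewrite m1E // m2E //.
  rewrite /L /lebesgue_stieltjes_measure /measure_extension /=.
  rewrite measurable_mu_extE /=; last exact: is_ocitv.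
  rewrite wlength_itv_bnd // -EFinD /D; congr EFin; ring.
- move=> k; rewrite m2E ?ltry // (le_trans _ (ler0n _ _)) // oppr_le0.
Qed.

End cumulative_comparison.

Section interval_comparison.
Context {R : realType}.
Variable nu : probability R R.

Let F (x : R) : R := fine (nu `]-oo, x]%classic).

Lemma prob_itvE (a b : R) : a <= b -> nu `]a, b]%classic = (F b - F a)%:E.
Proof.
move=> ab; rewrite EFinB !fineK ?fin_num_measure//.
have : `]a, b]%classic = `]-oo, b] `\` `]-oo, a] => [|->].
  by rewrite -[RHS]setCK setCD setCitvl setUC -[LHS]setCK setCitv.
rewrite measureD ?setIidr//; first exact: subset_itvl.
by rewrite -ge0_fin_numE// fin_num_measure.
Qed.

Lemma prob_cumulative_rc : right_continuous F.
Proof.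
move=> a; apply: fine_cvg; rewrite fineK ?fin_num_measure //.
pose X : {RV nu >-> R} := HB.pack (idfun : R -> R)
  (isMeasurableFun.Build _ _ _ _ (idfun : R -> R) (@measurable_id _ _ setT)).
exact: (@cdf_right_continuous _ _ _ _ X a).
Qed.

End interval_comparison.

Section interval_comparison_lemmas.
Context {R : realType}.

Lemma prob_le_scale (nu1 nu2 : probability R R) (c : R) : 0 <= c ->
  (forall p q : R, p < q -> c * fine (nu1 `]p, q]%classic) <= fine (nu2 `]p, q]%classic)) ->
  forall A, measurable A -> (c%:E * nu1 A <= nu2 A)%E.
Proof.
move=> c0 h A mA.
pose F1 (x : R) : R := c * fine (nu1 `]-oo, x]%classic).
pose F2 (x : R) : R := fine (nu2 `]-oo, x]%classic).
have := @measure_le_of_cumulative R (mscale (NngNum c0) nu1) nu2 F1 F2.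
rewrite /mscale /=; apply => //.
- by move=> a b ab; rewrite /mscale /= (prob_itvE nu1 ab) -EFinM mulrBr.
- by move=> a b; exact: prob_itvE.
- by move=> a; apply: cvgM; [exact: cvg_cst|exact: prob_cumulative_rc].
- exact: prob_cumulative_rc.
- move=> a b; rewrite le_eqVlt => /predU1P[->|ab]; first by rewrite !subrr.
  by have := h a b ab; rewrite (prob_itvE nu1 (ltW ab)) (prob_itvE nu2 (ltW ab)) /= mulrBr.
Qed.

Lemma prob_le_lebesgue (nu : probability R R) (C : R) : 0 <= C ->
  (forall p q : R, p < q -> fine (nu `]p, q]%classic) <= C * (q - p)) ->
  forall A, measurable A -> (nu A <= C%:E * lebesgue_measure (A : set R))%E.
Proof.
move=> C0 h A mA.
pose F1 (x : R) : R := fine (nu `]-oo, x]%classic).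
pose L (A : set R) : \bar R := lebesgue_measure A.
have [L' L'E] : exists L' : {measure set R -> \bar R}, forall A, L' A = L A.
  have L0 : L set0 = 0%E by exact: measure0.
  have L_ge0 B : (0 <= L B)%E by exact: measure_ge0.
  have L_sigma : semi_sigma_additive L.
    exact: (@measure_semi_sigma_additive _ _ _ (@lebesgue_measure R)).
  pose M := isMeasure.Build _ _ _ L L0 L_ge0 L_sigma.
  by exists (HB.pack_for {measure set R -> \bar R} L M).
have := @measure_le_of_cumulative R nu (mscale (NngNum C0) L') F1 (fun x => C * x).
rewrite /mscale /= => H; rewrite -/(L A) -L'E; apply: H => //.
- by move=> a b; exact: prob_itvE.
- move=> a b ab; rewrite /mscale /= L'E /L lebesgue_measure_itv /= lte_fin.
  move: ab; rewrite le_eqVlt => /predU1P[->|ab].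
    by rewrite ltxx subrr mule0.
  by rewrite ab -EFinM mulrBr.
- exact: prob_cumulative_rc.
- by move=> a; apply: cvg_at_right_filter; apply: cvgM; [exact: cvg_cst|exact: cvg_id].
- move=> a b; rewrite le_eqVlt => /predU1P[->|ab]; first by rewrite !subrr.
  by have := h a b ab; rewrite (prob_itvE nu (ltW ab)) /= mulrBr.
Qed.

End interval_comparison_lemmas.

(** * Lower bound on the density of a stable law *)

Section stable_density.
Context {R : realType}.
Notation mu := (@lebesgue_measure R).
Variable nu : probability R R.
Variables alpha c : R.
Hypothesis alpha0 : 0 < alpha.
Hypothesis c0 : 0 < c.
Hypothesis cos_nu : forall t, \int[nu]_y cos (t * y) = stable_cf alpha c t.
Hypothesis sin_nu : forall t, \int[nu]_y sin (t * y) = 0.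

Lemma measurable_fejer : measurable_fun setT (@fejer R).
Proof.
pose f (z : measurableTypeR R * R) : R := (1 - z.1) * cos (z.1 * z.2).
have mf : measurable_fun setT f.
  apply: measurable_funM; first by apply: measurable_funB.
  apply: measurableT_comp measurable_cos _.
  by apply: measurable_funM.
have [|m1 _ _] := @Rintegral_fubini _ _ _ _ _ mu nu `[0, 1]%classic f 1 (measurable_itv _) (lebesgue_itv_lty 0 1) mf.
  move=> u y; rewrite /= in_itv /= => /andP[u0 u1]; rewrite /f /= normrM mulr_ile1 //; last exact: cos_le1_abs.
  by rewrite ger0_norm; lra.
exact: m1.
Qed.

Lemma measurable_fejer_window (T y : R) :
  measurable_fun (setT : set (measurableTypeR R)) (fun a => T * fejer (T * (y - a))).
Proof.
apply: measurable_funM => //; apply: (measurableT_comp measurable_fejer).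
by apply: measurable_funM => //; exact: measurable_funB.
Qed.

Lemma fejer_window_integrable (p q T y : R) : 0 < T ->
  mu.-integrable `[p, q] (EFin \o (fun a => T * fejer (T * (y - a)))).
Proof.
move=> T0.
apply: (@integrable_bounded _ _ _ mu _ (fun a => T * fejer (T * (y - a))) T) => //.
- exact: lebesgue_itv_lty.
- exact: measurable_funS (measurable_fejer_window T y).
move=> a _; rewrite normrM (gtr0_norm T0) ler_piMr ?(ltW T0) //.
rewrite ger0_norm ?fejer_ge0 //; apply: le_trans (fejer_le_half _) _.
by rewrite invf_le1 ?ler1n.
Qed.

(** The kernel is dominated by a Cauchy density, whose integral is an arctangent. *)
Lemma fejer_window_le (p q T y : R) : p < q -> 0 < T ->
  \int[mu]_(a in `[p, q]) (T * fejer (T * (y - a))) <= 4 * pi.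
Proof.
move=> pq T0.
pose F (a : R) := - 4 * atan (T * (y - a)).
have dF (a : R) : p <= a <= q -> is_derive a 1 F (4 * T / (1 + (T * (y - a)) ^+ 2)).
  move=> _.
  have d1 : is_derive a 1 (fun a : R => T * (y - a)) (- T).
    by apply: is_derive_eq; rewrite /GRing.scale /=; ring.
  have d2 := @is_derive1_comp _ atan (fun a : R => T * (y - a)) a _ _ (is_derive1_atan _) d1.
  have d3 : is_derive a 1 (fun a : R => - 4 * atan (T * (y - a))) (- 4 * ((1 + (T * (y - a)) ^+ 2)^-1 * - T)).
    exact: (is_deriveZ _ d2).
  by apply: is_derive_eq d3 _; ring.
have cf : {within `[p, q], continuous (fun a : R => 4 * T / (1 + (T * (y - a)) ^+ 2))}.
  apply: continuous_subspaceT => a; apply: cvgM; first exact: cvg_cst.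
  apply: cvgV; first by rewrite gt_eqF // ltr_pwDl // sqr_ge0.
  apply: cvgD; first exact: cvg_cst.
  rewrite !expr2; apply: cvgM; (apply: cvgM; [exact: cvg_cst|]); by apply: cvgB; [exact: cvg_cst|exact: cvg_id].
apply: (@le_trans _ _ (F q - F p)).
  rewrite -(FTC2 pq dF cf); apply: le_Rintegral => //.
  - exact: fejer_window_integrable.
  - exact: continuous_itv_integrable.
  move=> a _; rewrite mulrAC mulrC ler_pM2r //; exact: fejer_le.
rewrite /F; have := atan_ltpi2 (T * (y - p)); have := atan_gtNpi2 (T * (y - q)).
set A := atan _; set B := atan _ => h1 h2; lra.
Qed.

Lemma fejer_window_far (p q T y delta : R) : p < q -> 0 < T -> 0 < delta ->
  (forall a : R, p <= a <= q -> delta <= `|y - a|) ->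
  \int[mu]_(a in `[p, q]) (T * fejer (T * (y - a))) <= 4 / (T * delta ^+ 2) * (q - p).
Proof.
move=> pq T0 d0 far.
have -> : 4 / (T * delta ^+ 2) * (q - p) = \int[mu]_(a in `[p, q]) (4 / (T * delta ^+ 2)).
  by rewrite Rintegral_cst // [X in fine X](lebesgue_itvE (ltW pq)).
apply: le_Rintegral => //.
- exact: fejer_window_integrable.
- apply: continuous_itv_integrable; apply: continuous_subspaceT => u; exact: cvg_cst.
move=> a; rewrite /= in_itv /= => apq.
have h : (T * delta) ^+ 2 <= (T * (y - a)) ^+ 2.
  rewrite !exprMn ler_pM2l ?exprn_gt0 // -(real_normK (num_real (y - a))).
  by rewrite lerXn2r ?nnegrE ?(ltW d0) // far.
have h0 : 0 < (T * delta) ^+ 2 by rewrite exprn_gt0 // mulr_gt0.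
have h1 : fejer (T * (y - a)) <= 4 / (T * delta) ^+ 2.
  apply: le_trans (fejer_le _) _; rewrite ler_pM2l // lef_pV2 ?posrE //.
    by rewrite (le_trans h) // lerDr.
  by rewrite ltr_pwDl // sqr_ge0.
have -> : 4 / (T * delta ^+ 2) = T * (4 / (T * delta) ^+ 2).
  by field; rewrite !gt_eqF.
by rewrite ler_pM2l.
Qed.

Hypothesis alpha1 : alpha < 1.

Lemma prob_enlarge (C p q delta : R) : p < q -> 0 < delta ->
  (forall p q : R, p < q -> fine (nu `[p, q]%classic) <= C * (q - p)) ->
  fine (nu `[p - delta, q + delta]%classic) <= fine (nu `[p, q]%classic) + 2 * (C * delta).
Proof.
move=> pq d0 hC.
pose I1 : set R := `[p - delta, p]%classic; pose I2 : set R := `[p, q]%classic.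
pose I3 : set R := `[q, q + delta]%classic; pose E : set R := `[p - delta, q + delta]%classic.
have mI1 : measurable I1 by exact: measurable_itv.
have mI2 : measurable I2 by exact: measurable_itv.
have mI3 : measurable I3 by exact: measurable_itv.
have mE : measurable E by exact: measurable_itv.
have sub : (nu E <= nu I1 + nu I2 + nu I3)%E.
  apply: (@le_trans _ _ (nu ((I1 `|` I2) `|` I3))).
    apply: le_measure; [exact: mem_set| |].
      by apply: mem_set; do 2 apply: measurableU => //.
    move=> x; rewrite /E /I1 /I2 /I3 /= !in_itv /= => /andP[x1 x2].
    have [xp|xp] := leP x p; first by left; left; rewrite x1.
    have [xq|xq] := leP x q; first by left; right; rewrite (ltW xp).
    by right; rewrite (ltW xq).
  apply: le_trans (measureU2 _ _ mI3) _ => //; first exact: measurableU.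
  by apply: leeD => //; apply: measureU2.
have h1 : fine (nu I1) <= C * delta.
  by rewrite (_ : delta = p - (p - delta)); [apply: hC; lra|ring].
have h2 : fine (nu I3) <= C * delta.
  by rewrite (_ : delta = q + delta - q); [apply: hC; lra|ring].
move: sub; rewrite -(fineK (fin_num_measure nu _ mE)) -(fineK (fin_num_measure nu _ mI1)).
rewrite -(fineK (fin_num_measure nu _ mI2)) -(fineK (fin_num_measure nu _ mI3)).
by rewrite -!EFinD lee_fin /=; lra.
Qed.

Lemma fejer_transform_abs (T a : R) :
  fejer_transform alpha c T `|a| = fejer_transform alpha c T a.
Proof.
have [a0|a0] := leP 0 a; first by rewrite ger0_norm.
rewrite ltr0_norm // /fejer_transform; apply: eq_Rintegral => u _.
by rewrite mulrN cosN.
Qed.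

(** Integrate the lower bound on the transform over centres [a] in [[p, q]].  By
    Fubini's theorem the result is the mean over [y] of the kernel mass that the
    window [[p, q]] receives from [y], which is at most [4 * pi] and is small
    unless [y] is within [delta] of the window.  Letting [T] grow and [delta]
    tend to 0 leaves the mass of the interval itself. *)
Lemma stable_ge_length (eta : R) : 0 < eta -> exists2 k : R, 0 < k &
  forall D p q : R, p < q -> (forall a : R, p <= a <= q -> eta <= `|a| <= D) ->
    k * D `^ (- 1 - alpha) * (q - p) <= fine (nu `[p, q]%classic).
Proof.
move=> eta0; have [k k0 hk] := transform_ge alpha0 alpha1 c0 eta0.
have [C C0 hC] := stable_le_length alpha0 c0 cos_nu sin_nu.
have p0 : 0 < 4 * pi :> R by rewrite mulr_gt0 // pi_gt0.
exists (k / (4 * pi)); first by rewrite divr_gt0.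
move=> D p q pq etaD.
rewrite (_ : k / (4 * pi) * _ * _ = k * D `^ (- 1 - alpha) * (q - p) / (4 * pi)); last by ring.
rewrite ler_pdivrMr // [leRHS]mulrC.
set V := k * _ * _.
(* mass of a slightly larger interval, up to an error vanishing as T grows *)
have main (T delta : R) : 4 / eta <= T -> 0 < delta ->
    V <= 4 * pi * (fine (nu `[p, q]%classic) + 2 * (C * delta)) + 4 / (T * delta ^+ 2) * (q - p).
  move=> Te d0; have T0 : 0 < T by apply: lt_le_trans Te; rewrite divr_gt0.
  pose f (z : measurableTypeR R * R) : R := T * fejer (T * (z.2 - z.1)).
  have mf : measurable_fun setT f.
    apply: measurable_funM => //; apply: (measurableT_comp measurable_fejer).
    by apply: measurable_funM => //; exact: measurable_funB.
  have [|m1 i2 e3] := @Rintegral_fubini _ _ _ _ _ mu nu `[p, q]%classic f T (measurable_itv _) (lebesgue_itv_lty p q) mf.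
    move=> a y _; rewrite /f /= normrM (gtr0_norm T0) ler_piMr ?(ltW T0) //.
    rewrite ger0_norm ?fejer_ge0 //; apply: le_trans (fejer_le_half _) _.
    by rewrite invf_le1 ?ler1n.
  have inner (a : R) : \int[nu]_y f (a, y) = T * fejer_transform alpha c T a.
    rewrite RintegralZl //; last exact: (fejer_nu_integrable cos_nu sin_nu).
    by rewrite (fejer_expectationE cos_nu sin_nu).
  have low : V <= \int[mu]_(a in `[p, q]) (\int[nu]_y f (a, y)).
    have -> : V = \int[mu]_(a in `[p, q]) (k * D `^ (- 1 - alpha)).
      by rewrite Rintegral_cst // [X in fine X](lebesgue_itvE (ltW pq)).
    apply: le_Rintegral => //.
      apply: continuous_itv_integrable; apply: continuous_subspaceT => u; exact: cvg_cst.
    move=> a; rewrite /= in_itv /= => /etaD /andP[ea aD].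
    rewrite inner.
    have a0 : 0 < `|a| by exact: lt_le_trans ea.
    rewrite -fejer_transform_abs; apply: (@le_trans _ _ (k * `|a| `^ (- 1 - alpha))).
      rewrite ler_pM2l // (_ : - 1 - alpha = - (1 + alpha)); last by ring.
      rewrite !powRN lef_pV2 ?posrE ?powR_gt0 //; last exact: lt_le_trans aD.
      by apply: ge0_ler_powR; rewrite ?nnegrE // ?addr_ge0 ?(ltW alpha0) // (le_trans _ aD).
    have := hk T `|a| Te ea; rewrite ler_pdivrMr // => h.
    by rewrite [leRHS]mulrC.
  apply: (le_trans low); rewrite -e3.
  pose E := `[p - delta, q + delta]%classic : set R.
  have mE : measurable E by exact: measurable_itv.
  have nuE : fine (nu E) <= fine (nu `[p, q]%classic) + 2 * (C * delta).
    exact: prob_enlarge.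
  have eT0 : 0 <= 4 / (T * delta ^+ 2) * (q - p).
    by rewrite mulr_ge0 ?subr_ge0 ?(ltW pq) // divr_ge0 // mulr_ge0 ?sqr_ge0 // ltW.
  apply: (@le_trans _ _ (\int[nu]_y (4 * pi * \1_E y + 4 / (T * delta ^+ 2) * (q - p)))); last first.
    have iE : nu.-integrable setT (EFin \o \1_E).
      apply: (@probability_integrable _ _ _ nu _ 1); first by apply: measurable_indic.
      by move=> y; rewrite indicE; case: (_ \in _); rewrite ?normr1 ?normr0.
    rewrite RintegralD //; first last.
    - by apply: (@probability_integrable _ _ _ nu _ (4 / (T * delta ^+ 2) * (q - p))) => // y; rewrite ger0_norm.
    - exact: (integrableZl measurableT (4 * pi) iE).
    rewrite RintegralZl // prob_Rintegral_cst prob_Rintegral_indic //.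
    by rewrite lerD2r ler_pM2l.
  apply: le_Rintegral => //.
  - apply: (@probability_integrable _ _ _ nu _ (4 * pi)); first exact: m1.
    move=> y; rewrite ger0_norm; first exact: fejer_window_le.
    by apply: Rintegral_ge0 => a _; rewrite mulr_ge0 ?fejer_ge0 // ltW.
  - apply: (@probability_integrable _ _ _ nu _ (4 * pi + 4 / (T * delta ^+ 2) * (q - p))).
      by apply: measurable_funD => //; apply: measurable_funM => //; apply: measurable_indic.
    move=> y; rewrite ger0_norm; last by rewrite addr_ge0 // mulr_ge0 ?(ltW p0).
    rewrite lerD2r ler_piMr ?(ltW p0) // indicE; case: (_ \in _) => //=.
  move=> y _; rewrite indicE; case: (boolP (y \in E)) => [_|/negP yE].
    by rewrite mulr1 ler_wpDr //; exact: fejer_window_le.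
  rewrite mulr0 add0r; apply: fejer_window_far => // a /andP[pa aq].
  rewrite leNgt; apply/negP; rewrite ltr_norml => /andP[y1 y2]; apply: yE.
  by apply: mem_set; rewrite /E /= in_itv /=; apply/andP; split; lra.
apply/ler_addgt0Pr => e e0.
(* [delta] makes the two enlarged margins cost [e / 2]; then [T] makes the
   contribution of distant points cost at most [e / 2] *)
have [delta dE d0] : exists2 delta : R, delta = e / (16 * pi * C) & 0 < delta.
  by eexists; [reflexivity|rewrite divr_gt0 // !mulr_gt0 // pi_gt0].
have [T Te hT] : exists2 T : R, 4 / eta <= T & 8 * (q - p) / (delta ^+ 2 * e) <= T.
  exists (Num.max (4 / eta) (8 * (q - p) / (delta ^+ 2 * e))).
    by rewrite le_max lexx.
  by rewrite le_max lexx orbT.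
have T0 : 0 < T by apply: lt_le_trans Te; rewrite divr_gt0.
have := main T delta Te d0.
have -> : 4 * pi * (fine (nu `[p, q]%classic) + 2 * (C * delta)) = 4 * pi * fine (nu `[p, q]%classic) + e / 2.
  have pn : pi != 0 :> R by rewrite gt_eqF // pi_gt0.
  have Cn : C != 0 by rewrite gt_eqF.
  rewrite dE; move: (pi) pn (fine _) => z zn f.
  by field; rewrite zn Cn.
have : 4 / (T * delta ^+ 2) * (q - p) <= e / 2.
  move: hT; rewrite ler_pdivrMr ?mulr_gt0 ?exprn_gt0 // => hT.
  rewrite mulrAC ler_pdivrMr ?mulr_gt0 ?exprn_gt0 //.
  have -> : e / 2 * (T * delta ^+ 2) = T * (delta ^+ 2 * e) / 2 by ring.
  lra.
lra.
Qed.

End stable_density.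

(** * Expectations, variances and bounded densities *)

Section prob_tools.
Context {R : realType} d (T : measurableType d) (P : probability T R).

Lemma joint_expectation d1 d2 (T1 : measurableType d1) (T2 : measurableType d2)
    (X1 : {RV P >-> T1}) (X2 : {RV P >-> T2}) (h : T1 * T2 -> R) (K : R) :
  independent_pair X1 X2 -> measurable_fun setT h -> (forall z, `|h z| <= K) ->
  \int[P]_w h (X1 w, X2 w) =
  \int[distribution P X1]_x (\int[distribution P X2]_y h (x, y)).
Proof.
move=> indep mh hK.
have mX : measurable_fun setT (fun w => (X1 w, X2 w)) by exact: measurable_fun_pair.
pose X : {mfun T >-> (T1 * T2)%type} :=
  HB.pack (fun w => (X1 w, X2 w)) (isMeasurableFun.Build _ _ _ _ _ mX).
have mhE : measurable_fun setT (EFin \o h) by exact/measurable_EFinP.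
have e1 : (\int[distribution P X]_z (h z)%:E)%E = (\int[P]_w (h (X1 w, X2 w))%:E)%E.
  rewrite (@integral_distribution _ _ _ _ _ _ X (EFin \o h)) //.
  apply: (@probability_integrable _ _ _ P (fun w => h (X1 w, X2 w)) K) => //.
  exact: measurableT_comp mh mX.
have e2 : (\int[distribution P X]_z (h z)%:E)%E =
    (\int[(distribution P X1 \x distribution P X2)%E]_z (h z)%:E)%E.
  apply: eq_measure_integral => A mA _; exact: (joint_law indep mA).
have ih : (distribution P X1 \x distribution P X2)%E.-integrable setT (EFin \o h).
  apply: (@integrable_bounded _ _ _ _ _ _ K) => //.
  have -> : [set: T1 * T2] = setT `*` setT by rewrite setXTT.
  have e : (distribution P X1 \x distribution P X2)%E (setT `*` setT) =
     (distribution P X1 setT * distribution P X2 setT)%E by exact: product_measure1E.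
  rewrite [X in (X < _)%E]e [X in (X * _)%E](@probability_setT _ _ _ (distribution P X1)).
  by rewrite [X in (_ * X)%E](@probability_setT _ _ _ (distribution P X2)) mule1 ltry.
have e3 := integral12_prod_meas1 ih.
rewrite /Rintegral -e1 e2 -e3; congr fine.
apply: eq_integral => x _; rewrite /fubini_F /= fineK //.
apply: integrable_fin_num => //.
apply: (@integrable_bounded _ _ _ _ _ (fun y => h (x, y)) K) => //.
  by rewrite [X in (X < _)%E](@probability_setT _ _ _ (distribution P X2)) ltry.
exact: (measurableT_comp mh (measurable_pair1 x)).
Qed.

Lemma expectation_law d1 (T1 : measurableType d1) (X : {RV P >-> T1}) (h : T1 -> R) (K : R) :
  measurable_fun setT h -> (forall z, `|h z| <= K) ->
  \int[P]_w h (X w) = \int[distribution P X]_x h x.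
Proof.
move=> mh hK; rewrite /Rintegral (@integral_distribution _ _ _ _ _ _ X (EFin \o h)) //.
  exact/measurable_EFinP.
apply: (@probability_integrable _ _ _ P (fun w => h (X w)) K) => //.
exact: measurableT_comp mh _.
Qed.

Lemma expectation_product d1 d2 (T1 : measurableType d1) (T2 : measurableType d2)
    (X1 : {RV P >-> T1}) (X2 : {RV P >-> T2}) (f : T1 -> R) (g : T2 -> R) (K : R) :
  independent_pair X1 X2 -> measurable_fun setT f -> measurable_fun setT g ->
  (forall x, `|f x| <= K) -> (forall x, `|g x| <= K) ->
  \int[P]_w (f (X1 w) * g (X2 w)) = \int[P]_w f (X1 w) * \int[P]_w g (X2 w).
Proof.
move=> indep mf mg fK gK.
rewrite (@joint_expectation _ _ _ _ X1 X2 (fun z => f z.1 * g z.2) (K * K)) //; last 2 first.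
- by apply: measurable_funM; exact: measurableT_comp.
- by move=> z; rewrite normrM; apply: ler_pM.
rewrite (expectation_law X1 mf fK) (expectation_law X2 mg gK) /=.
have ig : (distribution P X2).-integrable setT (EFin \o g).
  apply: (@integrable_bounded _ _ _ _ _ _ K) => //.
  by rewrite [X in (X < _)%E](@probability_setT _ _ _ (distribution P X2)) ltry.
have if' : (distribution P X1).-integrable setT (EFin \o f).
  apply: (@integrable_bounded _ _ _ _ _ _ K) => //.
  by rewrite [X in (X < _)%E](@probability_setT _ _ _ (distribution P X1)) ltry.
rewrite -RintegralZr //; apply: eq_Rintegral => x _.
by rewrite RintegralZl.
Qed.

Lemma expectation_sum (I : Type) (s : seq I) (f : I -> T -> R) :
  (forall i, P.-integrable setT (EFin \o f i)) ->
  P.-integrable setT (EFin \o (fun w => \sum_(i <- s) f i w)) /\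
  \int[P]_w (\sum_(i <- s) f i w) = \sum_(i <- s) \int[P]_w f i w.
Proof.
move=> fi; elim: s => [|i s [IH1 IH2]].
  under eq_fun do rewrite big_nil; rewrite big_nil prob_Rintegral_cst; split=> //.
  by apply: (@probability_integrable _ _ _ P _ 0) => // y; rewrite normr0.
under eq_fun do rewrite big_cons; rewrite big_cons.
split.
  have := integrableD measurableT (fi i) IH1; by apply: eq_integrable.
by rewrite RintegralD // IH2.
Qed.

Lemma variance_sum (I : eqType) (s : seq I) (g : I -> T -> R) (K : R) : uniq s ->
  (forall i, measurable_fun setT (g i)) -> (forall i w, `|g i w| <= K) ->
  (forall i j, i != j -> \int[P]_w (g i w * g j w) = 0) ->
  \int[P]_w ((\sum_(i <- s) g i w) ^+ 2) = \sum_(i <- s) \int[P]_w (g i w ^+ 2).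
Proof.
move=> + mg gK orth; elim: s => [_|i s IH /= /andP[si us]].
  rewrite big_nil -[RHS](prob_Rintegral_cst P); apply: eq_Rintegral => w _.
  by rewrite big_nil expr0n.
have igg j k : P.-integrable setT (EFin \o (fun w => g j w * g k w)).
  apply: (@probability_integrable _ _ _ P _ (K * K)); first exact: measurable_funM.
  by move=> w; rewrite normrM ler_pM.
have [iS eS] := @expectation_sum _ s (fun j w => g i w * g j w) (igg i).
have [iS2 eS2] := @expectation_sum _ s (fun j w => \sum_(k <- s) g j w * g k w)
  (fun j => (@expectation_sum _ s (fun k w => g j w * g k w) (igg j)).1).
have sq w : (\sum_(j <- s) g j w) ^+ 2 = \sum_(j <- s) \sum_(k <- s) g j w * g k w.
  by rewrite expr2 big_distrl /=; apply: eq_bigr => j _; rewrite big_distrr.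
have iq : P.-integrable setT (EFin \o (fun w => (\sum_(j <- s) g j w) ^+ 2)).
  by apply: eq_integrable iS2 => // w _ /=; rewrite sq.
have ii : P.-integrable setT (EFin \o (fun w => g i w ^+ 2)).
  by apply: eq_integrable (igg i i) => // w _ /=; rewrite expr2.
have i2S : P.-integrable setT (EFin \o (fun w => 2 * \sum_(j <- s) g i w * g j w)).
  exact: (integrableZl measurableT 2 iS).
rewrite big_cons -IH //.
rewrite (@eq_Rintegral _ _ _ P setT (fun w => g i w ^+ 2 +
    (2 * (\sum_(j <- s) g i w * g j w) + (\sum_(j <- s) g j w) ^+ 2))); last first.
  by move=> w _; rewrite big_cons -big_distrr /=; ring.
rewrite RintegralD //; last exact: (integrableD measurableT i2S iq).
rewrite RintegralD // RintegralZl // eS big_seq big1 ?mulr0 ?add0r // => j js.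
by apply: orth; apply: contraNneq si => ->.
Qed.

End prob_tools.

(** The Radon-Nikodym derivative is almost everywhere at most [C]; truncating it
    makes the bound hold everywhere without changing the integrals. *)
Lemma bounded_density {R : realType} (lam rho : probability R R) (C : R) : 0 < C ->
  (forall A, measurable A -> (lam A <= C%:E * rho A)%E) ->
  exists w : R -> R, [/\ measurable_fun setT w, (forall x, 0 <= w x <= C) &
    forall A, measurable A -> lam A = (\int[rho]_(x in A) (w x)%:E)%E].
Proof.
move=> C0 lamC.
have dom : lam `<< rho.
  apply/null_content_dominatesP => A mA rA.
  by apply/eqP; rewrite eq_le measure_ge0 andbT (le_trans (lamC A mA)) // rA mule0.
have [f [f0 ffin fi fE]] := radon_nikodym_sigma_finite dom.
pose F x := fine (f x).
have FE x : (F x)%:E = f x by rewrite fineK.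
have mF : measurable_fun setT F.
  by apply: measurableT_comp => //; exact: measurable_int fi.
have F0 x : 0 <= F x by rewrite fine_ge0.
pose A n := [set x | C + n.+1%:R^-1 <= F x].
have mA n : measurable (A n).
  rewrite (_ : A n = F @^-1` `[C + n.+1%:R^-1, +oo[).
    by rewrite -[X in measurable X]setTI; exact: mF.
  by apply/seteqP; split=> x /=; rewrite in_itv /= andbT.
have A0 n : rho (A n) = 0%E.
  have h1 : ((C + n.+1%:R^-1)%:E * rho (A n) <= lam (A n))%E.
    rewrite fE // -integral_cst //; apply: ge0_le_integral => //.
    - by move=> x _; rewrite lee_fin addr_ge0 // ltW.
    - by apply: measurable_funS (measurable_int _ fi).
    - by move=> x; rewrite /A /= -lee_fin FE.
  have := le_trans h1 (lamC _ (mA n)).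
  rewrite -(fineK (fin_num_measure rho _ (mA n))) -!EFinM lee_fin mulrDl gerDl.
  move=> h; congr EFin; apply/eqP; rewrite eq_le fine_ge0 // andbT.
  by rewrite pmulr_rle0 ?invr_gt0 in h.
exists (fun x => Num.min (F x) C); split.
- exact: measurable_minr.
- by move=> x; rewrite le_min F0 (ltW C0) ge_min lexx orbT.
move=> B mB; rewrite fE //; apply: ge0_ae_eq_integral => //.
- exact: measurable_funS (measurable_int _ fi).
- apply: (@measurable_funS _ _ _ _ setT) => //; apply/measurable_EFinP; exact: measurable_minr.
- by move=> x _; rewrite lee_fin le_min F0 ltW.
exists (\bigcup_n A n); split.
- exact: bigcupT_measurable.
- apply/negligibleP; first exact: bigcupT_measurable.
  by apply: negligible_bigcup => n; apply/negligibleP; [exact: mA|exact: A0].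
move=> x /not_implyP[_ ne]; apply: contrapT => nA; apply: ne.
rewrite -FE; congr EFin; rewrite min_l // leNgt; apply/negP => CF; apply: nA.
have [n _ hn] : exists2 n : nat, True & n.+1%:R^-1 < F x - C.
  have h : 0 < F x - C by rewrite subr_gt0.
  exists (Num.bound (F x - C)^-1) => //.
  rewrite invf_plt ?posrE // (lt_trans (archi_boundP _)) ?invr_ge0 ?(ltW h) //.
  by rewrite ltr_nat.
by exists n => //; rewrite /A /= -lerBrDl; exact: ltW.
Qed.

(** * Exchanging a site for an independent point *)

Lemma young_scaled {R : realFieldType} (a s : R) : 0 < s -> a <= s / 2 + a ^+ 2 / (2 * s).
Proof.
move=> s0; rewrite -subr_ge0.
have -> : s / 2 + a ^+ 2 / (2 * s) - a = (a - s) ^+ 2 / (2 * s) by field; rewrite gt_eqF.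
by rewrite divr_ge0 ?sqr_ge0 // mulr_ge0 // ltW.
Qed.

Section exchange.
Context {R : realType} d (T : measurableType d) (P : probability T R).
Variable Y : int -> {RV P >-> R}.
Hypothesis indepY : mutually_independent Y.
Hypothesis lawY : forall x, has_law (Y x) (distribution P (Y 0)).

Local Notation X := (fun x => site Y x : {RV P >-> R}).
Local Notation Pi D := (perturbed_lattice D Y).

Definition inserted (D : set int) (lam : probability R R) (A : set (configuration R)) : R :=
  fine ((distribution P (Pi D) \x lam)%E (insert_event A)).

(** Tilting the lattice by a density evaluated at the site [u] changes the law of
    that site only, the others being independent of it. *)
Lemma inserted_tilt (I : set int) u (lam : probability R R) (w : R -> R) (C : R) A :
  I u -> measurable A -> measurable_fun setT w -> (forall x, 0 <= w x <= C) ->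
  (forall A, measurable A -> lam A = (\int[distribution P (X u)]_(x in A) (w x)%:E)%E) ->
  inserted (I `\ u) lam A = \int[P]_v (w (site Y u v) * \1_(Pi I @^-1` A) v).
Proof.
move=> Iu mA mw wC lamE.
have mE := measurable_insert_event mA.
have wle z : `|w z| <= C by have /andP[w0 wz] := wC z; rewrite ger0_norm.
have C0 : 0 <= C by exact: le_trans (wle 0).
pose h (z : configuration R * R) : R := w z.2 * \1_(insert_event A) z.
have mh : measurable_fun setT h.
  apply: measurable_funM; first exact: measurableT_comp mw measurable_snd.
  exact: measurable_indic.
have hC z : `|h z| <= C.
  by rewrite /h normrM indicE; case: (_ \in _); rewrite ?normr1 ?normr0 ?mulr1 ?mulr0.
have nIu : ~ (I `\ u) u by move=> [_ /(_ erefl)].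
have indep := indep_lattice_site indepY nIu.
transitivity (\int[P]_v h (Pi (I `\ u) v, site Y u v)).
  rewrite (joint_expectation indep mh hC) /inserted /product_measure1 /Rintegral.
  congr fine; apply: eq_integral => c _ /=.
  rewrite fineK; last first.
    apply: integrable_fin_num => //.
    apply: (@probability_integrable _ _ _ (distribution P (X u)) (fun y => h (c, y)) C) => //.
    exact: (measurableT_comp mh (measurable_pair1 c)).
  rewrite lamE; last exact: measurable_xsection.
  rewrite integral_mkcond; apply: eq_integral => z _.
  rewrite patchE /h /= indicE; have -> : (z \in xsection (insert_event A) c) = ((c, z) \in insert_event A).
    by apply/idP/idP => /set_mem/xsectionP ?; apply/mem_set => //; apply/xsectionP.
  by case: ifP => _; rewrite ?mulr1 ?mulr0.
have mX1 : measurable_fun setT (fun v => h (Pi (I `\ u) v, site Y u v)).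
  apply: (measurableT_comp mh).
  exact: (measurable_fun_pair (measurable_funP (Pi (I `\ u))) (measurable_site Y u)).
rewrite /Rintegral; congr fine; apply: ae_eq_integral => //.
- exact/measurable_EFinP.
- apply/measurable_EFinP; apply: measurable_funM.
    exact: measurableT_comp mw (measurable_site Y u).
  by apply: measurable_indic; exact: measurable_preimage.
have := ae_lattice_insert lawY Iu; apply: filterS => v e _.
rewrite /h /=; congr (_ * _)%:E; rewrite !indicE; congr (_%:R); congr nat_of_bool.
by apply/idP/idP => /set_mem; rewrite /insert_event /= => ?; apply/mem_set; rewrite /= ?e // -e.
Qed.

(** Averaging [inserted_tilt] over [u] in [B] expresses the mean of the inserted
    laws as an expectation tilted by the average of the densities.  That average
    has mean 1, and its variance is at most [C / size B] because its terms are
    independent, with mean 1 and values between 0 and [C]; so the tilt costs at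
    most [s]. *)
Lemma exchange (I : set int) (B : seq int) (lam : probability R R) (C s : R) A :
  uniq B -> (forall u, u \in B -> I u) -> (0 < size B)%N -> 0 < C -> 0 < s ->
  (forall u, u \in B -> forall A, measurable A -> (lam A <= C%:E * distribution P (X u) A)%E) ->
  C <= (size B)%:R * s ^+ 2 -> measurable A ->
  `|fine (P (Pi I @^-1` A)) - (size B)%:R^-1 * \sum_(u <- B) inserted (I `\ u) lam A| <= s.
Proof.
move=> uB BI B0 C0 s0 lamC Cs mA.
pose N : R := (size B)%:R; have N0 : 0 < N by rewrite ltr0n.
have /choice[w wP] : forall u, exists w : R -> R,
   [/\ measurable_fun setT w, (forall x, 0 <= w x <= C) &
    (u \in B -> forall A, measurable A -> lam A = (\int[distribution P (X u)]_(x in A) (w x)%:E)%E)].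
  move=> u; have [uinB|_] := boolP (u \in B).
    by have [w [w1 w2 w3]] := bounded_density C0 (lamC u uinB); exists w; split.
  by exists (cst 0); split=> // x; rewrite lexx ltW.
pose Z u v := w u (site Y u v).
have mZ u : measurable_fun setT (Z u).
  by have [mw _ _] := wP u; exact: measurableT_comp mw (measurable_site Y u).
have wC u x : 0 <= w u x <= C by have [_ h _] := wP u.
have wle u x : `|w u x| <= C by have /andP[h1 h2] := wC u x; rewrite ger0_norm.
have iZ u : P.-integrable setT (EFin \o Z u).
  by apply: (@probability_integrable _ _ _ _ _ C) => // v; exact: wle.
have EZ u : u \in B -> \int[P]_v Z u v = 1.
  move=> uinB; have [mw _ lamE] := wP u.
  rewrite (expectation_law (X u) mw (wle u)) /Rintegral -(lamE uinB setT measurableT).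
  by rewrite (@probability_setT _ _ _ lam).
pose g u v := if u \in B then Z u v - 1 else 0.
have mg u : measurable_fun setT (g u).
  by rewrite /g; case: (u \in B) => //; exact: measurable_funB.
have gK u v : `|g u v| <= C + 1.
  rewrite /g; case: (u \in B); last by rewrite normr0 addr_ge0 // ltW.
  by apply: le_trans (ler_normB _ _) _; rewrite normr1 lerD2r; exact: wle.
have orth u u' : u != u' -> \int[P]_v (g u v * g u' v) = 0.
  move=> uu'; rewrite /g.
  have zero (f : T -> R) : (forall v, f v = 0) -> \int[P]_v f v = 0.
    by move=> f0; rewrite -[RHS](prob_Rintegral_cst P); apply: eq_Rintegral => v _.
  have [uinB|_] := boolP (u \in B); last by apply: zero => v; rewrite mul0r.
  have [uinB'|_] := boolP (u' \in B); last by apply: zero => v; rewrite mulr0.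
  have [mw _ _] := wP u; have [mw' _ _] := wP u'.
  have wle1 i x : `|w i x - 1| <= C + 1.
    by apply: le_trans (ler_normB _ _) _; rewrite normr1 lerD2r.
  rewrite (@expectation_product _ _ _ _ _ _ _ _ (X u) (X u') (fun x => w u x - 1) (fun x => w u' x - 1) (C + 1)) //; last 3 first.
  - exact: (indep_sites indepY uu').
  - exact: measurable_funB.
  - exact: measurable_funB.
  have -> : \int[P]_v (w u (site Y u v) - 1) = 0; last by rewrite mul0r.
  rewrite RintegralB //; last 2 first.
  - exact: iZ.
  - by apply: (@probability_integrable _ _ _ _ _ 1) => // v; rewrite normr1.
  by rewrite prob_Rintegral_cst -/(Z u) EZ // subrr.
have varS := variance_sum uB mg gK orth.
pose S v := \sum_(u <- B) g u v.
have mS : measurable_fun setT S by apply: measurable_sum.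
have ES2 : \int[P]_v (S v ^+ 2) <= N * C.
  rewrite varS /N -sum1_size natr_sum mulr_suml !big_seq; apply: ler_sum => u uinB.
  rewrite mul1r (@le_trans _ _ (\int[P]_v ((C - 2) * Z u v + 1))) //.
    apply: le_Rintegral => //.
    - apply: (@probability_integrable _ _ _ _ _ ((C + 1) ^+ 2)); first exact: measurable_funX.
      by move=> v; rewrite normrX lerXn2r ?nnegrE // addr_ge0 // ltW.
    - apply: (@probability_integrable _ _ _ _ _ (`|C - 2| * C + 1)).
        by apply: measurable_funD => //; exact: measurable_funM.
      move=> v; apply: le_trans (ler_normD _ _) _; rewrite normr1 lerD2r normrM.
      by rewrite ler_wpM2l //; exact: wle.
    move=> v _; rewrite /g uinB; have /andP[] := wC u (site Y u v); rewrite -/(Z u v); nra.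
  rewrite RintegralD //; last 2 first.
  - exact: (integrableZl measurableT (C - 2) (iZ u)).
  - by apply: (@probability_integrable _ _ _ _ _ 1) => // v; rewrite normr1.
  by rewrite RintegralZl // EZ // prob_Rintegral_cst; lra.
have mE : measurable (Pi I @^-1` A) by exact: measurable_preimage.
have iA : P.-integrable setT (EFin \o \1_(Pi I @^-1` A)).
  apply: (@probability_integrable _ _ _ _ _ 1); first exact: measurable_indic.
  by move=> v; rewrite indicE; case: (_ \in _); rewrite ?normr1 ?normr0.
have iZA u : P.-integrable setT (EFin \o (fun v => Z u v * \1_(Pi I @^-1` A) v)).
  apply: (@probability_integrable _ _ _ _ _ C).
    by apply: measurable_funM => //; exact: measurable_indic.
  move=> v; rewrite normrM indicE; case: (_ \in _); rewrite ?normr1 ?normr0 ?mulr0 ?mulr1 ?(ltW C0) //.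
  exact: wle.
have [iSZA eSZA] := @expectation_sum _ _ _ P _ B (fun u v => Z u v * \1_(Pi I @^-1` A) v) iZA.
have -> : fine (P (Pi I @^-1` A)) - N^-1 * (\sum_(u <- B) inserted (I `\ u) lam A) =
    \int[P]_v (- (N^-1 * S v) * \1_(Pi I @^-1` A) v).
  have -> : \sum_(u <- B) inserted (I `\ u) lam A = \sum_(u <- B) \int[P]_v (Z u v * \1_(Pi I @^-1` A) v).
    rewrite !big_seq; apply: eq_bigr => u uinB; have [mw _ lamE] := wP u.
    by rewrite (inserted_tilt (BI u uinB) mA mw (wC u) (lamE uinB)).
  rewrite -eSZA -RintegralZl // -(prob_Rintegral_indic _ mE) -RintegralB //; last first.
    exact: (integrableZl measurableT N^-1 iSZA).
  apply: eq_Rintegral => v _; rewrite /S -big_distrl /=.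
  have -> : \sum_(u <- B) g u v = \sum_(u <- B) Z u v - N.
    rewrite /N -sum1_size natr_sum -sumrB !big_seq; apply: eq_bigr => u uinB.
    by rewrite /g uinB.
  by field; rewrite gt_eqF.
have mSN : measurable_fun setT (fun v => - (N^-1 * S v) * \1_(Pi I @^-1` A) v).
  apply: measurable_funM; last exact: measurable_indic.
  by apply: measurableT_comp => //; exact: measurable_funM.
have Sle v : `|S v| <= N * (C + 1).
  apply: le_trans (ler_norm_sum _ _ _) _.
  rewrite /N -sum1_size natr_sum mulr_suml; apply: ler_sum => u _; rewrite mul1r; exact: gK.
have pw v : `|- (N^-1 * S v) * \1_(Pi I @^-1` A) v| <= s / 2 + (N ^+ 2 * s * 2)^-1 * S v ^+ 2.
  apply: (@le_trans _ _ `|N^-1 * S v|).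
    rewrite normrM normrN ler_piMr // indicE; case: (_ \in _); rewrite ?normr1 ?normr0 //.
  have -> : (N ^+ 2 * s * 2)^-1 * S v ^+ 2 = (N^-1 * S v) ^+ 2 / (2 * s).
    by field; rewrite !gt_eqF.
  by rewrite -(real_normK (num_real (N^-1 * S v))); exact: young_scaled.
have iS2 : P.-integrable setT (EFin \o (fun v => S v ^+ 2)).
  apply: (@probability_integrable _ _ _ _ _ ((N * (C + 1)) ^+ 2)); first exact: measurable_funX.
  by move=> v; rewrite normrX lerXn2r ?nnegrE ?mulr_ge0 ?addr_ge0 ?(ltW N0) ?(ltW C0).
have icst : P.-integrable setT (EFin \o (fun=> s / 2)).
  by apply: (@probability_integrable _ _ _ _ (fun=> s / 2) `|s / 2|).
have ikS := integrableZl measurableT (N ^+ 2 * s * 2)^-1 iS2.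
have ibd : P.-integrable setT (EFin \o (fun v => s / 2 + (N ^+ 2 * s * 2)^-1 * S v ^+ 2)).
  exact: (integrableD measurableT icst ikS).
have imain : P.-integrable setT (EFin \o (fun v => - (N^-1 * S v) * \1_(Pi I @^-1` A) v)).
  apply: (@probability_integrable _ _ _ _ _ (N^-1 * (N * (C + 1)))) => // v.
  rewrite normrM normrN normrM (ger0_norm (ltW _)) ?invr_gt0 //.
  rewrite -[leRHS]mulr1; apply: ler_pM => //; first by rewrite mulr_ge0 ?invr_ge0 ?(ltW N0).
    by rewrite ler_pM2l ?invr_gt0.
  by rewrite indicE; case: (_ \in _); rewrite ?normr1 ?normr0.
apply: le_trans (le_normr_Rintegral measurableT imain) _.
apply: (@le_trans _ _ (\int[P]_v (s / 2 + (N ^+ 2 * s * 2)^-1 * S v ^+ 2))).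
  by apply: le_Rintegral => //; exact: integrable_norm imain.
rewrite RintegralD //.
rewrite prob_Rintegral_cst RintegralZl //.
have k0 : 0 < (N ^+ 2 * s * 2)^-1 by rewrite invr_gt0 !mulr_gt0 ?exprn_gt0.
have h1 : (N ^+ 2 * s * 2)^-1 * \int[P]_v (S v ^+ 2) <= (N ^+ 2 * s * 2)^-1 * (N * (N * s ^+ 2)).
  rewrite ler_pM2l //; apply: (le_trans ES2); rewrite ler_pM2l //.
have h2 : (N ^+ 2 * s * 2)^-1 * (N * (N * s ^+ 2)) = s / 2 by field; rewrite !gt_eqF.
rewrite h2 in h1; apply: (le_trans (lerD (lexx _) h1)); lra.
Qed.

End exchange.

(** * Setwise limits of probabilities *)

Section setwise_limits.
Context {R : realType} d (T : measurableType d).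

(** Only the properties of a probability that survive averaging and are used in
    the Dynkin argument; real values make averages and differences painless. *)
Definition prob_content (q : set T -> R) : Prop :=
  [/\ q setT = 1,
      forall A B, measurable A -> measurable B -> A `&` B = set0 ->
        q (A `|` B) = q A + q B &
      forall F : (set T)^nat, (forall n, measurable (F n)) -> trivIset setT F ->
        (fun n => q (\big[setU/set0]_(i < n) F i)) @ \oo --> q (\bigcup_n F n)].

Lemma prob_content_prob (Q : probability T R) : prob_content (fun A => fine (Q A)).
Proof.
split=> [|A B mA mB AB|F mF tF]; first by rewrite probability_setT.
  by rewrite measureU // fineD ?fin_num_measure.
apply: fine_cvg; rewrite fineK ?fin_num_measure //; last exact: bigcupT_measurable.
have mU n : measurable (\big[setU/set0]_(i < n) F i) by exact: bigsetU_measurable.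
have ndU : nondecreasing_seq (fun n => \big[setU/set0]_(i < n) F i).
  by move=> m n mn; apply/subsetPset; exact: subset_bigsetU.
have := @nondecreasing_cvg_mu _ _ _ Q _ mU _ ndU.
have -> : \bigcup_n \big[setU/set0]_(i < n) F i = \bigcup_n F n.
  apply/seteqP; split=> x.
    by move=> [n _]; rewrite -bigcup_mkord => -[i _ Fx]; exists i.
  by move=> [n _ Fx]; exists n.+1 => //; rewrite -bigcup_mkord; exists n => //=.
by apply; exact: bigcupT_measurable.
Qed.

Lemma prob_content_avg (I : eqType) (s : seq I) (q : I -> set T -> R) : (0 < size s)%N ->
  (forall i, prob_content (q i)) ->
  prob_content (fun A => (size s)%:R^-1 * \sum_(i <- s) q i A).
Proof.
move=> s0 qP; split=> [|A B mA mB AB|F mF tF].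
- rewrite (eq_bigr (fun=> 1)) => [|i _]; last by case: (qP i).
  by rewrite -(natr_sum _ s predT (fun=> 1%N)) sum1_size mulVf // pnatr_eq0 -lt0n.
- rewrite -mulrDr -big_split /=; congr (_ * _); apply: eq_bigr => i _.
  by case: (qP i) => _ h _; exact: h.
- apply: cvgM; first exact: cvg_cst.
  elim: s {s0} => [|i s IH].
    by rewrite big_nil; under eq_fun do rewrite big_nil; exact: cvg_cst.
  rewrite big_cons; under eq_fun do rewrite big_cons.
  by apply: cvgD => //; case: (qP i) => _ _ h; exact: h.
Qed.

(** The uniform Cauchy bound passes from [q_ n - q_ m] to [q_ n - q] on every set
    where convergence holds.  This uniformity is what makes the class of such
    sets closed under countable disjoint unions, hence a Dynkin class. *)
Lemma setwise_limit (q_ : nat -> set T -> R) (q : set T -> R) (eps : nat -> R)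
    (L : set (set T)) :
  (forall n, prob_content (q_ n)) -> prob_content q -> setI_closed L ->
  L `<=` measurable -> (measurable : set (set T)) `<=` <<s L >> ->
  (forall A, L A -> q_ ^~ A @ \oo --> q A) ->
  (forall A m n, measurable A -> (n <= m)%N -> `|q_ n A - q_ m A| <= eps n) ->
  eps @ \oo --> 0 ->
  forall A n, measurable A -> `|q_ n A - q A| <= eps n.
Proof.
move=> q_P qP LI Lm mL qL qeps eps0.
have close A n : measurable A -> q_ ^~ A @ \oo --> q A -> `|q_ n A - q A| <= eps n.
  move=> mA qA; have : (fun m => `|q_ n A - q_ m A|) @ \oo --> `|q_ n A - q A|.
    by apply: cvg_norm; apply: cvgB => //; exact: cvg_cst.
  move=> /cvg_lim <- //; apply: limr_le.
    by apply/cvg_ex; exists `|q_ n A - q A|; apply: cvg_norm; apply: cvgB => //; exact: cvg_cst.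
  by near=> m; apply: qeps => //; near: m; exact: nbhs_infty_ge.
have limit A : measurable A -> (forall n, `|q_ n A - q A| <= eps n) -> q_ ^~ A @ \oo --> q A.
  move=> mA h; apply/cvgrPdist_le => e e0.
  have /cvgrPdist_le/(_ e e0) := eps0; apply: filterS => n /=.
  rewrite sub0r normrN distrC => en; apply: le_trans (h n) (le_trans (ler_norm _) en).
have setC (q' : set T -> R) S : prob_content q' -> measurable S -> q' (~` S) = 1 - q' S.
  move=> [qT qU _] mS.
  by rewrite -qT -(setUv S) qU ?setICr //; [ring|exact: measurableC].
have q0 (q' : set T -> R) : prob_content q' -> q' set0 = 0.
  move=> h; have := setC q' setT h measurableT; rewrite setCT => ->.
  by case: h => -> _ _; rewrite subrr.
have Lmeas S : <<s L >> S -> measurable S.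
  by apply: smallest_sub => //; exact: sigma_algebra_measurable.
move=> A n mA; apply: (close) => //.
pose T' := g_sigma_algebraType L.
apply: (@dynkin_induction _ T' L (fun A => q_ ^~ A @ \oo --> q A)) (mL _ mA) => //.
- case: qP => -> _ _; rewrite (_ : q_ ^~ setT = cst 1); first exact: cvg_cst.
  by apply/funext => k; case: (q_P k).
- move=> S mS h; rewrite setC //; last exact: Lmeas.
  rewrite (_ : q_ ^~ (~` S) = fun k => 1 - q_ k S); first by apply: cvgB => //; exact: cvg_cst.
  by apply/funext => k; rewrite setC //; exact: Lmeas.
move=> F mF' tF h.
have mF (k : nat) : d.-measurable (F k) by exact: (Lmeas _ (mF' k)).
have mU (k : nat) : d.-measurable (\big[setU/set0]_(i < k) F i) by exact: bigsetU_measurable.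
have addF (q' : set T -> R) k : prob_content q' ->
    q' (\big[setU/set0]_(i < k) F i) = \sum_(i < k) q' (F i).
  move=> q'P; elim: k => [|k IH]; first by rewrite !big_ord0 q0.
  rewrite !big_ord_recr /= -IH; case: q'P => _ qU _; apply: qU; [exact: mU|exact: mF|].
  rewrite -bigcup_mkord; apply/seteqP; split=> // x [[i /= ik Fi] Fk].
  have e : F i `&` F k = set0.
    by move/trivIsetP : tF => /(_ i k I I); apply; rewrite neq_ltn ik.
  by have : (F i `&` F k) x by []; rewrite e.
apply: (limit); first exact: bigcupT_measurable.
move=> m.
have [_ _ /(_ F mF tF) c1] := q_P m; have [_ _ /(_ F mF tF) c2] := qP.
have c3 : (fun k => `|q_ m (\big[setU/set0]_(i < k) F i) - q (\big[setU/set0]_(i < k) F i)|) @ \oo -->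
    `|q_ m (\bigcup_k F k) - q (\bigcup_k F k)|.
  by apply: cvg_norm; exact: cvgB.
rewrite -(cvg_lim _ c3) //; apply: limr_le; first by apply/cvg_ex; eexists; exact: c3.
apply: nearW => k; apply: (close) => //.
rewrite addF //; rewrite (_ : q_ ^~ _ = fun n => \sum_(i < k) q_ n (F i)).
  elim: (k) => [|j IH].
    by rewrite big_ord0; under eq_fun do rewrite big_ord0; exact: cvg_cst.
  by rewrite big_ord_recr /=; under eq_fun do rewrite big_ord_recr /=; apply: cvgD.
by apply/funext => j; rewrite addF.
Unshelve. all: by end_near.
Qed.

End setwise_limits.

(** * Local events *)

Section local_events.
Context {R : realType}.

Lemma measurable_restrict_conf (B : set R) : measurable B ->
  measurable_fun setT (fun p : configuration R => restrict_conf p B).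
Proof.
move=> mB; apply: measurable_conf => A mA.
rewrite (_ : (fun w => _) = npoints (B `&` A)); last first.
  by apply/funext => p; rewrite /npoints /= setIA.
by apply: measurable_npoints; exact: measurableI.
Qed.

Definition window (n : nat) : set R := [set z | `|z| <= n%:R].

Lemma measurable_window n : measurable (window n).
Proof.
rewrite (_ : window n = `[- n%:R, n%:R]%classic); first exact: measurable_itv.
by apply/seteqP; split=> z /=; rewrite /window /= in_itv /= ler_norml.
Qed.

Definition local_event : set (set (configuration R)) :=
  [set A | exists n A', measurable A' /\ A = (fun p => restrict_conf p (window n)) @^-1` A'].

Lemma local_event_measurable : local_event `<=` measurable.
Proof.
move=> _ [n [A [mA ->]]]; rewrite -[X in measurable X]setTI.
exact: measurable_restrict_conf (measurable_window n) _ _ mA.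
Qed.

Lemma restrict_window n m (p : configuration R) : (n <= m)%N ->
  restrict_conf (restrict_conf p (window m)) (window n) = restrict_conf p (window n).
Proof.
move=> nm; apply: conf_eq => /=; apply/seteqP; split=> x /= [].
  by move=> [].
move=> px xn; split => //; split => //.
by rewrite /window /= (le_trans xn) // ler_nat.
Qed.

Lemma local_event_le n m A : (n <= m)%N -> measurable A -> exists2 A' : set (configuration R),
  measurable A' & (fun p : configuration R => restrict_conf p (window n)) @^-1` A =
                  (fun p => restrict_conf p (window m)) @^-1` A'.
Proof.
move=> nm mA; exists ((fun p : configuration R => restrict_conf p (window n)) @^-1` A).
  by apply: local_event_measurable; exists n, A.
by apply/seteqP; split=> p /=; rewrite restrict_window.
Qed.

Lemma local_event_setI : setI_closed local_event.
Proof.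
move=> _ _ [n [A [mA ->]]] [m [B [mB ->]]].
have [A' mA' ->] := local_event_le (leq_maxl n m) mA.
have [B' mB' ->] := local_event_le (leq_maxr n m) mB.
by exists (maxn n m), (A' `&` B'); split => //; exact: measurableI.
Qed.

(** A count over a Borel set is at least [k] exactly when the count over some
    window is, so all counting events are generated by local ones. *)
Lemma measurable_local_event : (measurable : set (set (configuration R))) `<=` <<s local_event >>.
Proof.
move=> A mA.
pose T' := g_sigma_algebraType local_event.
have mid : measurable_fun setT (id : T' -> configuration R).
  apply: measurable_conf => B mB; apply: measurable_counting => k.
  rewrite (_ : [set w | _] = \bigcup_n
      ((fun p : configuration R => restrict_conf p (window n)) @^-1` (npoints B @^-1` [set y | (k%:R%:E <= y)%E]))).
    apply: bigcupT_measurable => n; apply: sub_sigma_algebra; exists n, (npoints B @^-1` [set y | (k%:R%:E <= y)%E]).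
    split => //; rewrite -[X in measurable X]setTI; apply: measurable_npoints => //.
    rewrite (_ : [set y | _] = `[k%:R%:E, +oo[%classic); first exact: emeasurable_itv.
    by apply/seteqP; split=> y /=; rewrite in_itv /= andbT.
  apply/seteqP; split=> p /=; last first.
    move=> [n _]; rewrite /= /npoints leq_counting => h; apply: (card_le_trans h).
    by apply: subset_card_le => x [[]].
  move=> /card_ge_seqP[l [lk ul lA]].
  pose n := Num.bound (\sum_(x <- l) `|x|).
  exists n => //; rewrite /npoints /= leq_counting; apply/card_ge_seqP; exists l; split => // x xl.
  have [px Bx] := lA x xl; do 2! split => //; rewrite /window /=.
  apply: ltW; apply: le_lt_trans (archi_boundP _); last by apply: sumr_ge0.
  by rewrite (big_rem x) //= lerDl; apply: sumr_ge0.
by have := mid measurableT A mA; rewrite setTI.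
Qed.

End local_events.

(** * Null sets of products, and averages *)

Section product_null.
Context {R : realType} d1 d2 (T1 : measurableType d1) (T2 : measurableType d2).

(** A product null set has null sections for almost every first coordinate. *)
Lemma product_null (m1 : probability T1 R) (m2 m2' : probability T2 R) (E : set (T1 * T2)) :
  measurable E -> (forall B, measurable B -> m2 B = 0%E -> m2' B = 0%E) ->
  (m1 \x m2)%E E = 0%E -> (m1 \x m2')%E E = 0%E.
Proof.
move=> mE dom E0.
have abs (q : probability T2 R) : (m1 \x q)%E E = (\int[m1]_x `|q (xsection E x)|)%E.
  by apply: eq_integral => x _; rewrite gee0_abs.
have mq (q : probability T2 R) : measurable_fun setT (fun x => q (xsection E x)).
  exact: measurable_fun_xsection.
move: E0; rewrite (abs m2) => /(ae_eq_integral_abs m1 measurableT (mq m2)) E0.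
rewrite (abs m2'); apply/(ae_eq_integral_abs m1 measurableT (mq m2')).
apply: filterS E0 => x /= h _; apply: dom; first exact: measurable_xsection.
exact: h.
Qed.

Lemma product_sections (m1 : probability T1 R) (m2 : probability T2 R) (E : set (T1 * T2)) :
  measurable E -> fine ((m1 \x m2)%E E) = \int[m2]_y fine (m1 (ysection E y)).
Proof.
move=> mE; rewrite /Rintegral; congr fine.
have := @indic_fubini_tonelli _ _ _ _ R m1 m2 E mE.
rewrite (indic_fubini_tonelli_FE m2 mE) (indic_fubini_tonelli_GE m1 mE) => e.
rewrite [LHS](_ : _ = (\int[m1]_x (m2 \o xsection E) x)%E) // e.
apply: eq_integral => y _ /=; rewrite fineK // fin_num_measure //.
exact: measurable_ysection.
Qed.

End product_null.

Lemma prob_le_ae {R : realType} d (T : measurableType d) (P : probability T R) (E F : set T) :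
  measurable E -> measurable F -> {ae P, forall w, E w -> F w} -> (P E <= P F)%E.
Proof.
move=> mE mF [N [mN N0 EF]]; rewrite -[leRHS]adde0 -N0.
apply: le_trans (measureU2 P mF mN); apply: le_measure; [exact/mem_set|by apply/mem_set; exact: measurableU|].
move=> w Ew; have [Nw|nN] := pselect (N w); [by right|left].
by apply: contrapT => nF; apply: nN; apply: EF => /(_ Ew).
Qed.

Section averages.
Context {R : realFieldType} (J : eqType) (s : seq J).

Lemma avg_dist (f g e : J -> R) : (forall u, u \in s -> `|f u - g u| <= e u) ->
  `|(size s)%:R^-1 * \sum_(u <- s) f u - (size s)%:R^-1 * \sum_(u <- s) g u| <=
  (size s)%:R^-1 * \sum_(u <- s) e u.
Proof.
move=> h; rewrite -mulrBr normrM ger0_norm ?invr_ge0 // ler_wpM2l ?invr_ge0 // -sumrB.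
apply: le_trans (ler_norm_sum _ _ _) _; rewrite !big_seq; exact: ler_sum.
Qed.

Lemma avg_cst (c : R) : (0 < size s)%N -> (size s)%:R^-1 * \sum_(u <- s) c = c.
Proof.
move=> s0; rewrite big_const_seq count_predT iter_addr_0 -[c *+ _]mulr_natl mulrA mulVf ?mul1r //.
by rewrite pnatr_eq0 -lt0n.
Qed.

End averages.

(** * Comparison of successive blocks of labels *)

(** Disjoint blocks of labels together with reference laws [lam k] bounded by
    [C k] times the law of each site of the blocks [k] and [k.+1].  The last two
    fields say that the error of [exchange] is [sigma * rho ^+ k] for either
    block. *)
Record block_system {R : realType} d (T : measurableType d) (P : probability T R)
    (Y : int -> {RV P >-> R}) (lam : nat -> probability R R) (blk : nat -> seq int)
    (C : nat -> R) (sigma rho : R) : Prop := BlockSystem {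
  block_uniq : forall k, uniq (blk k);
  block_size : forall k, (k < size (blk k))%N;
  block_disjoint : forall k u v, u \in blk k -> v \in blk k.+1 -> u != v;
  block_cst_gt0 : forall k, 0 < C k;
  block_sigma_gt0 : 0 < sigma;
  block_rho01 : 0 < rho < 1;
  block_le : forall k u A, (u \in blk k) || (u \in blk k.+1) -> measurable A ->
    (lam k A <= (C k)%:E * distribution P (site Y u : {RV P >-> R}) A)%E;
  block_cst_le : forall k, C k <= (size (blk k))%:R * (sigma * rho ^+ k) ^+ 2;
  block_cst_le_next : forall k, C k <= (size (blk k.+1))%:R * (sigma * rho ^+ k) ^+ 2
}.

Section block_comparison.
Context {R : realType} d (T : measurableType d) (P : probability T R).
Variable Y : int -> {RV P >-> R}.
Hypothesis indepY : mutually_independent Y.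
Hypothesis lawY : forall x, has_law (Y x) (distribution P (Y 0)).

Local Notation X := (fun x => site Y x : {RV P >-> R}).
Local Notation Pi D := (perturbed_lattice D Y).

Variables (lam : nat -> probability R R) (blk : nat -> seq int).
Variables (C : nat -> R) (sigma rho : R).
Hypothesis sys : block_system Y lam blk C sigma rho.
Let blk_uniq := block_uniq sys.
Let blk_size := block_size sys.
Let blk_disj := block_disjoint sys.
Let C_gt0 := block_cst_gt0 sys.
Let sigma0 := block_sigma_gt0 sys.
Let rho01 := block_rho01 sys.
Let lam_le := block_le sys.
Let C_le := block_cst_le sys.
Let C_le1 := block_cst_le_next sys.

Variable I : set int.
Hypothesis blkI : forall k u, u \in blk k -> I u.

Let size_gt0 k : (0 < size (blk k))%N. Proof. exact: leq_ltn_trans _ (blk_size k). Qed.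
Let err0 k : 0 < sigma * rho ^+ k.
Proof. by have /andP[r0 _] := rho01; rewrite mulr_gt0 // exprn_gt0. Qed.

Definition block_avg k (A : set (configuration R)) : R :=
  (size (blk k))%:R^-1 * \sum_(u <- blk k) fine (P (Pi (I `\ u) @^-1` A)).

(** The sum of the geometric series of errors from [k] on. *)
Definition tail_err k : R := 2 * (sigma * rho ^+ k) / (1 - rho).

(** Both averages are within one exchange error of the same quantity, in which
    one label of each block is removed and one point of law [lam k] is inserted. *)
Lemma block_avg_step k A : measurable A ->
  `|block_avg k A - block_avg k.+1 A| <= 2 * (sigma * rho ^+ k).
Proof.
move=> mA.
pose M := (size (blk k))%:R^-1 * \sum_(u <- blk k) ((size (blk k.+1))%:R^-1 *
  \sum_(v <- blk k.+1) inserted Y (I `\ u `\ v) (lam k) A).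
have h1 : `|block_avg k A - M| <= sigma * rho ^+ k.
  rewrite -[leRHS](avg_cst (sigma * rho ^+ k) (size_gt0 k)); apply: avg_dist => u uk.
  apply: (exchange indepY lawY (C := C k)) => //.
  - move=> v vk; split; first exact: (blkI vk).
    by move=> /= vu; have := blk_disj uk vk; rewrite vu eqxx.
  - by move=> v vk B mB; apply: lam_le => //; rewrite vk orbT.
have h2 : `|block_avg k.+1 A - M| <= sigma * rho ^+ k.
  rewrite -[leRHS](avg_cst (sigma * rho ^+ k) (size_gt0 k.+1)).
  have -> : M = (size (blk k.+1))%:R^-1 * \sum_(v <- blk k.+1) ((size (blk k))%:R^-1 *
      \sum_(u <- blk k) inserted Y (I `\ v `\ u) (lam k) A).
    rewrite /M -!mulr_sumr mulrCA exchange_big /=; do 2 congr (_ * _).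
    apply: eq_bigr => v _; apply: eq_bigr => u _.
    congr inserted; apply/seteqP; split=> x [[]] /=; tauto.
  apply: avg_dist => v vk.
  apply: (exchange indepY lawY (C := C k)) => //.
  - move=> u uk; split; first exact: (blkI uk).
    by move=> /= vu; have := blk_disj uk vk; rewrite vu eqxx.
  - by move=> u uk B mB; apply: lam_le => //; rewrite uk.
have -> : block_avg k A - block_avg k.+1 A = (block_avg k A - M) - (block_avg k.+1 A - M) by ring.
apply: le_trans (ler_normB _ _) _; lra.
Qed.

Lemma block_avg_cauchy A m n : measurable A -> (n <= m)%N ->
  `|block_avg n A - block_avg m A| <= tail_err n.
Proof.
move=> mA nm; have /andP[r0 r1] := rho01.
have r1' : 0 < 1 - rho by rewrite subr_gt0.
have h j : `|block_avg n A - block_avg (n + j) A| <= tail_err n * (1 - rho ^+ j).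
  elim: j => [|j IH]; first by rewrite addn0 subrr normr0 expr0 subrr mulr0.
  rewrite addnS; apply: le_trans (ler_distD (block_avg (n + j) A) _ _) _.
  apply: (le_trans (lerD IH (block_avg_step (n + j) mA))).
  rewrite le_eqVlt; apply/orP; left; apply/eqP; rewrite /tail_err exprD exprS.
  by field; rewrite gt_eqF.
rewrite -(subnKC nm); apply: le_trans (h _) _; rewrite ler_piMr //.
  by rewrite /tail_err divr_ge0 ?mulr_ge0 ?exprn_ge0 ?ltW.
by rewrite lerBlDr lerDl exprn_ge0 // ltW.
Qed.

Lemma tail_err_cvg0 : tail_err @ \oo --> 0.
Proof.
have /andP[r0 r1] := rho01.
rewrite (_ : tail_err = fun k => geometric (2 * sigma / (1 - rho)) rho k).
  by apply: cvg_geometric; rewrite gtr0_norm.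
by apply/funext => k; rewrite /tail_err /=; ring.
Qed.

(** Removing a site changes a local event only if the site lies in the window. *)
Lemma remove_far_site n u A : I u -> measurable A ->
  `|fine (P (Pi (I `\ u) @^-1` ((fun p => restrict_conf p (window n)) @^-1` A))) -
    fine (P (Pi I @^-1` ((fun p => restrict_conf p (window n)) @^-1` A)))| <=
  fine (P (X u @^-1` window n)).
Proof.
move=> Iu mA; set L := (fun p : configuration R => restrict_conf p (window n)) @^-1` A.
have mL : measurable L by apply: local_event_measurable; exists n, A.
have m1 : measurable (Pi (I `\ u) @^-1` L) by exact: measurable_preimage.
have m2 : measurable (Pi I @^-1` L) by exact: measurable_preimage.
have m3 : measurable (X u @^-1` window n).
  by apply: measurable_preimage; exact: measurable_window.
have same : {ae P, forall w, ~ (X u @^-1` window n) w ->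
    (Pi (I `\ u) @^-1` L) w <-> (Pi I @^-1` L) w}.
  have := ae_lattice_insert lawY Iu; apply: filterS => w /= -> nw.
  rewrite /L /= (_ : restrict_conf (add_pt _ _) _ = restrict_conf (Pi (I `\ u) w) (window n)) //.
  apply: conf_eq => /=; apply/seteqP; split=> x /= [px xn]; split => //; last by left.
  by case: px => // xu; case: nw; rewrite -xu.
have le (E F : set T) : measurable E -> measurable F ->
    {ae P, forall w, ~ (X u @^-1` window n) w -> E w -> F w} ->
    fine (P E) <= fine (P F) + fine (P (X u @^-1` window n)).
  move=> mE mF h; rewrite -fineD ?fin_num_measure //; apply: fine_le.
  - exact: fin_num_measure.
  - by rewrite fin_numD !fin_num_measure.
  apply: (@le_trans _ _ (P (F `|` X u @^-1` window n))); last exact: measureU2.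
  apply: prob_le_ae => //; first exact: measurableU.
  apply: filterS h => w h Ew; have [|nw] := pselect ((X u @^-1` window n) w); [by right|].
  by left; apply: h.
have l1 := le _ _ m1 m2 _; have l2 := le _ _ m2 m1 _.
rewrite ler_norml lerBlDl lerBrDl; apply/andP; split; last first.
  by apply: l1; apply: filterS same => w h /h [].
by rewrite lerBlDr; apply: l2; apply: filterS same => w h /h [].
Qed.

(** The expected number of visits of a window is bounded over the whole lattice,
    so on average over a growing block a site is unlikely to visit it. *)
Lemma block_avg_local L : local_event L -> block_avg ^~ L @ \oo --> fine (P (Pi I @^-1` L)).
Proof.
move=> [n [A [mA ->]]]; set L' := _ @^-1` A.
apply/cvgrPdist_le => e e0.
pose K : R := n.*2.+1%:R.
near=> k.
pose N : R := (size (blk k))%:R; have N0 : 0 < N by rewrite ltr0n.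
have kN : N^-1 * K <= e.
  rewrite ler_pdivrMl // mulrC -ler_pdivrMl // mulrC.
  apply: (@le_trans _ _ k%:R); last by rewrite /N ler_nat ltnW.
  by near: k; exact: nbhs_infty_ger.
apply: le_trans kN; rewrite distrC -[X in _ - X](avg_cst _ (size_gt0 k)).
apply: (@le_trans _ _ (N^-1 * (\sum_(u <- blk k) fine (P (X u @^-1` window n))))).
  by apply: avg_dist => u uk; apply: remove_far_site => //; exact: (blkI uk).
rewrite ler_pM2l ?invr_gt0 //.
have mW u : measurable (X u @^-1` window n).
  by apply: measurable_preimage; exact: measurable_window.
rewrite -lee_fin -sumEFin; apply: le_trans (expected_count lawY n (blk_uniq k)).
by apply: lee_sum => u _; rewrite fineK // fin_num_measure.
Unshelve. all: by end_near.
Qed.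

(** Local convergence identifies the limit of the Cauchy sequence of averages, and
    the Cauchy bound makes the convergence uniform over all events. *)
Lemma block_avg_close A n : measurable A ->
  `|block_avg n A - fine (P (Pi I @^-1` A))| <= tail_err n.
Proof.
apply: (@setwise_limit _ _ _ block_avg (fun A => fine (P (Pi I @^-1` A))) tail_err local_event).
- move=> k; apply: prob_content_avg; first exact: size_gt0.
  by move=> u; exact: (prob_content_prob (distribution P (Pi (I `\ u)))).
- exact: (prob_content_prob (distribution P (Pi I))).
- exact: local_event_setI.
- exact: local_event_measurable.
- exact: measurable_local_event.
- exact: block_avg_local.
- exact: block_avg_cauchy.
- exact: tail_err_cvg0.
Qed.

Lemma inserted_sections D (mu : probability R R) A : measurable A ->
  inserted Y D mu A = \int[mu]_z fine (P (Pi D @^-1` ysection (insert_event A) z)).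
Proof. by move=> mA; rewrite /inserted product_sections //; exact: measurable_insert_event. Qed.

(** Integrate [block_avg_close] over the position of the inserted point: the bound
    is uniform over the events obtained as sections. *)
Lemma inserted_avg_close (mu : probability R R) A n : measurable A ->
  `|(size (blk n))%:R^-1 * \sum_(u <- blk n) inserted Y (I `\ u) mu A - inserted Y I mu A|
  <= tail_err n.
Proof.
move=> mA; have mE := measurable_insert_event mA.
pose g D z := fine (P (Pi D @^-1` ysection (insert_event A) z)).
have g01 D z : `|g D z| <= 1.
  have mS : measurable (Pi D @^-1` ysection (insert_event A) z).
    by apply: measurable_preimage; exact: measurable_ysection.
  rewrite ger0_norm ?fine_ge0 // -lee_fin fineK ?fin_num_measure //.
  exact: probability_le1.
have mg D : measurable_fun setT (g D).
  apply: measurableT_comp => //.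
  exact: (measurable_fun_ysection (distribution P (Pi D)) mE).
have ig D : mu.-integrable setT (EFin \o g D).
  by apply: (@probability_integrable _ _ _ mu (g D) 1).
have [iS eS] := @expectation_sum _ _ _ mu _ (blk n) (fun u => g (I `\ u)) (fun u => ig (I `\ u)).
rewrite inserted_sections // -/(g I).
rewrite (eq_bigr (fun u => \int[mu]_z g (I `\ u) z)); last by move=> u _; rewrite inserted_sections.
have iN := integrableZl measurableT (size (blk n))%:R^-1 iS.
rewrite -eS -RintegralZl // -RintegralB //; last exact: (ig I).
have iD := integrableB measurableT iN (ig I).
apply: le_trans (le_normr_Rintegral measurableT iD) _.
rewrite -[leRHS](prob_Rintegral_cst mu); apply: le_Rintegral => //.
- exact: integrable_norm iD.
- by apply: (@probability_integrable _ _ _ _ (fun=> tail_err n) `|tail_err n|).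
by move=> z _; apply: block_avg_close; exact: measurable_ysection.
Qed.

Lemma inserted_close A n : measurable A ->
  `|fine (P (Pi I @^-1` A)) - inserted Y I (lam n) A| <= sigma * rho ^+ n + tail_err n.
Proof.
move=> mA; apply: le_trans (ler_distD _ _ _) (lerD _ (inserted_avg_close (lam n) n mA)).
apply: (exchange indepY lawY (C := C n)) => //.
- by move=> u; exact: blkI.
- by move=> u un B mB; apply: lam_le => //; rewrite un.
Qed.

Lemma null_of_small_tail (a : R) : 0 <= a ->
  (forall n, a <= sigma * rho ^+ n + tail_err n) -> a = 0.
Proof.
move=> a0 h; have /andP[r0 r1] := rho01.
apply/eqP; rewrite eq_le a0 andbT.
have lim : (fun n => sigma * rho ^+ n + tail_err n) @ \oo --> (0 : R).
  rewrite -[0]addr0; apply: cvgD; last exact: tail_err_cvg0.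
  by apply: (@cvg_geometric R sigma rho); rewrite gtr0_norm.
rewrite -(cvg_lim _ lim) //; apply: limr_ge; first by apply/cvg_ex; exists 0.
exact: nearW.
Qed.

End block_comparison.

(** * Stable sites and uniform laws *)

Section uniform_law.
Context {R : realType} (a b : R) (ab : a < b).
Notation mu := (@lebesgue_measure R).

Definition uniform_on (lam : probability R R) :=
  forall A, measurable A -> lam A = ((b - a)^-1%:E * mu (A `&` `[a, b]%classic))%E.

(** The uniform probability lives on a type whose Borel structure is presented
    differently; this transports it. *)
Lemma uniform_on_exists : exists lam : probability R R, uniform_on lam.
Proof.
pose L (A : set R) : \bar R := uniform_prob ab A.
have L0 : L set0 = 0%E by exact: measure0.
have L_ge0 B : (0 <= L B)%E by exact: measure_ge0.
have L_sigma : semi_sigma_additive L.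
  exact: (@measure_semi_sigma_additive _ _ _ (uniform_prob ab)).
have LT : L setT = 1%E by exact: (@probability_setT _ _ _ (uniform_prob ab)).
pose M := isMeasure.Build _ _ _ L L0 L_ge0 L_sigma.
pose m : {measure set R -> \bar R} := HB.pack L M.
pose Pr := @Measure_isProbability.Build _ _ _ m LT.
exists (HB.pack_for (probability R R) L M Pr) => A mA.
rewrite [LHS](_ : _ = uniform_prob ab A) // /uniform_prob integral_uniform_pdf.
rewrite (eq_integral (fun=> (b - a)^-1%:E)).
  by rewrite integral_cst //; exact: measurableI.
by move=> x /set_mem[_]; rewrite /= in_itv /= /uniform_pdf => ->.
Qed.

End uniform_law.

Section stable_sites.
Context {R : realType} d (T : measurableType d) (P : probability T R).
Variable Y : int -> {RV P >-> R}.
Hypothesis lawY : forall x, has_law (Y x) (distribution P (Y 0)).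
Variables alpha c : R.
Hypothesis alpha0 : 0 < alpha.
Hypothesis c0 : 0 < c.
Let nu : probability R R := distribution P (Y 0).
Hypothesis cos_nu : forall t, \int[nu]_y cos (t * y) = stable_cf alpha c t.
Hypothesis sin_nu : forall t, \int[nu]_y sin (t * y) = 0.
Notation mu := (@lebesgue_measure R).
Local Notation X x := (site Y x : {RV P >-> R}).

Lemma site_itv x (p q : R) :
  distribution P (X x) `[p, q]%classic = nu `[p - x%:~R, q - x%:~R]%classic.
Proof.
rewrite /distribution /pushforward site_law //; congr (nu _).
by apply/seteqP; split=> y /=; rewrite !in_itv /= lerBlDl lerBrDl.
Qed.

Lemma site_atomless x (a : R) : distribution P (X x) [set a] = 0%E.
Proof.
have e : distribution P (X x) [set a] = nu [set a - x%:~R].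
  rewrite /distribution /pushforward site_law //; congr (nu _).
  by apply/seteqP; split=> y /= => [<-|->]; ring.
by rewrite e; exact: (stable_atomless alpha0 c0 cos_nu sin_nu).
Qed.

Lemma site_itv_oc x (p q : R) : p < q ->
  distribution P (X x) `]p, q]%classic = distribution P (X x) `[p, q]%classic.
Proof.
move=> pq; have -> : `[p, q]%classic = [set p] `|` `]p, q]%classic :> set R.
  apply/seteqP; split=> z /=; rewrite !in_itv /=.
    by move=> /andP[]; rewrite le_eqVlt => /predU1P[->|->] zq; [left|right].
  by move=> [->|/andP[/ltW -> ->] //]; rewrite lexx ltW.
rewrite measureU //.
  by rewrite -[LHS]add0e -[in LHS](site_atomless x p).
by apply/seteqP; split=> // z [/= ->]; rewrite in_itv /= ltxx.
Qed.

Lemma site_abs_continuous x (A : set R) : measurable A -> mu A = 0%E ->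
  distribution P (X x) A = 0%E.
Proof.
move=> mA A0; have [K K0 hK] := stable_le_length alpha0 c0 cos_nu sin_nu.
have := @prob_le_lebesgue _ (distribution P (X x)) K (ltW K0) _ A mA.
rewrite A0 mule0 => h; apply/eqP; rewrite eq_le measure_ge0 andbT; apply: h.
move=> p q pq; rewrite [Z in fine Z](site_itv_oc x pq) site_itv.
apply: le_trans (hK _ _ _) _; first by rewrite ltrD2r.
by rewrite le_eqVlt; apply/orP; left; apply/eqP; ring.
Qed.

Hypothesis alpha1 : alpha < 1.

(** On an interval at distances between [eta] and [D] from the site's label, the
    density of the site is at least of order [D `^ (- 1 - alpha)]. *)
Lemma uniform_le_site (eta : R) : 0 < eta -> exists2 K : R, 0 < K &
  forall (x : int) (a b D : R) (lam : probability R R), a < b -> uniform_on a b lam -> 0 < D ->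
  (forall z, a <= z <= b -> eta <= `|z - x%:~R| <= D) ->
  forall A, measurable A ->
  (lam A <= (K * D `^ (1 + alpha) / (b - a))%:E * distribution P (X x) A)%E.
Proof.
move=> eta0; have [k k0 hk] := stable_ge_length alpha0 c0 cos_nu sin_nu alpha1 eta0.
exists k^-1; first by rewrite invr_gt0.
move=> x a b D lam ab lamE D0 xD A mA.
pose w : R := k * D `^ (- 1 - alpha) * (b - a).
have w0 : 0 < w by rewrite !mulr_gt0 ?powR_gt0 // subr_gt0.
have -> : k^-1 * D `^ (1 + alpha) / (b - a) = w^-1.
  have -> : D `^ (1 + alpha) = (D `^ (- 1 - alpha))^-1.
    by rewrite -powRN; congr (_ `^ _); ring.
  by rewrite /w !invfM.
have : (w%:E * lam A <= distribution P (X x) A)%E.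
  apply: prob_le_scale => //; first exact: ltW.
  move=> p q pq; rewrite [Z in _ <= fine Z](site_itv_oc x pq).
  pose p' := Num.max p a; pose q' := Num.min q b.
  have sub : (`]p, q]%classic `&` `[a, b]%classic : set R) `<=` `[p', q']%classic.
    move=> z [] /=; rewrite !in_itv /= => /andP[pz zq] /andP[az zb].
    by rewrite ge_max le_min (ltW pz) az zq zb.
  have mI : measurable (`]p, q]%classic `&` `[a, b]%classic : set R) by exact: measurableI.
  have le1 : (mu (`]p, q]%classic `&` `[a, b]%classic) <= mu `[p', q']%classic)%E.
    by apply: le_measure => //; exact: mem_set.
  have U : fine (lam `]p, q]%classic) =
      (b - a)^-1 * fine (mu (`]p, q]%classic `&` `[a, b]%classic)).
    rewrite lamE // fineM // ge0_fin_numE //.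
    by apply: (le_lt_trans le1); exact: lebesgue_itv_lty.
  rewrite U /w -mulrA mulVKf; last by rewrite gt_eqF // subr_gt0.
  have [pq'|qp'] := ltP p' q'; last first.
    have -> : mu (`]p, q]%classic `&` `[a, b]%classic) = 0%E.
      apply/eqP; rewrite eq_le measure_ge0 andbT (le_trans le1) //.
      by rewrite lebesgue_measure_itv /= lte_fin ltNge qp'.
    by rewrite /= mulr0 fine_ge0.
  have le2 : fine (mu (`]p, q]%classic `&` `[a, b]%classic)) <= q' - p'.
    rewrite -lee_fin fineK; last first.
      by rewrite ge0_fin_numE //; apply: (le_lt_trans le1); exact: lebesgue_itv_lty.
    by apply: (le_trans le1); rewrite lebesgue_measure_itv /= lte_fin pq'.
  apply: (@le_trans _ _ (k * D `^ (- 1 - alpha) * (q' - p'))).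
    by rewrite ler_pM2l // mulr_gt0 // powR_gt0.
  apply: (@le_trans _ _ (fine (distribution P (X x) `[p', q']%classic))).
    rewrite site_itv; have -> : q' - p' = (q' - x%:~R) - (p' - x%:~R) by ring.
    apply: hk; first by rewrite ltrD2r.
    move=> z; rewrite lerBlDr lerBrDr => /andP[pz zq].
    have := xD (z + x%:~R); rewrite addrK; apply; apply/andP; split.
      by apply: le_trans pz; rewrite /p' le_max lexx orbT.
    by apply: (le_trans zq); rewrite /q' ge_min lexx orbT.
  apply: fine_le; rewrite ?fin_num_measure //.
  apply: le_measure; [exact: mem_set|exact: mem_set|].
  move=> z /=; rewrite !in_itv /= ge_max le_min => /andP[/andP[-> _] /andP[-> _]] //.
move=> h; rewrite -(@lee_pmul2l _ w%:E) ?lte_fin //.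
by rewrite muleA -EFinM mulfV ?gt_eqF // mul1e.
Qed.

(** The real line minus the label is a countable union of intervals that stay away
    from the label, and on each of them the uniform law is bounded by a multiple
    of the law of the site. *)
Lemma lebesgue_abs_continuous v (A : set R) : measurable A ->
  distribution P (X v) A = 0%E -> mu A = 0%E.
Proof.
move=> mA A0.
have piece (a b : R) : a < b -> (b < v%:~R \/ v%:~R < a) ->
    mu (A `&` `[a, b]%classic) = 0%E.
  move=> ab hv.
  have [eta eta0 heta] : exists2 eta : R, 0 < eta & forall z, a <= z <= b -> eta <= `|z - v%:~R|.
    case: hv => hv; [exists (v%:~R - b)|exists (a - v%:~R)]; rewrite ?subr_gt0 // => z /andP[az zb].
      by rewrite distrC (le_trans _ (ler_norm _)) // lerB.
    by rewrite (le_trans _ (ler_norm _)) // lerB.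
  have [K K0 hK] := uniform_le_site eta0.
  pose D : R := `|a| + `|b| + `|v%:~R| + 1.
  have D0 : 0 < D by rewrite ltr_wpDl // !addr_ge0.
  have [lam lamE] := uniform_on_exists ab.
  have := hK v a b D lam ab lamE D0 _ A mA; rewrite A0 mule0 lamE // => h.
  have {}h : ((b - a)^-1%:E * mu (A `&` `[a, b]%classic) <= 0)%E.
    apply: h => z azb; rewrite (heta _ azb) /=; move/andP: azb => [az zb].
    apply: le_trans (ler_normB _ _) _; rewrite /D -addrA lerD //; last by rewrite lerDl.
    rewrite ler_norml; apply/andP; split.
      rewrite lerNl; apply: (@le_trans _ _ (- a)); first by rewrite lerN2.
      by apply: (le_trans (ler_norm _)); rewrite normrN lerDl.
    by apply: (le_trans zb); apply: (le_trans (ler_norm _)); rewrite lerDr.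
  apply/eqP; rewrite eq_le measure_ge0 andbT.
  by move: h; rewrite pmule_rle0 // lte_fin invr_gt0 subr_gt0.
pose F n : set R := (A `&` `[v%:~R - n.+2%:R, v%:~R - n.+1%:R^-1]%classic) `|`
  (A `&` `[v%:~R + n.+1%:R^-1, v%:~R + n.+2%:R]%classic).
have n12 n : n.+1%:R^-1 < n.+2%:R :> R.
  by apply: (@le_lt_trans _ _ 1); rewrite ?invf_le1 ?ler1n ?ltr1n.
have F0 n : mu.-negligible (F n).
  apply: negligibleU; apply/negligibleP; try exact: measurableI.
    by apply: piece; [rewrite ltrD2l ltrN2|left; rewrite ltrBlDr ltrDl invr_gt0].
  by apply: piece; [rewrite ltrD2l|right; rewrite ltrDl invr_gt0].
have neg : mu.-negligible ((\bigcup_n F n) `|` [set v%:~R]).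
  apply: negligibleU; last by apply/negligibleP => //; exact: lebesgue_measure_set1.
  exact: negligible_bigcup.
have : mu.-negligible A.
  apply: negligibleS neg => z Az.
  have [->|zv] := eqVneq z v%:~R; [by right|left].
  have d0 : 0 < `|z - v%:~R| by rewrite normr_gt0 subr_eq0.
  pose n := Num.bound (`|z - v%:~R| + `|z - v%:~R|^-1).
  have hn : `|z - v%:~R| + `|z - v%:~R|^-1 < n%:R.
    by apply: archi_boundP; rewrite addr_ge0 ?invr_ge0.
  have h1 : `|z - v%:~R| <= n.+2%:R.
    apply: ltW; apply: (@le_lt_trans _ _ (`|z - v%:~R| + `|z - v%:~R|^-1)).
      by rewrite lerDl invr_ge0.
    by apply: (lt_trans hn); rewrite ltr_nat.
  have h2 : n.+1%:R^-1 <= `|z - v%:~R|.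
    rewrite -[leRHS]invrK lef_pV2 ?posrE ?invr_gt0 //.
    apply: (@le_trans _ _ (`|z - v%:~R| + `|z - v%:~R|^-1)); first by rewrite lerDr.
    by apply: (le_trans (ltW hn)); rewrite ler_nat.
  exists n => //; have [vz|zv'] := leP v%:~R z; [right|left]; split => //=; rewrite in_itv /=.
    by move: h1 h2; rewrite ger0_norm ?subr_ge0 // => h1 h2; rewrite -lerBrDl h2 -lerBlDl h1.
  move: h1 h2; rewrite ltr0_norm ?subr_lt0 // opprB => h1 h2.
  by rewrite lerBlDl -lerBlDr h1 lerBrDl -lerBrDr h2.
by move/negligibleP => /(_ mA).
Qed.

End stable_sites.

(** * Removing and restoring a point below exponent one *)

Lemma product_null_l {R : realType} d1 d2 (T1 : measurableType d1) (T2 : measurableType d2)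
    (m1 m1' : probability T1 R) (m2 : probability T2 R) (E : set (T1 * T2)) :
  measurable E -> (forall B, measurable B -> m1 B = 0%E -> m1' B = 0%E) ->
  (m1 \x m2)%E E = 0%E -> (m1' \x m2)%E E = 0%E.
Proof.
move=> mE dom E0.
have abs (q : probability T1 R) : (q \x m2)%E E = (\int[m2]_y `|q (ysection E y)|)%E.
  have := @indic_fubini_tonelli _ _ _ _ R q m2 E mE.
  rewrite (indic_fubini_tonelli_FE m2 mE) (indic_fubini_tonelli_GE q mE) => e.
  rewrite [LHS](_ : _ = (\int[q]_x (m2 \o xsection E) x)%E) // e.
  by apply: eq_integral => y _; rewrite gee0_abs.
have mq (q : probability T1 R) : measurable_fun setT (fun y => q (ysection E y)).
  exact: measurable_fun_ysection.
move: E0; rewrite (abs m1) => /(ae_eq_integral_abs m2 measurableT (mq m1)) E0.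
rewrite (abs m1'); apply/(ae_eq_integral_abs m2 measurableT (mq m1')).
apply: filterS E0 => x /= h _; apply: dom; first exact: measurable_ysection.
exact: h.
Qed.

Section small_exponent.
Context {R : realType} d (T : measurableType d) (P : probability T R).
Variable Y : int -> {RV P >-> R}.
Hypothesis indepY : mutually_independent Y.
Hypothesis lawY : forall x, has_law (Y x) (distribution P (Y 0)).
Variables alpha c : R.
Hypothesis alpha0 : 0 < alpha.
Hypothesis c0 : 0 < c.
Let nu : probability R R := distribution P (Y 0).
Hypothesis cos_nu : forall t, \int[nu]_y cos (t * y) = stable_cf alpha c t.
Hypothesis sin_nu : forall t, \int[nu]_y sin (t * y) = 0.
Hypothesis alpha1 : alpha < 1.
Notation mu := (@lebesgue_measure R).
Local Notation X x := (site Y x : {RV P >-> R}).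
Local Notation Pi D := (perturbed_lattice D Y).

(** Dyadic blocks on the right, uniform reference laws on the mirrored dyadic
    intervals on the left, at a distance comparable to [2 ^ k].  The density
    bound grows like [(2 `^ alpha) ^+ k] and the block like [2 ^ k], so the error
    ratio is the square root of [2 `^ (alpha - 1)].  Starting at a scale larger
    than [`|x|] keeps [x] out of the blocks and away from the intervals. *)
Lemma stable_blocks (x : int) : exists (lam : nat -> probability R R) (blk : nat -> seq int)
    (C : nat -> R) (sigma rho : R),
  [/\ block_system Y lam blk C sigma rho, (forall k u, u \in blk k -> u != x) &
    forall k A, measurable A -> distribution P (X x) A = 0%E -> lam k A = 0%E].
Proof.
have [K K0 hK] := uniform_le_site lawY alpha0 c0 cos_nu sin_nu alpha1 (@ltr01 R).
(* the first scale, chosen so that [`|x| + 1 < 2 ^ k0] *)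
pose k0 := `|x|%N.+1.
have k0x : (`|x|.+1 < 2 ^ k0)%N by rewrite ltn_expl.
pose t k : R := (2 ^ (k + k0))%:R.
have t0 k : 0 < t k by rewrite ltr0n expn_gt0.
have tS k : t k.+1 = 2 * t k by rewrite /t addSn expnS natrM.
have tx k : `|x|%N%:R + 1 <= t k.
  rewrite natr1 /t ler_nat; apply: ltnW; apply: (leq_trans k0x).
  by rewrite leq_exp2l // leq_addl.
have xn : `|x%:~R| = `|x|%N%:R :> R by rewrite -intr_norm -abszE.
have abt k : - (2 * t k) < - t k by rewrite ltrN2 ltr_pMl // ltr1n.
have /choice[lam lamE] : forall k, exists lam : probability R R,
    uniform_on (- (2 * t k)) (- t k) lam by move=> k; exact: uniform_on_exists.
pose blk k := [seq (2 ^ (k + k0) + 1 + i)%:Z | i <- iota 0 (2 ^ (k + k0))].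
have size_blk k : size (blk k) = (2 ^ (k + k0))%N by rewrite size_map size_iota.
have mem_blk k u : u \in blk k -> exists2 m : nat, u = m%:Z &
    (2 ^ (k + k0) < m <= 2 ^ (k.+1 + k0))%N.
  move=> h; case: (elimT (@seq.mapP _ _ _ _ _) h) => i; rewrite mem_iota add0n => /andP[_ il] ->.
  exists (2 ^ (k + k0) + 1 + i)%N => //; rewrite addSn expnS; lia.
have len k : - t k - (- (2 * t k)) = t k by ring.
pose A8 : R := K * 8 `^ (1 + alpha).
have A80 : 0 < A8 by rewrite mulr_gt0 // powR_gt0.
pose rho : R := 2 `^ ((alpha - 1) / 2).
pose C k : R := K * (8 * t k) `^ (1 + alpha) / t k.
have rho0 : 0 < rho by rewrite powR_gt0.
have rho1 : rho < 1.
  by rewrite /rho /powR pnatr_eq0 /= expR_lt1 pmulr_llt0 ?ln_gt0 ?ltr1n // pmulr_llt0 ?invr_gt0 // subr_lt0.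
have rhoE k : (rho ^+ (k + k0)) ^+ 2 = t k `^ (alpha - 1).
  have -> : t k = 2 `^ (k + k0)%:R by rewrite /t natrX powR_mulrn.
  rewrite /rho -exprM -powR_mulrn ?powR_ge0 // -!powRrM natrM.
  by congr (_ `^ _); field.
pose sigma : R := Num.sqrt A8 * rho ^+ k0.
have CE k : C k = t k * (sigma * rho ^+ k) ^+ 2.
  have -> : (sigma * rho ^+ k) ^+ 2 = A8 * t k `^ (alpha - 1).
    by rewrite /sigma -mulrA -exprD addnC exprMn sqr_sqrtr ?ltW // rhoE.
  rewrite /C powRM; [|exact: ler0n|exact: ltW (t0 k)].
  have -> : t k `^ (1 + alpha) = t k ^+ 2 * t k `^ (alpha - 1).
    rewrite -[t k ^+ 2]powR_mulrn ?(ltW (t0 k)) // -powRD; last by rewrite (gt_eqF (t0 k)) implybT.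
    by congr (_ `^ _); ring.
  by rewrite /A8; field; rewrite gt_eqF.
exists lam, blk, C, sigma, rho; split; first split.
- by move=> k; rewrite map_inj_uniq ?iota_uniq // => i j; lia.
- move=> k; rewrite size_blk; apply: (@leq_trans (2 ^ k)); first by rewrite ltn_expl.
  by rewrite leq_exp2l // leq_addr.
- move=> k u v /mem_blk[m -> /andP[_ h1]] /mem_blk[n -> /andP[h2 _]].
  by apply/eqP => -[e]; move: h1 h2; rewrite e; lia.
- by move=> k; rewrite /C divr_gt0 // mulr_gt0 // powR_gt0 // mulr_gt0.
- by rewrite mulr_gt0 ?sqrtr_gt0 ?exprn_gt0.
- by rewrite rho0.
- move=> k u A uk mA.
  have [m uE /andP[m1 m2]] : exists2 m : nat, u = m%:Z &
      (2 ^ (k + k0) < m <= 2 ^ (k.+2 + k0))%N.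
    case/orP: uk => /mem_blk[m -> /andP[h1 h2]]; exists m => //.
      by rewrite h1 (leq_trans h2) // leq_exp2l // leq_add2r.
    by rewrite h2 andbT (leq_trans _ h1) // ltnS leq_exp2l // leq_add2r.
  have D0 : 0 < 8 * t k by rewrite mulr_gt0.
  have := hK u _ _ (8 * t k) (lam k) (abt k) (lamE k) D0 _ A mA; rewrite len; apply.
  move=> z /andP[z1 z2].
  have u1 : t k <= u%:~R by rewrite uE -pmulrn ler_nat ltnW.
  have u2 : u%:~R <= 4 * t k.
    rewrite (_ : 4 * t k = t k.+2); last by rewrite !tS; ring.
    by rewrite uE -pmulrn ler_nat.
  have t1 : 1 <= t k by rewrite (le_trans _ (tx k)) // lerDr.
  have := t0 k; rewrite distrC ger0_norm; last by lra.
  by move=> _; apply/andP; split; lra.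
- by move=> k; rewrite size_blk -/(t k) CE.
- move=> k; rewrite size_blk -/(t k.+1) CE tS ler_wpM2r ?sqr_ge0 //.
  by rewrite ler_pMl // ler1n.
- move=> k u /mem_blk[m -> /andP[h1 _]]; apply/eqP => e.
  have : (2 ^ k0 <= 2 ^ (k + k0))%N by rewrite leq_exp2l // leq_addl.
  by move: h1 k0x; rewrite -e /=; lia.
move=> k A mA A0.
pose D : R := 2 * t k + `|x%:~R|.
have D0 : 0 < D by rewrite ltr_pwDl ?mulr_gt0.
have := hK x _ _ D (lam k) (abt k) (lamE k) D0 _ A mA.
rewrite A0 mule0 => h; apply/eqP; rewrite eq_le measure_ge0 andbT; apply: h.
move=> z /andP[z1 z2]; have := tx k; rewrite -xn => txk.
have := ler_norm (x%:~R : R); have := ler_norm (- x%:~R : R); rewrite normrN => n1 n2.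
have tk := t0 k.
by rewrite distrC ger0_norm /D; [apply/andP; split; lra|lra].
Qed.

(** Inserting a point of law [lam n] into the lattice without [x] gives a law
    absolutely continuous with respect to the full lattice, since [lam n] is
    absolutely continuous with respect to the law of the site [x]; and for large
    [n] the insertion is undetectable. *)
Lemma removed_null (x : int) A : measurable A ->
  P (Pi setT @^-1` A) = 0%E -> P (Pi (setT `\ x) @^-1` A) = 0%E.
Proof.
move=> mA A0.
have [lam [blk [C [sigma [rho [sys blkx lam0]]]]]] := stable_blocks x.
have mE := measurable_insert_event mA.
have mP : measurable (Pi (setT `\ x) @^-1` A) by exact: measurable_preimage.
rewrite -(fineK (fin_num_measure P _ mP)); congr EFin.
apply: (null_of_small_tail sys); first exact: fine_ge0.
move=> n.
have I0 : inserted Y (setT `\ x) (lam n) A = 0.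
  rewrite /inserted (@product_null _ _ _ _ _ _ (distribution P (X x))) //.
    by move=> B mB; exact: lam0.
  by rewrite -(lattice_insert indepY lawY).
have bI k u : u \in blk k -> (setT `\ x) u by move=> /blkx /eqP.
have := inserted_close indepY lawY sys bI n mA.
by rewrite I0 subr0 ger0_norm // fine_ge0.
Qed.

(** The full lattice is the lattice without [x] with the site [x] inserted, hence
    close to an average over [u] of the same with [u] removed as well.  Each of
    these is absolutely continuous with respect to the lattice without [x],
    because the laws of the sites [x] and [u] have the same null sets: the site
    [x] plays the part of the removed site [u]. *)
Lemma restored_null (x : int) A : measurable A ->
  P (Pi (setT `\ x) @^-1` A) = 0%E -> P (Pi setT @^-1` A) = 0%E.
Proof.
move=> mA A0.
have [lam [blk [C [sigma [rho [sys blkx _]]]]]] := stable_blocks x.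
have mE := measurable_insert_event mA.
have mP : measurable (Pi setT @^-1` A) by exact: measurable_preimage.
rewrite -(fineK (fin_num_measure P _ mP)); congr EFin.
apply: (null_of_small_tail sys); first exact: fine_ge0.
move=> n; have bI k u : u \in blk k -> (setT `\ x) u by move=> /blkx /eqP.
have := inserted_avg_close indepY lawY sys bI (distribution P (X x)) n mA.
rewrite big_seq big1 ?mulr0 ?sub0r ?normrN => [|u un]; last first.
  rewrite /inserted (@product_null _ _ _ _ _ _ (distribution P (X u))) //.
    move=> B mB uB; apply: (site_abs_continuous lawY alpha0 c0 cos_nu sin_nu) => //.
    exact: (lebesgue_abs_continuous lawY alpha0 c0 cos_nu sin_nu alpha1 (v := u)).
  by rewrite -(lattice_insert indepY lawY) //; exact: (bI _ _ un).
rewrite /inserted -(lattice_insert indepY lawY (I := setT)) // => h.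
rewrite ger0_norm ?fine_ge0 // in h; apply: (le_trans h); rewrite lerDr.
by rewrite mulr_ge0 ?exprn_ge0 ?ltW ?(block_sigma_gt0 sys) //; have /andP[] := block_rho01 sys.
Qed.

End small_exponent.

(** * Isolated points and deletion events *)

Section isolated_points.
Context {R : realType}.

Lemma isolating_interval (p : configuration R) (z : R) : points p z ->
  exists a b : rat, ratr a < z < ratr b /\ points p `&` `]ratr a, ratr b[%classic = [set z].
Proof.
move=> pz.
have fF : finite_set ((points p `&` `[z - 1, z + 1]%classic) `\ z).
  by apply: finite_setD; exact: lfsetP.
have lz : z - 1 < z by rewrite ltrBlDr ltrDl.
have gz : z < z + 1 by rewrite ltrDl.
have [acF _] := @accessible_finite_set_closed R.
have /closed_openC oF := acF (hausdorff_accessible (@Rhausdorff R)) _ fF.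
have : nbhs z (~` ((points p `&` `[z - 1, z + 1]%classic) `\ z)).
  by apply: open_nbhs_nbhs; split => // -[_ /(_ erefl)].
move=> /nbhs_ballP[e /= e0 zeF].
pose r := Num.min e 1.
have r0 : 0 < r by rewrite lt_min e0 ltr01.
have /rat_in_itvoo[a] : z - r < z by rewrite ltrBlDr ltrDl.
rewrite in_itv/= => /andP[za az].
have /rat_in_itvoo[b] : z < z + r by rewrite ltrDl.
rewrite in_itv/= => /andP[zb bz].
exists a, b; rewrite az zb; split => //.
apply/seteqP; split=> x /=; last by move=> ->; split => //; rewrite in_itv /= az zb.
move=> [px]; rewrite in_itv/= => /andP[ax xb].
have zx : `|z - x| < r.
  rewrite ltr_norml; apply/andP; split.
    by rewrite ltrBrDl ltrBlDl addrC (lt_trans xb).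
  by rewrite ltrBlDl -ltrBlDr (lt_trans za).
apply: contrapT => xz; apply: (zeF x).
  by rewrite /ball /= (lt_le_trans zx)// ge_min lexx.
split => //; split => //=; rewrite in_itv/= -ler_distlC (le_trans (ltW zx))//.
by rewrite ge_min lexx orbT.
Qed.

Lemma restrict_isolated (p : configuration R) (z : R) (B : set R) :
  points p `&` B = [set z] -> restrict_conf p (~` B) = remove_pt p z.
Proof.
move=> pB; apply: conf_eq; apply/seteqP; split=> x /= [px xB]; split => //.
  by move=> xz; apply: xB; have [] : (points p `&` B) x by rewrite pB.
by move=> Bx; apply: xB; have : (points p `&` B) x by []; rewrite pB.
Qed.

Lemma counting_set1 (z : R) : (counting [set z] = 1 :> \bar R)%E.
Proof.
have := @countingU1 R set0 z (fun h => h); rewrite set0U => ->.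
by rewrite (counting0E set0).2 // add0e.
Qed.

(** Deleting a point is encoded as emptying an interval that contains no other
    point: with rational endpoints this is a countable union that does not refer
    to the deleted point. *)
Definition deletion_event (A : set (configuration R)) : set (configuration R) :=
  \bigcup_(a : rat) \bigcup_(b : rat)
    ((npoints `]ratr a, ratr b[%classic @^-1` [set 1%E]) `&`
     ((fun p => restrict_conf p (~` `]ratr a, ratr b[%classic)) @^-1` A)).

Lemma measurable_deletion_event A : measurable A -> measurable (deletion_event A).
Proof.
move=> mA; apply: countable_bigcupT_measurable => // a.
apply: countable_bigcupT_measurable => // b; apply: measurableI.
  rewrite -[X in measurable X]setTI; apply: measurable_npoints => //; exact: measurable_itv.
rewrite -[X in measurable X]setTI; apply: measurable_restrict_conf => //.
by apply: measurableC; exact: measurable_itv.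
Qed.

Lemma deletion_eventP A (p : configuration R) (z : R) :
  points p z -> A (remove_pt p z) -> deletion_event A p.
Proof.
move=> pz Apz; have [a [b [_ pab]]] := isolating_interval pz.
exists a => //; exists b => //; split; rewrite /= /npoints ?pab ?counting_set1 //.
by rewrite (restrict_isolated pab).
Qed.

Lemma counting1 (A : set R) : (counting A = 1 :> \bar R)%E -> exists z, A = [set z].
Proof.
move=> A1; have [z Az] : A !=set0.
  apply/set0P/eqP => A0; move: A1; rewrite A0 (counting0E set0).2 // => /eqP.
  by rewrite eq_sym onee_eq0.
exists z; have := countingD1 Az; rewrite A1 subee // => /counting0E AD.
by rewrite -(setD1K Az) AD setU0.
Qed.

End isolated_points.

(** * Tolerance below exponent one *)

Section tolerance_below_one.
Context {R : realType} d (T : measurableType d) (P : probability T R).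
Variable Y : int -> {RV P >-> R}.
Hypothesis indepY : mutually_independent Y.
Hypothesis lawY : forall x, has_law (Y x) (distribution P (Y 0)).
Hypothesis atomless : forall a, distribution P (Y 0) [set a] = 0%E.
Local Notation X x := (site Y x : {RV P >-> R}).
Local Notation Pi D := (perturbed_lattice D Y).

(** Almost surely the unique point of a rational interval is the site of a unique
    label [x], and deleting it leaves the lattice without [x]; there are countably
    many labels. *)
Lemma deletion_event_null A : measurable A ->
  (forall x, P (Pi (setT `\ x) @^-1` A) = 0%E) ->
  P (Pi setT @^-1` deletion_event A) = 0%E.
Proof.
move=> mA A0.
have mD : measurable (Pi setT @^-1` deletion_event A).
  by apply: measurable_preimage; exact: measurable_deletion_event.
apply/negligibleP => //.
have null : P.-negligible (\bigcup_n (fun n => if @choice.unpickle int n is Some x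
    then Pi (setT `\ (x : int)) @^-1` A else set0) n).
  apply: negligible_bigcup => n; case: choice.unpickle => [x|]; last exact: negligible_set0.
  by apply/negligibleP; [exact: (measurable_preimage (Pi (setT `\ (x : int))))|exact: A0].
have := ae_locally_finite lawY setT; have := ae_sites_distinct indepY lawY atomless.
move=> inj lf; have {inj lf}[N [mN N0 hN]] := filterI inj lf.
have nN : P.-negligible N by apply/negligibleP.
apply: negligibleS (negligibleU nN null).
move=> w [a _ [b _ /= [n1 Ar]]].
have [Nw|Nw] := pselect (N w); [by left|right].
have [inj lf] : injective (fun x => site Y x w) /\ locally_finite [set site Y x w | x in setT].
  by apply: contrapT => h; apply: Nw; apply: hN.
have [z pz] := counting1 n1.
have := restrict_isolated pz => e; rewrite e in Ar.
have : (Pi setT w `&` `]ratr a, ratr b[%classic) z by rewrite pz.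
move=> [+ _]; rewrite perturbed_latticeE // => -[x _ xz].
exists (choice.pickle x) => //; rewrite choice.pickleK /=.
suff -> : Pi (setT `\ x) w = remove_pt (Pi setT w) z by [].
have lf' : locally_finite [set site Y y w | y in setT `\ x].
  by apply: locally_finite_sub lf => _ [y _ <-]; exists y.
apply: conf_eq => /=; rewrite !perturbed_latticeE //.
apply/seteqP; split=> [_ [y [_ yx] <-]|_ [[y _ <-] yz]].
  split; first by exists y.
  by rewrite /= -xz => /inj.
by exists y => //; split => // yx; apply: yz; rewrite -xz /= yx.
Qed.

Hypothesis removed : forall x A, measurable A ->
  P (Pi setT @^-1` A) = 0%E -> P (Pi (setT `\ x) @^-1` A) = 0%E.
Hypothesis restored : forall x A, measurable A ->
  P (Pi (setT `\ x) @^-1` A) = 0%E -> P (Pi setT @^-1` A) = 0%E.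
Hypothesis site_lebesgue : forall x (A : set R), measurable A ->
  distribution P (X x) A = 0%E -> lebesgue_measure A = 0%E.

Lemma lattice_deletion_tolerant : deletion_tolerant (distribution P (Pi setT)).
Proof.
move=> d' T' P' Pi' Z lawPi ptZ; apply/null_content_dominatesP => A mA A0.
have mD := measurable_deletion_event mA.
have D0 : P' (Pi' @^-1` deletion_event A) = 0%E.
  rewrite -[LHS]/(distribution P' Pi' (deletion_event A)) lawPi //.
  by apply: deletion_event_null => // x; exact: removed.
have mR : measurable (remove_point Pi' Z @^-1` A) by exact: measurable_preimage.
apply/eqP; rewrite eq_le measure_ge0 andbT -D0.
apply: (@prob_le_ae _ _ _ P' (remove_point Pi' Z @^-1` A) (Pi' @^-1` deletion_event A)) => //.
  exact: measurable_preimage.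
by apply: filterS ptZ => w pz; exact: deletion_eventP.
Qed.

(** Replace the law of the lattice by that of the lattice without the label 0, and
    the uniform law by that of the site 0, one coordinate of the product at a
    time; the result is the law of the lattice itself. *)
Lemma lattice_insertion_tolerant : insertion_tolerant (distribution P (Pi setT)).
Proof.
move=> V mV V0 d' T' P' Pi' U lawPi unifU indep; apply/null_content_dominatesP => A mA A0.
have mE := measurable_insert_event mA.
have e : distribution P' (add_point Pi' U) A =
    (distribution P' Pi' \x distribution P' U)%E (insert_event A).
  by rewrite -(joint_law indep mE).
rewrite e.
apply: (@product_null_l _ _ _ _ _ (distribution P (Pi (setT `\ (0 : int))))) => //.
  by move=> B mB B0; apply: (eq_trans (lawPi B mB)); exact: restored B0.
apply: (@product_null _ _ _ _ _ _ (distribution P (X 0))) => //.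
  move=> B mB B0; apply: (eq_trans (unifU B mB)); rewrite (_ : lebesgue_measure (B `&` V) = 0%E) ?mule0 //.
  apply/eqP; rewrite eq_le measure_ge0 andbT -(site_lebesgue mB B0).
  by apply: le_measure; [apply/mem_set; exact: measurableI|exact: mem_set|exact: subIsetl].
by rewrite -(lattice_insert indepY lawY).
Qed.

Lemma lattice_equivalent (x : int) :
  distribution P (Pi setT) `<< distribution P (Pi (setT `\ x)) /\
  distribution P (Pi (setT `\ x)) `<< distribution P (Pi setT).
Proof.
split; apply/null_content_dominatesP => A mA A0; [exact: restored A0|exact: removed].
Qed.

End tolerance_below_one.

(** * Oscillation of radial weights along the lattice *)

Section radial_weights.
Context {R : realType}.

Definition rad (z : R) : nat := Num.truncn `|z|.

Lemma rad_ltn z n : (rad z < n)%N = (`|z| < n%:R).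
Proof.
have /andP[h1 h2] := truncn_itv (normr_ge0 z).
apply/idP/idP => h; first by apply: lt_le_trans h2 _; rewrite ler_nat.
by rewrite -(ltr_nat R); exact: le_lt_trans h.
Qed.

(** A displacement by [y] changes the radius by at most [`|y|]; rounding down may
    cost one more. *)
Lemma rad_shift (x : int) (y : R) :
  (rad (x%:~R + y) <= `|x|%N + (rad y).+1)%N /\ (`|x|%N <= rad (x%:~R + y) + (rad y).+1)%N.
Proof.
have xn : `|x%:~R| = `|x|%N%:R :> R by rewrite -intr_norm -abszE.
have hy : `|y| < (rad y).+1%:R by rewrite -rad_ltn.
have hz : `|x%:~R + y| < (rad (x%:~R + y)).+1%:R by rewrite -rad_ltn.
split.
  rewrite -ltnS rad_ltn -addSn natrD -natr1 -xn; apply: (le_lt_trans (ler_normD _ _)).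
  by lra.
rewrite -ltnS -(ltr_nat R) -addSn natrD -xn.
have : `|x%:~R| <= `|x%:~R + y| + `|y|.
  by rewrite -[X in `|X|](addrK y); apply: ler_normB.
lra.
Qed.

Lemma measurable_radial (H : nat -> R) : measurable_fun setT (fun z => H (rad z)).
Proof.
move=> _ A mA; rewrite setTI.
rewrite (_ : _ @^-1` A = \bigcup_(m in [set m | A (H m)]) [set z | rad z = m]); last first.
  by apply/seteqP; split=> z /= => [h|[m Am /= ->] //]; exists (rad z).
apply: bigcup_measurable => m _.
rewrite (_ : [set z | _] = [set z : R | `|z| < m.+1%:R] `\` [set z | `|z| < m%:R]).
  have mB n : measurable [set z : R | `|z| < n%:R].
    rewrite (_ : [set z | _] = `]- n%:R, n%:R[%classic); first exact: measurable_itv.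
    by apply/seteqP; split=> z /=; rewrite in_itv /= ltr_norml.
  by apply: measurableD; exact: mB.
apply/seteqP; split=> z /=; rewrite -!rad_ltn.
  by move=> ->; rewrite ltnSn ltnn.
by rewrite ltnS => -[h1 /negP]; rewrite -leqNgt => h2; apply/eqP; rewrite eqn_leq h1.
Qed.

Definition dev (H : nat -> R) (x : int) (y : R) : R := H (rad (x%:~R + y)) - H `|x|%N.

Lemma measurable_dev H x : measurable_fun setT (dev H x).
Proof.
apply: measurable_funB => //; apply: (measurableT_comp (measurable_radial H)).
by apply: (measurable_funD (f := cst x%:~R) (g := id)).
Qed.

(** The weight equal to 1 up to radius [r], to 0 from radius [r + L] on, and linear
    in between; truncated subtraction takes care of the outer part. *)
Definition ramp (r L m : nat) : R := (minn L (r + L - m))%:R / L%:R.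

Lemma ramp01 r L m : (0 < L)%N -> 0 <= ramp r L m <= 1.
Proof.
move=> L0; rewrite /ramp divr_ge0 //= ler_pdivrMr ?ltr0n // mul1r ler_nat; exact: geq_minl.
Qed.

Lemma ramp_in r L m : (0 < L)%N -> (m <= r)%N -> ramp r L m = 1.
Proof.
move=> L0 mr; rewrite /ramp (_ : minn _ _ = L) ?divff ?pnatr_eq0 -?lt0n //; lia.
Qed.

Lemma ramp_out r L m : (r + L <= m)%N -> ramp r L m = 0.
Proof. by move=> h; rewrite /ramp (_ : minn _ _ = 0%N) ?mul0r //; lia. Qed.

Lemma ramp_dist r L m m' k : (0 < L)%N -> (m <= m' + k)%N -> (m' <= m + k)%N ->
  `|ramp r L m - ramp r L m'| <= (minn k L)%:R / L%:R.
Proof.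
move=> L0 h1 h2; rewrite /ramp -mulrBl normrM [X in _ * X]ger0_norm ?invr_ge0 //.
rewrite ler_pM2r ?invr_gt0 ?ltr0n // ler_norml lerBlDr -natrD ler_nat lerNl opprB lerBlDr -natrD ler_nat.
by apply/andP; split; lia.
Qed.

Lemma dev_ramp_le r L x y : (0 < L)%N ->
  `|dev (ramp r L) x y| <= (minn (rad y).+1 L)%:R / L%:R.
Proof. by move=> L0; have [h1 h2] := rad_shift x y; exact: ramp_dist. Qed.

Lemma dev_le1 (H : nat -> R) x y : (forall m, 0 <= H m <= 1) -> `|dev H x y| <= 1.
Proof.
move=> H01; rewrite /dev ler_norml.
have /andP[h1 h2] := H01 (rad (x%:~R + y)); have /andP[h3 h4] := H01 `|x|%N.
by apply/andP; split; lra.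
Qed.

Lemma count_near (s : seq int) (y : R) n : uniq s ->
  (count (fun x : int => rad (x%:~R + y) < n)%N s <= n.*2.+1)%N.
Proof.
move=> us; have := count_lattice_points y (c := n%:R) (n := n) us.
rewrite ler0n lexx => /(_ isT); apply: leq_trans; rewrite size_filter.
by apply: sub_count => x /=; rewrite rad_ltn => /ltW.
Qed.

Lemma rad_int (x : int) : rad (x%:~R : R) = `|x|%N.
Proof.
have xn : `|x%:~R| = `|x|%N%:R :> R by rewrite -intr_norm -abszE.
apply/eqP; rewrite eqn_leq -ltnS rad_ltn xn ltr_nat ltnSn /= leqNgt rad_ltn xn.
by rewrite ltxx.
Qed.

Lemma count_abs (s : seq int) n : uniq s -> (count (fun x : int => `|x| < n)%N s <= n.*2.+1)%N.
Proof.
move=> us; apply: leq_trans (count_near 0 n us).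
by apply: sub_count => x /=; rewrite addr0 rad_int.
Qed.

(** The square of a truncated radius is bounded by a sum of tail indicators whose
    coefficients grow linearly, so that a tail of order [j^-1] integrates to
    order [L]. *)
Lemma sq_min_le n L : ((minn n.+1 L) ^ 2 <= 1 + \sum_(j <- iota 0 L) (2 * j + 3) * (j < n))%N.
Proof.
apply: (@leq_trans ((minn n L).+1 ^ 2)); first by rewrite leq_exp2r //; lia.
elim: L => [|L IH]; first by rewrite minn0 big_nil.
rewrite (_ : iota 0 L.+1 = iota 0 L ++ iota L 1); last by rewrite -[L.+1]addn1 iotaD add0n.
rewrite big_cat /= big_seq1 addnA.
have [Ln|nL] := ltnP L n.
  have -> : minn n L.+1 = L.+1 by lia.
  have : (minn n L = L)%N by lia.
  by move=> e; move: IH; rewrite e; nia.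
by rewrite (_ : minn n L.+1 = minn n L); lia.
Qed.

Definition beyond (j : nat) : set R := [set y | j%:R <= `|y|].

Lemma beyondE j y : \1_(beyond j) y = (j <= rad y)%:R :> R.
Proof.
rewrite indicE leqNgt rad_ltn -leNgt; congr (_%:R); congr nat_of_bool.
by apply/idP/idP => [/set_mem|h]; [|exact/mem_set].
Qed.

Lemma measurable_beyond j : measurable (beyond j).
Proof.
rewrite (_ : beyond j = ~` `]- j%:R, j%:R[%classic); first by apply: measurableC; exact: measurable_itv.
apply/seteqP; split=> y; rewrite /beyond /= in_itv /= -ltr_norml leNgt; first by move/negP.
by move=> /negP.
Qed.

Lemma sum_indicator_le (I : Type) (s : seq I) (p : pred I) (a : R) (f : I -> R) :
  (forall x, f x <= (p x)%:R * a) -> \sum_(x <- s) f x <= (count p s)%:R * a.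
Proof.
move=> h; apply: (@le_trans _ _ (\sum_(x <- s) (p x)%:R * a)); first exact: ler_sum.
by rewrite -mulr_suml -natr_sum -sum1_count [X in _ <= X%:R * _]big_mkcond.
Qed.

(** At most [8 * L] labels are within reach of the ramp before or after
    displacement, and each of them contributes at most the square of
    [minn (rad y).+1 L / L]. *)
Lemma ramp_energy_pointwise r L s y : uniq s -> (r < L)%N ->
  \sum_(x <- s) dev (ramp r L) x y ^+ 2 <=
  8 / L%:R * (1 + \sum_(j <- iota 0 L) (2 * j + 3)%:R * \1_(beyond j.+1) y).
Proof.
move=> us rL; have L0 : (0 < L)%N by exact: leq_ltn_trans rL.
have LR : 0 < L%:R :> R by rewrite ltr0n.
pose near (x : int) := (`|x| < r + L)%N || (rad (x%:~R + y) < r + L)%N.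
pose b := minn (rad y).+1 L.
apply: (@le_trans _ _ ((count near s)%:R * (b%:R / L%:R) ^+ 2)).
  apply: sum_indicator_le => x; have [_|] := boolP (near x).
    by rewrite mul1r -[leLHS]real_normK ?num_real // lerXn2r ?nnegrE ?divr_ge0 // dev_ramp_le.
  rewrite /near negb_or -!leqNgt => /andP[h1 h2].
  by rewrite /dev !ramp_out // subrr expr0n mul0r.
have cn : (count near s <= 8 * L)%N.
  have h1 := count_abs (r + L) us; have h2 := count_near y (r + L) us.
  have : (count near s <= count (fun x : int => `|x| < r + L)%N s +
      count (fun x : int => rad (x%:~R + y) < r + L)%N s)%N.
    by rewrite -count_predUI leq_addr.
  by rewrite -!muln2 in h1 h2; lia.
apply: (@le_trans _ _ ((8 * L)%:R * (b%:R / L%:R) ^+ 2)).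
  by rewrite ler_wpM2r ?sqr_ge0 // ler_nat.
have -> : (8 * L)%:R * (b%:R / L%:R) ^+ 2 = 8 / L%:R * (b ^ 2)%:R :> R.
  by rewrite natrM natrX; field; rewrite gt_eqF.
rewrite ler_pM2l ?divr_gt0 //.
have -> : 1 + \sum_(j <- iota 0 L) (2 * j + 3)%:R * \1_(beyond j.+1) y =
    (1 + \sum_(j <- iota 0 L) (2 * j + 3) * (j < rad y))%N%:R :> R.
  rewrite natrD natr_sum; congr (_ + _); apply: eq_bigr => j _.
  by rewrite beyondE natrM.
by rewrite ler_nat; exact: sq_min_le.
Qed.

(** For labels beyond [A] the first factor vanishes unless the displacement brings
    the label back within [M], which needs [`|y|] to be at least [A - M].  For
    the other labels the second factor is at most [K / L] unless [`|y|] is at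
    least [K]. *)
Lemma cross_pointwise (H : nat -> R) M r L s y A K : uniq s -> (0 < L)%N -> (M < A)%N ->
  (forall m, 0 <= H m <= 1) -> (forall m, (M <= m)%N -> H m = 0) ->
  \sum_(x <- s) dev H x y * dev (ramp r L) x y <=
  A.*2.+1%:R * (K%:R / L%:R + \1_(beyond K) y) + M.*2.+1%:R * \1_(beyond (A - M)) y.
Proof.
move=> us L0 MA H01 HM.
have LR : 0 < L%:R :> R by rewrite ltr0n.
pose a : R := K%:R / L%:R + \1_(beyond K) y.
pose b : R := \1_(beyond (A - M)) y.
have a0 : 0 <= a by rewrite addr_ge0 ?divr_ge0 // beyondE.
have b0 : 0 <= b by rewrite /b beyondE.
pose p (x : int) := (`|x| < A)%N; pose q (x : int) := (rad (x%:~R + y) < M)%N.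
apply: (@le_trans _ _ (\sum_(x <- s) ((p x)%:R * a + (q x)%:R * b))).
  apply: ler_sum => x _.
  have ramp1 m : 0 <= (ramp r L m : R) <= 1 by exact: ramp01.
  have d1 := dev_le1 x y H01; have d2 := dev_le1 x y ramp1.
  have [pA|Ap] := ltnP `|x|%N A; rewrite ?/p ?pA ?mul1r.
    apply: (@le_trans _ _ a); last by rewrite lerDl mulr_ge0.
    apply: (le_trans (ler_norm _)); rewrite normrM -[leRHS]mul1r; apply: ler_pM => //.
    apply: (le_trans (dev_ramp_le r x y L0)); rewrite /a beyondE.
    have [Ky|yK] := leqP K (rad y).
      by apply: ler_wpDl; rewrite ?divr_ge0 // ler_pdivrMr // mul1r ler_nat geq_minr.
    by rewrite addr0 ler_pM2r ?invr_gt0 // ler_nat geq_min yK.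
  rewrite ltnNge Ap /= mul0r add0r /q.
  have Hx : H `|x|%N = 0 by apply: HM; exact: leq_trans (ltnW MA) Ap.
  have [qM|Mq] := ltnP (rad (x%:~R + y)) M; last first.
    by rewrite /dev Hx HM // subrr mul0r mul0r.
  rewrite mul1r /b beyondE.
  have -> : (A - M <= rad y)%N by have [_ h2] := rad_shift x y; lia.
  apply: (le_trans (ler_norm _)); rewrite normrM -[leRHS]mulr1; exact: ler_pM.
rewrite big_split /=; apply: lerD.
  apply: le_trans (sum_indicator_le (p := p) (a := a) s _) _ => //.
  by rewrite ler_wpM2r // ler_nat; exact: count_abs.
apply: le_trans (sum_indicator_le (p := q) (a := b) s _) _ => //.
by rewrite ler_wpM2r // ler_nat; exact: count_near.
Qed.

End radial_weights.

(** * Weights of small energy *)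

Definition weight {R : realType} (r M : nat) (H : nat -> R) : Prop :=
  [/\ forall m, 0 <= H m <= 1, forall m, (m <= r)%N -> H m = 1 &
      forall m, (M <= m)%N -> H m = 0].

Lemma ramp_weight {R : realType} r L : (0 < L)%N -> weight r (r + L) (ramp r L : nat -> R).
Proof.
by move=> L0; split=> m; [exact: ramp01|exact: ramp_in|exact: ramp_out].
Qed.

Lemma eventually_le {R : realType} (a e : R) : 0 <= a -> 0 < e ->
  exists n : nat, forall m, (n <= m)%N -> a / m.+1%:R <= e.
Proof.
move=> a0 e0; exists (Num.bound (a / e)) => m nm.
rewrite ler_pdivrMr // mulrC -ler_pdivrMr //.
apply: ltW; apply: (lt_trans (archi_boundP _)); first by rewrite divr_ge0 // ltW.
by rewrite ltr_nat ltnS.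
Qed.

Lemma mix_arith {R : realFieldType} (v c : R) : 0 < v ->
  (v / (v + 1)) ^+ 2 * (2 * c / v) + (1 - v / (v + 1)) ^+ 2 * c +
  2 * (v / (v + 1)) * (1 - v / (v + 1)) * (c / (2 * v)) = 2 * c / (v + 1).
Proof. by move=> v0; field; rewrite !gt_eqF // addr_gt0. Qed.

Section energies.
Context {R : realType}.
Variable nu : probability R R.
Variable Ct : R.
Hypothesis Ct0 : 0 < Ct.
Hypothesis tail : forall r : R, 1 <= r -> fine (nu [set y | r <= `|y|]) <= Ct / r.

(** An upper bound for the variance of the sum of [H] over the sites with labels
    in [s]. *)
Definition energy (H : nat -> R) (s : seq int) : R :=
  \int[nu]_y \sum_(x <- s) dev H x y ^+ 2.

Lemma sum_dev_integrable (H G : nat -> R) (s : seq int) r M r' M' :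
  weight r M H -> weight r' M' G ->
  nu.-integrable setT (EFin \o (fun y => \sum_(x <- s) dev H x y * dev G x y)).
Proof.
move=> [H01 _ _] [G01 _ _].
have [] // := @expectation_sum _ _ _ nu _ s (fun x y => dev H x y * dev G x y) _.
move=> x; apply: (@probability_integrable _ _ _ nu _ 1).
  by apply: measurable_funM; exact: measurable_dev.
by move=> y; rewrite normrM -[1]mulr1; apply: ler_pM => //; exact: dev_le1.
Qed.

Lemma sum_sqE (H : nat -> R) (s : seq int) :
  (fun y => \sum_(x <- s) dev H x y ^+ 2) = (fun y => \sum_(x <- s) dev H x y * dev H x y).
Proof. by apply/funext => y; apply: eq_bigr => x _; rewrite expr2. Qed.

Lemma Rintegral_lin3 (f1 f2 f3 : R -> R) (k1 k2 k3 : R) :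
  nu.-integrable setT (EFin \o f1) -> nu.-integrable setT (EFin \o f2) ->
  nu.-integrable setT (EFin \o f3) ->
  \int[nu]_y (k1 * f1 y + k2 * f2 y + k3 * f3 y) =
  k1 * \int[nu]_y f1 y + k2 * \int[nu]_y f2 y + k3 * \int[nu]_y f3 y.
Proof.
move=> i1 i2 i3.
have j1 := integrableZl measurableT k1 i1; have j2 := integrableZl measurableT k2 i2.
have j3 := integrableZl measurableT k3 i3.
rewrite RintegralD //; last exact: (integrableD measurableT j1 j2).
by rewrite RintegralD // !RintegralZl.
Qed.

Lemma expectation_le_steps (f : R -> R) (a : R) (l : seq (nat * R)) :
  nu.-integrable setT (EFin \o f) ->
  (forall y, f y <= a + \sum_(q <- l) q.2 * \1_(beyond q.1) y) ->
  \int[nu]_y f y <= a + \sum_(q <- l) q.2 * fine (nu (beyond q.1)).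
Proof.
move=> fi h.
have i1 (q : nat * R) : nu.-integrable setT (EFin \o (fun y => q.2 * \1_(beyond q.1) y)).
  apply: (@probability_integrable _ _ _ nu _ `|q.2|).
    by apply: measurable_funM => //; apply: measurable_indic; exact: measurable_beyond.
  move=> y; rewrite normrM -[leRHS]mulr1 ler_wpM2l // beyondE.
  by case: (_ <= _)%N; rewrite ?normr1 ?normr0.
have [iS eS] := expectation_sum l i1.
have ia : nu.-integrable setT (EFin \o (fun=> a)).
  by apply: (@probability_integrable _ _ _ nu (fun=> a) `|a|).
apply: (@le_trans _ _ (\int[nu]_y (a + \sum_(q <- l) q.2 * \1_(beyond q.1) y))).
  by apply: le_Rintegral => //; exact: (integrableD measurableT ia iS).
rewrite RintegralD // eS prob_Rintegral_cst lerD2l; apply: ler_sum => q _.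
rewrite RintegralZl //; last first.
  apply: (@probability_integrable _ _ _ nu _ 1).
    by apply: measurable_indic; exact: measurable_beyond.
  by move=> y; rewrite beyondE; case: (_ <= _)%N; rewrite ?normr1 ?normr0.
by rewrite prob_Rintegral_indic //; exact: measurable_beyond.
Qed.

Lemma tail_beyond n : fine (nu (beyond n.+1)) <= Ct / n.+1%:R.
Proof. by apply: tail; rewrite ler1n. Qed.

(** The number of contributing labels is of order [L], and the mean of
    [(minn (rad y).+1 L / L) ^+ 2] is of order [L^-1] because the tail is. *)
Lemma ramp_energy r L s : uniq s -> (r < L)%N -> energy (ramp r L) s <= 8 * (1 + 3 * Ct).
Proof.
move=> us rL; have L0 : (0 < L)%N by exact: leq_ltn_trans rL.
have LR : 0 < L%:R :> R by rewrite ltr0n.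
have W := @ramp_weight R r L L0.
pose l := [seq (j.+1, 8 / L%:R * (2 * j + 3)%:R : R) | j <- iota 0 L].
apply: (@le_trans _ _ (8 / L%:R + \sum_(q <- l) q.2 * fine (nu (beyond q.1)))).
  apply: expectation_le_steps.
    by rewrite sum_sqE; exact: (sum_dev_integrable s W W).
  move=> y; apply: (le_trans (ramp_energy_pointwise y us rL)).
  rewrite mulrDr mulr1 lerD2l big_map mulr_sumr.
  by apply: ler_sum => j _ /=; rewrite mulrA.
rewrite big_map /=.
have h : \sum_(j <- iota 0 L) 8 / L%:R * (2 * j + 3)%:R * fine (nu (beyond j.+1)) <=
    \sum_(j <- iota 0 L) 8 / L%:R * (3 * Ct).
  apply: ler_sum => j _; rewrite -mulrA ler_pM2l ?divr_gt0 //.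
  apply: (le_trans (ler_wpM2l (ler0n _ _) (tail_beyond j))).
  rewrite mulrCA mulrC ler_pM2r // ler_pdivrMr // -natrM ler_nat; lia.
apply: (le_trans (lerD (lexx _) h)).
rewrite big_const_seq count_predT size_iota iter_addr_0 -[X in _ + X]mulr_natr.
rewrite [X in _ + X](_ : _ = 8 * (3 * Ct)); last by field; rewrite gt_eqF.
rewrite mulrDr lerD2r mulr1 ler_pdivrMr // ler_peMr // ler1n; exact: L0.
Qed.

(** Choose [A], then [K], then [L]: each makes one of the three terms of
    [cross_pointwise] small, uniformly in [s]. *)
Lemma cross_small (H : nat -> R) r0 M r (delta : R) : weight r0 M H -> 0 < delta ->
  exists L0, forall L s, (L0 <= L)%N -> (0 < L)%N -> uniq s ->
  \int[nu]_y (\sum_(x <- s) dev H x y * dev (ramp r L) x y) <= delta.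
Proof.
move=> W d0; have [H01 _ HM] := W.
have d3 : 0 < delta / 3 by rewrite divr_gt0.
have [n1 h1] := @eventually_le _ (M.*2.+1%:R * Ct) _ (mulr_ge0 (ler0n _ _) (ltW Ct0)) d3.
pose A := (M + n1.+1)%N.
have [n2 h2] := @eventually_le _ (A.*2.+1%:R * Ct) _ (mulr_ge0 (ler0n _ _) (ltW Ct0)) d3.
have [n3 h3] := @eventually_le _ (A.*2.+1%:R * n2.+1%:R) _ (mulr_ge0 (ler0n _ _) (ler0n _ _)) d3.
exists n3.+1 => L s; case: L => // L n3L _ us.
have L0 : (0 < L.+1)%N by [].
have MA : (M < A)%N by rewrite /A; lia.
pose l : seq (nat * R) := [:: (n2.+1, A.*2.+1%:R); (n1.+1, M.*2.+1%:R)].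
apply: (@le_trans _ _ (A.*2.+1%:R * (n2.+1%:R / L.+1%:R) + \sum_(q <- l) q.2 * fine (nu (beyond q.1)))).
  apply: expectation_le_steps; first exact: sum_dev_integrable W (ramp_weight r L0).
  move=> y; apply: (le_trans (cross_pointwise r y n2.+1 us L0 MA H01 HM)).
  by rewrite /l !big_cons big_nil /= (_ : (A - M)%N = n1.+1) ?addKn // mulrDr addr0 addrA.
rewrite /l !big_cons big_nil /=.
apply: (@le_trans _ _ (delta / 3 + (delta / 3 + (delta / 3 + 0)))); last by lra.
apply: lerD; first by rewrite mulrA; exact: h3.
apply: lerD.
  by apply: le_trans (ler_wpM2l (ler0n _ _) (tail_beyond n2)) _; rewrite mulrA; exact: h2.
apply: lerD => //.
by apply: le_trans (ler_wpM2l (ler0n _ _) (tail_beyond n1)) _; rewrite mulrA; exact: h1.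
Qed.

Lemma weight_mix r M L (H : nat -> R) (a : R) : 0 <= a <= 1 -> (0 < L)%N -> weight r M H ->
  weight r (maxn M (r + L)) (fun m => a * H m + (1 - a) * ramp r L m).
Proof.
move=> /andP[a0 a1] L0 [H01 H1 H0]; split=> m.
- have /andP[h1 h2] := H01 m; have /andP[h3 h4] := @ramp01 R r L m L0.
  have b0 : 0 <= 1 - a by lra.
  rewrite addr_ge0 ?mulr_ge0 //=.
  have : a * H m <= a * 1 by rewrite ler_wpM2l.
  have : (1 - a) * ramp r L m <= (1 - a) * 1 by rewrite ler_wpM2l.
  lra.
- by move=> mr; rewrite H1 // ramp_in //; ring.
by rewrite geq_max => /andP[Mm rLm]; rewrite H0 // ramp_out // !mulr0 addr0.
Qed.

Lemma energy_mix r M L (H : nat -> R) (a : R) s : (0 < L)%N -> weight r M H ->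
  energy (fun m => a * H m + (1 - a) * ramp r L m) s =
  a ^+ 2 * energy H s + (1 - a) ^+ 2 * energy (ramp r L) s +
  2 * a * (1 - a) * \int[nu]_y (\sum_(x <- s) dev H x y * dev (ramp r L) x y).
Proof.
move=> L0 W; have Wr := @ramp_weight R r L L0.
rewrite /energy !sum_sqE -Rintegral_lin3; last 3 first.
- exact: (sum_dev_integrable s W W).
- exact: (sum_dev_integrable s Wr Wr).
- exact: (sum_dev_integrable s W Wr).
apply: eq_Rintegral => y _; rewrite !mulr_sumr -!big_split /=; apply: eq_bigr => x _.
by rewrite /dev; ring.
Qed.

(** Mix the previous weight with a ramp so long that the two are nearly
    orthogonal.  If all energies were at most [C0] and the cross terms zero, the
    average of [n] ramps would have energy [C0 / n]; the factor 2 leaves room for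
    cross terms of size [C0 / (2 n)]. *)
Lemma smooth_weight r n : exists (H : nat -> R) (M : nat), weight r M H /\
  forall s, uniq s -> energy H s <= 16 * (1 + 3 * Ct) / n.+1%:R.
Proof.
pose C0 : R := 8 * (1 + 3 * Ct).
have C00 : 0 < C0 by rewrite mulr_gt0 // addr_gt0 // mulr_gt0.
have -> : 16 * (1 + 3 * Ct) = 2 * C0 by rewrite /C0; ring.
elim: n => [|n [H [M [W EH]]]].
  exists (ramp r r.+1), (r + r.+1)%N; split; first exact: ramp_weight.
  by move=> s us; apply: (le_trans (ramp_energy us (ltnSn r))); rewrite -/C0 divr1; lra.
have n0 : 0 < n.+1%:R :> R by [].
have d0 : 0 < C0 / (2 * n.+1%:R) by rewrite divr_gt0 // mulr_gt0.
have [L0 hL] := cross_small r W d0.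
pose L := (L0 + r.+1)%N.
have Lp : (0 < L)%N by rewrite /L addnS.
(* with this [a] the mix gives equal weights to [n.+2] ramps *)
pose a : R := n.+1%:R / n.+2%:R.
have n2 : n.+2%:R = n.+1%:R + 1 :> R by rewrite natr1.
have a01 : 0 <= a <= 1 by rewrite divr_ge0 //= ler_pdivrMr // mul1r ler_nat.
exists (fun m => a * H m + (1 - a) * ramp r L m), (maxn M (r + L)); split; first exact: weight_mix.
move=> s us; rewrite (energy_mix _ _ Lp W).
have e1 := EH s us.
have e2 : energy (ramp r L) s <= C0 by apply: ramp_energy => //; rewrite /L; lia.
have e3 := hL L s (leq_addr _ _) Lp us.
apply: (@le_trans _ _ (a ^+ 2 * (2 * C0 / n.+1%:R) + (1 - a) ^+ 2 * C0 +
    2 * a * (1 - a) * (C0 / (2 * n.+1%:R)))).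
  have /andP[a0 a1] := a01.
  apply: lerD; first by apply: lerD; rewrite ler_wpM2l ?sqr_ge0.
  by rewrite ler_wpM2l // !mulr_ge0 // subr_ge0.
rewrite le_eqVlt; apply/orP; left; apply/eqP; rewrite /a n2.
exact: mix_arith.
Qed.

End energies.

(** * Concentration of smooth counts *)

Section smooth_counts.
Context {R : realType}.

Definition shell (m : nat) : set R := [set z | rad z = m].

Lemma measurable_shell m : measurable (shell m).
Proof.
have := @measurable_radial R (fun k => k%:R) measurableT [set m%:R] (measurable_set1 _).
rewrite setTI (_ : _ @^-1` _ = shell m) //.
apply/seteqP; split=> z; rewrite /shell /=; last by move=> ->.
by move=> h; apply/eqP; rewrite -(eqr_nat R) h.
Qed.

(** The sum of [H] over the points within radius [M], as a combination of counts
    over shells, which makes it measurable. *)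
Definition smooth_count (H : nat -> R) (M : nat) (p : configuration R) : R :=
  \sum_(m <- iota 0 M) H m * fine (npoints (shell m) p).

Lemma measurable_smooth_count H M : measurable_fun setT (smooth_count H M).
Proof.
apply: measurable_sum => m; apply: measurable_funM => //.
by apply: measurableT_comp => //; apply: measurable_npoints; exact: measurable_shell.
Qed.

Lemma counting_seq (l : seq R) : uniq l ->
  (counting [set z | z \in l] : \bar R) = (size l)%:R%:E.
Proof.
elim: l => [_|z l IH /= /andP[zl ul]].
  by rewrite (_ : [set _ | _] = set0) ?(counting0E set0).2 //; apply/seteqP; split.
have -> : [set x | x \in z :: l] = [set x | x \in l] `|` [set z].
  apply/seteqP; split=> x /=; rewrite inE; first by move=> /orP[/eqP->|xl]; [right|left].
  by move=> [xl|->]; rewrite ?xl ?orbT ?eqxx.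
by rewrite countingU1; [rewrite IH // -EFinD natr1|exact/negP].
Qed.

Lemma points_list (p : configuration R) (M : nat) : exists2 l : seq R, uniq l &
  forall z, (z \in l) <-> (points p z /\ (rad z < M)%N).
Proof.
have [l lE] : exists l : seq R, points p `&` `[- M%:R, M%:R]%classic = [set` l].
  by apply/finite_seqP; exact: lfsetP.
exists (undup [seq z <- l | (rad z < M)%N]); first exact: undup_uniq.
have lP z : z \in l <-> (points p `&` `[- M%:R, M%:R]%classic) z by rewrite lE.
move=> z; rewrite mem_undup mem_filter; split; first by move=> /andP[-> /lP[]].
move=> [pz zM]; rewrite zM; apply/lP; split => //=.
by rewrite in_itv /= -ler_norml ltW // -rad_ltn.
Qed.

Lemma smooth_count_list H M r (p : configuration R) (l : seq R) :
  weight r M H -> uniq l -> (forall z, (rad z < M)%N -> (points p z <-> z \in l)) ->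
  smooth_count H M p = \sum_(z <- l) H (rad z).
Proof.
move=> [_ _ H0] ul lP.
have e m : (m < M)%N -> fine (npoints (shell m) p) = \sum_(z <- l) (rad z == m)%:R.
  move=> mM; rewrite /npoints (_ : points p `&` shell m = [set z | z \in [seq z <- l | rad z == m]]).
    rewrite counting_seq ?filter_uniq //= size_filter -natr_sum -sum1_count.
    by rewrite [in LHS]big_mkcond.
  apply/seteqP; split=> z; rewrite /shell /= mem_filter.
    by move=> [pz zm]; rewrite zm eqxx; apply/lP => //; rewrite zm.
  by move=> /andP[/eqP zm zl]; split => //; apply/lP => //; rewrite zm.
rewrite /smooth_count big_seq (eq_bigr (fun m => \sum_(z <- l) H m * (rad z == m)%:R)); last first.
  by move=> m; rewrite mem_iota => /andP[_ mM]; rewrite e // mulr_sumr.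
rewrite -big_seq exchange_big /=; apply: eq_bigr => z _.
have [zM|Mz] := ltnP (rad z) M.
  rewrite (bigD1_seq (rad z)) ?mem_iota ?iota_uniq //= eqxx mulr1 big1 ?addr0 // => m.
  by rewrite eq_sym => /negbTE ->; rewrite mulr0.
rewrite H0 // big_seq big1 // => m; rewrite mem_iota add0n => /andP[_ mM].
by rewrite (_ : (rad z == m) = false) ?mulr0 //; apply/negbTE; rewrite neq_ltn (leq_trans mM Mz) orbT.
Qed.

(** On [B] the weight is 1, so deleting the points of [B] lowers the smooth count
    by exactly their number. *)
Lemma smooth_count_restrict H M r (p : configuration R) (B : set R) :
  weight r M H -> (forall z, B z -> (rad z <= r)%N) ->
  (npoints B p = (smooth_count H M p - smooth_count H M (restrict_conf p (~` B)))%:E)%E.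
Proof.
move=> W Br; have [_ H1 H0] := W.
have [l ul lP] := points_list p M.
have BM z : B z -> (rad z < M)%N.
  move=> Bz; rewrite ltnNge; apply/negP => /H0; rewrite H1 ?Br // => /eqP.
  by rewrite oner_eq0.
rewrite (@smooth_count_list H M r p l W ul); last first.
  by move=> z zM; split; [move=> pz; apply/lP|move/lP => []].
rewrite (@smooth_count_list H M r _ [seq z <- l | ~~ `[< B z >]] W); last 2 first.
- exact: filter_uniq.
- move=> z zM; rewrite mem_filter; split => /=.
    by move=> [pz Bz]; apply/andP; split; [apply/asboolPn|apply/lP].
  by move=> /andP[/asboolPn Bz /lP[pz _]].
rewrite (bigID (fun z => `[< B z >])) /= [X in _ + X - _]big_mkcond [X in _ - X]big_filter.
rewrite [X in _ - X]big_mkcond addrK big_seq_cond.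
rewrite (eq_bigr (fun=> 1)) => [|z /andP[_ /asboolP Bz]]; last by rewrite H1 // Br.
rewrite -big_seq_cond /npoints (_ : points p `&` B = [set z | z \in [seq z <- l | `[< B z >]]]).
  rewrite counting_seq ?filter_uniq // size_filter -sum1_count natr_sum.
  by congr EFin.
apply/seteqP; split=> z /=; rewrite mem_filter.
  by move=> [pz Bz]; apply/andP; split; [apply/asboolP|apply/lP; split => //; exact: BM].
by move=> /andP[/asboolP Bz /lP[]].
Qed.

End smooth_counts.

Lemma measurable_norm_gt {R : realType} d (T : measurableType d) (f : T -> R) (e : R) :
  measurable_fun setT f -> measurable [set w | e < `|f w|].
Proof.
move=> mf; rewrite (_ : [set w | _] = (fun w => `|f w|) @^-1` `]e, +oo[).
  by rewrite -[X in measurable X]setTI; apply: measurableT_comp.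
by apply/seteqP; split=> w /=; rewrite in_itv /= andbT.
Qed.

Section concentration.
Context {R : realType} d (T : measurableType d) (P : probability T R).
Variable Y : int -> {RV P >-> R}.
Hypothesis indepY : mutually_independent Y.
Hypothesis lawY : forall x, has_law (Y x) (distribution P (Y 0)).
Hypothesis atomless : forall a, distribution P (Y 0) [set a] = 0%E.
Let nu : probability R R := distribution P (Y 0).
Local Notation X x := (site Y x : {RV P >-> R}).
Local Notation Pi := (perturbed_lattice setT Y).

(** The centring [c] is the mean; replacing each individual mean by the weight at
    the undisplaced label can only increase the mean square. *)
Lemma radial_variance r M (H : nat -> R) (s : seq int) : weight r M H -> uniq s -> exists c : R,
  \int[P]_w ((\sum_(x <- s) H (rad (site Y x w)) - c) ^+ 2) <= energy nu H s.
Proof.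
move=> W us; have [H01 _ _] := W.
pose f (x : int) w := H (rad (site Y x w)).
have H1 m : `|H m| <= 1 by have /andP[h1 h2] := H01 m; rewrite ger0_norm.
have mH := measurable_radial H.
have mf x : measurable_fun setT (f x) by exact: (measurableT_comp mH (measurable_site Y x)).
have fi x : P.-integrable setT (EFin \o f x).
  by apply: (@probability_integrable _ _ _ P _ 1) => // w; exact: H1.
pose c (x : int) := \int[P]_w f x w.
have c1 x : `|c x| <= 1.
  apply: le_trans (le_normr_Rintegral measurableT (fi x)) _.
  rewrite -[leRHS](prob_Rintegral_cst P 1); apply: le_Rintegral => //.
  - exact: integrable_norm.
  - by apply: (@probability_integrable _ _ _ P (fun=> 1) 1) => // w; rewrite normr1.
  by move=> w _; exact: H1.
pose g x w := f x w - c x.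
have mg x : measurable_fun setT (g x) by exact: measurable_funB.
have g2 x w : `|g x w| <= 2 by apply: le_trans (ler_normB _ _) _; have := H1 (rad (site Y x w)); have := c1 x; rewrite /f; lra.
exists (\sum_(x <- s) c x).
have -> : \int[P]_w ((\sum_(x <- s) H (rad (site Y x w)) - \sum_(x <- s) c x) ^+ 2) =
    \int[P]_w ((\sum_(x <- s) g x w) ^+ 2).
  by apply: eq_Rintegral => w _; rewrite -sumrB.
rewrite (variance_sum us mg g2); last first.
  move=> x x' xx'.
  rewrite (@expectation_product _ _ _ P _ _ _ _ (X x) (X x') (fun z => H (rad z) - c x) (fun z => H (rad z) - c x') 2) //.
  - have -> : \int[P]_w (H (rad (site Y x w)) - c x) = 0; last by rewrite mul0r.
    rewrite RintegralB //; last 2 first.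
    + exact: fi.
    + by apply: (@probability_integrable _ _ _ P (fun=> c x) 1).
    by rewrite prob_Rintegral_cst subrr.
  - exact: (indep_sites indepY xx').
  - exact: measurable_funB.
  - exact: measurable_funB.
  - by move=> z; apply: le_trans (ler_normB _ _) _; have := H1 (rad z); have := c1 x; lra.
  - by move=> z; apply: le_trans (ler_normB _ _) _; have := H1 (rad z); have := c1 x'; lra.
have idev x : nu.-integrable setT (EFin \o (fun y => dev H x y ^+ 2)).
  apply: (@probability_integrable _ _ _ nu _ 1).
    by apply: measurable_funX; exact: measurable_dev.
  by move=> y; rewrite normrX -[1](expr1n _ 2) lerXn2r ?nnegrE //; exact: dev_le1.
have [_ eE] := @expectation_sum _ _ _ nu _ s _ idev.
rewrite /energy eE; apply: ler_sum => x _.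
pose a := H `|x|%N.
have -> : \int[nu]_y dev H x y ^+ 2 = \int[P]_w ((f x w - a) ^+ 2).
  have -> : \int[P]_w ((f x w - a) ^+ 2) = \int[distribution P (Y x)]_y dev H x y ^+ 2.
    apply: (@expectation_law _ _ _ P _ _ (Y x) (fun y => dev H x y ^+ 2) 1).
      by apply: measurable_funX; exact: measurable_dev.
    by move=> y; rewrite normrX -[1](expr1n _ 2) lerXn2r ?nnegrE //; exact: dev_le1.
  rewrite /Rintegral; congr fine; apply: eq_measure_integral => A mA _; exact/esym/lawY.
have e1 : \int[P]_w ((f x w - a) ^+ 2) = \int[P]_w (g x w ^+ 2 + (2 * (c x - a) * g x w + (c x - a) ^+ 2)).
  by apply: eq_Rintegral => w _; rewrite /g; ring.
have ig2 : P.-integrable setT (EFin \o (fun w => g x w ^+ 2)).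
  apply: (@probability_integrable _ _ _ P _ (2 ^+ 2)); first exact: measurable_funX.
  by move=> w; rewrite normrX lerXn2r ?nnegrE.
have ig : P.-integrable setT (EFin \o g x).
  by apply: (@probability_integrable _ _ _ P _ 2).
have icst : P.-integrable setT (EFin \o (fun=> (c x - a) ^+ 2)).
  by apply: (@probability_integrable _ _ _ P (fun=> (c x - a) ^+ 2) `|(c x - a) ^+ 2|).
have ikg := integrableZl measurableT (2 * (c x - a)) ig.
have Eg : \int[P]_w g x w = 0.
  rewrite /g RintegralB //; last by apply: (@probability_integrable _ _ _ P (fun=> c x) 1).
  by rewrite prob_Rintegral_cst subrr.
rewrite e1 RintegralD //; last exact: (integrableD measurableT ikg icst).
rewrite RintegralD // RintegralZl // Eg mulr0 add0r prob_Rintegral_cst.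
by rewrite lerDl sqr_ge0.
Qed.

Lemma chebyshev_sq (f : T -> R) (e V : R) : measurable_fun setT f -> 0 < e ->
  P.-integrable setT (EFin \o (fun w => f w ^+ 2)) -> \int[P]_w (f w ^+ 2) <= V ->
  fine (P [set w | e < `|f w|]) <= V / e ^+ 2.
Proof.
move=> mf e0 i2 hV; rewrite ler_pdivlMr ?exprn_gt0 // mulrC.
have mE := measurable_norm_gt e mf.
apply: le_trans hV; rewrite -(prob_Rintegral_indic P mE) -RintegralZl //; last first.
  apply: (@probability_integrable _ _ _ P _ 1); first exact: measurable_indic.
  by move=> w; rewrite indicE; case: (_ \in _); rewrite ?normr1 ?normr0.
apply: le_Rintegral => //.
  apply: (@probability_integrable _ _ _ P _ `|e ^+ 2|).
    by apply: measurable_funM => //; exact: measurable_indic.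
  by move=> w; rewrite normrM indicE; case: (_ \in _); rewrite ?normr1 ?normr0 ?mulr1 ?mulr0.
move=> w _; rewrite indicE; have [/set_mem /= h|_] := boolP (w \in _).
  rewrite mulr1 -[leRHS]real_normK ?num_real // lerXn2r ?nnegrE ?(ltW e0) //; exact: ltW.
by rewrite mulr0 sqr_ge0.
Qed.

Variable Ct : R.
Hypothesis Ct0 : 0 < Ct.
Hypothesis tail : forall r : R, 1 <= r -> fine (nu [set y | r <= `|y|]) <= Ct / r.

(** With high probability only the finitely many labels of [s] reach the support
    of [H], so the smooth count is a sum over [s], and its variance is small. *)
Lemma smooth_count_concentrates r (e : R) : 0 < e -> exists (H : nat -> R) (M : nat) (c : R),
  weight r M H /\ (P [set w | (e < `|smooth_count H M (Pi w) - c|)%R] <= e%:E)%E.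
Proof.
move=> e0.
have C0 : 0 <= 16 * (1 + 3 * Ct) by rewrite mulr_ge0 // addr_ge0 // mulr_ge0 // ltW.
have e3 : 0 < e / 2 * e ^+ 2 by rewrite mulr_gt0 ?divr_gt0 ?exprn_gt0.
have [n /(_ n (leqnn _)) hn] := eventually_le C0 e3.
have [H [M [W EH]]] := smooth_weight Ct0 tail r n.
have e2 : 0 < e / 2 by rewrite divr_gt0.
have [N [Bad [mBad PBad] hBad]] := far_sites_small lawY M e2.
(* the labels from [- N] to [N - 1], which include all those below [N] in
   absolute value *)
pose s : seq int := [seq (i%:Z - N%:Z : int) | i <- iota 0 N.*2].
have us : uniq s by rewrite map_inj_uniq ?iota_uniq // => i j; lia.
have sP (x : int) : (`|x| < N)%N -> x \in s.
  move=> xN; apply: (introT (@seq.mapP _ _ _ _ _)); exists (absz (x + N%:Z)%R); last by lia.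
  by rewrite mem_iota add0n -muln2; lia.
have [c hc] := radial_variance W us.
exists H, M, c; split => //.
pose S w := \sum_(x <- s) H (rad (site Y x w)) - c.
have [H01 _ _] := W.
have mS : measurable_fun setT S.
  apply: measurable_funB => //; apply: measurable_sum => x.
  exact: (measurableT_comp (measurable_radial H) (measurable_site Y x)).
have iS : P.-integrable setT (EFin \o (fun w => S w ^+ 2)).
  apply: (@probability_integrable _ _ _ P _ (((size s)%:R + `|c|) ^+ 2)); first exact: measurable_funX.
  move=> w; rewrite normrX lerXn2r ?nnegrE ?addr_ge0 //.
  apply: le_trans (ler_normB _ _) _; rewrite lerD2r.
  apply: le_trans (ler_norm_sum _ _ _) _; rewrite -sum1_size natr_sum; apply: ler_sum => x _.
  by have /andP[h1 h2] := H01 (rad (site Y x w)); rewrite ger0_norm.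
pose Ch := [set w | e < `|S w|].
have mCh : measurable Ch by exact: measurable_norm_gt.
have PCh : (P Ch <= (e / 2)%:E)%E.
  rewrite -[P Ch]fineK ?fin_num_measure // lee_fin.
  apply: le_trans (chebyshev_sq mS e0 iS (le_trans hc (EH s us))) _.
  by rewrite ler_pdivrMr ?exprn_gt0.
apply: (@le_trans _ _ (P (Bad `|` Ch))).
  apply: prob_le_ae.
  - apply: measurable_norm_gt; apply: measurable_funB => //.
    exact: (measurableT_comp (measurable_smooth_count H M) (measurable_funP Pi)).
  - exact: measurableU.
  have := ae_locally_finite lawY setT; have := ae_sites_distinct indepY lawY atomless.
  apply: filterS2 => w inj lf.
  have [Bw|nB] := pselect (Bad w); first by left.
  suff sc : smooth_count H M (Pi w) = \sum_(x <- s) H (rad (site Y x w)).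
    by rewrite /= sc => h; right.
  rewrite -(big_map (fun x => site Y x w) predT (fun z => H (rad z))).
  apply: (smooth_count_list W); first by rewrite map_inj_uniq.
  move=> z zM; rewrite perturbed_latticeE //; split.
    move=> [x _ xz]; apply: (introT (@seq.mapP _ _ _ _ _)); exists x => //.
    apply: sP; rewrite ltnNge; apply/negP => /(hBad w nB).
    by rewrite xz; apply/negP; rewrite -leNgt ltW // -rad_ltn.
  by move=> h; case: (elimT (@seq.mapP _ _ _ _ _) h) => x _ ->; exists x.
apply: (le_trans (measureU2 P mBad mCh)); apply: (le_trans (leeD PBad PCh)).
by rewrite -EFinD lee_fin -splitr.
Qed.

End concentration.

(** * Counting missing points *)

Section missing_points.
Context {R : realType} d (T : measurableType d) (P : probability T R).
Variable Y : int -> {RV P >-> R}.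
Hypothesis indepY : mutually_independent Y.
Hypothesis lawY : forall x, has_law (Y x) (distribution P (Y 0)).
Hypothesis atomless : forall a, distribution P (Y 0) [set a] = 0%E.
Variable Ct : R.
Hypothesis Ct0 : 0 < Ct.
Hypothesis tail : forall r : R, 1 <= r ->
  fine (distribution P (Y 0) [set y | r <= `|y|]) <= Ct / r.
Local Notation law := (distribution P (perturbed_lattice setT Y)).

(** Weights equal to 1 on larger and larger radii have smooth counts that become
    deterministic fast enough for Borel-Cantelli.  Their discrepancy to these
    constants tends to 0 on the lattice, hence to the number of deleted points
    when points are deleted.  The upper limit is used because it is always
    measurable. *)
Lemma missing_counter : exists2 N : configuration R -> \bar R, measurable_fun setT N &
  {ae law, forall p, forall (B : set R) r, (forall z, B z -> (rad z <= r)%N) ->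
    N (restrict_conf p (~` B)) = npoints B p}.
Proof.
have half0 j : 0 < (2^-1 : R) ^+ j by rewrite exprn_gt0 // invr_gt0.
have /choice[H] : forall j, exists (q : (nat -> R) * nat * R), weight j q.1.2 q.1.1 /\
    (P [set w | (2^-1 ^+ j < `|smooth_count q.1.1 q.1.2 (perturbed_lattice setT Y w) - q.2|)%R]
      <= (2^-1 ^+ j)%:E)%E.
  move=> j; have [H [M [c h]]] :=
    smooth_count_concentrates indepY lawY atomless Ct0 tail j (half0 j).
  by exists (H, M, c).
move=> /all_and2[W PH].
pose F j := smooth_count (H j).1.1 (H j).1.2; pose c j := (H j).2.
have mF j : measurable_fun setT (F j) by exact: measurable_smooth_count.
exists (fun q => limn_esup (fun j => (c j - F j q)%:E)).
  apply: measurable_fun_limn_esup => j; apply/measurable_EFinP.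
  exact: measurable_funB.
pose E j := [set p : configuration R | 2^-1 ^+ j < `|F j p - c j|].
have mE j : measurable (E j) by apply: measurable_norm_gt; exact: measurable_funB.
have sumE : (\sum_(j <oo) law (E j) < +oo)%E.
  apply: (@le_lt_trans _ _ (2%:E)%E); last by rewrite ltry.
  apply: lime_le; first by apply: is_cvg_nneseries.
  apply: nearW => n.
  apply: (@le_trans _ _ (\sum_(0 <= j < n) (2^-1 ^+ j)%:E)%E).
    by apply: lee_sum => j _; exact: PH.
  rewrite sumEFin lee_fin.
  have -> : \sum_(0 <= j < n) (2^-1 : R) ^+ j = 2 - 2 * 2^-1 ^+ n.
    elim: n => [|n IH]; first by rewrite big_nil expr0; ring.
    by rewrite big_nat_recr //= IH exprS; field.
  by rewrite lerBlDr lerDl mulr_ge0 // exprn_ge0 // invr_ge0.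
exists (lim_sup_set E); split.
- by apply: bigcap_measurable => // k _; apply: bigcup_measurable.
- exact: lim_sup_set_cvg0.
move=> p; apply: contra_notP => nl B r Br.
have [n nE] : exists n, ~ (\bigcup_(k >= n) E k) p.
  by apply/existsNP => h; apply: nl => k _; exact: h.
have small j : (n <= j)%N -> `|F j p - c j| <= 2^-1 ^+ j.
  by move=> nj; rewrite leNgt; apply/negP => h; apply: nE; exists j.
pose q := restrict_conf p (~` B); pose k := F r p - F r q.
have kE j : (r <= j)%N -> npoints B p = (F j p - F j q)%:E.
  by move=> rj; apply: (smooth_count_restrict p (W j)) => z /Br /leq_trans; apply.
have Nk : npoints B p = k%:E by exact: kE.
have lim : (fun j => c j - F j q) @ \oo --> k.
  apply/cvgrPdist_le => e e0.
  have : (fun j : nat => (2^-1 : R) ^+ j) @ \oo --> (0 : R).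
    by apply: cvg_expr; rewrite ger0_norm ?invr_ge0 // invf_lt1 // ltr1n.
  move=> /cvgrPdist_le /(_ e e0) lim0; near=> j.
  have rj : (r <= j)%N by near: j; exact: nbhs_infty_ge.
  have nj : (n <= j)%N by near: j; exact: nbhs_infty_ge.
  have ej : `|0 - (2^-1 : R) ^+ j| <= e by near: j.
  have kj : k = F j p - F j q by apply: EFin_inj; rewrite -Nk; exact: kE.
  rewrite kj (_ : _ - _ = F j p - c j); last by ring.
  by apply: (le_trans (small j nj)); move: ej; rewrite sub0r normrN; apply: le_trans; exact: ler_norm.
have limE : (fun j => (c j - F j q)%:E) @ \oo --> k%:E by apply: cvg_EFin => //; exact: nearW.
rewrite Nk is_cvg_limn_esupE; first exact/cvg_lim.
by apply/cvg_ex; exists k%:E.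
Unshelve. all: by end_near.
Qed.

Lemma lattice_rigid : rigid law.
Proof.
have [N mN hN] := missing_counter.
move=> c r r0; exists N => //; apply: filterS hN => p /(_ (ball c r) (Num.truncn (`|c| + r))); apply.
move=> z; rewrite /ball /= => cz; rewrite -ltnS rad_ltn.
apply: (@le_lt_trans _ _ (`|c| + r)); last first.
  by have /andP[] := truncn_itv (addr_ge0 (normr_ge0 c) (ltW r0)).
have -> : z = c - (c - z) by ring.
by apply: (le_trans (ler_normB _ _)); rewrite lerD2l ltW.
Qed.

(** The counter is almost surely 0 on the lattice and 1 after the deletion of a
    point, so the event that it equals 1 separates the two laws. *)
Lemma lattice_deletion_singular : deletion_singular law.
Proof.
have [N mN [E [mE E0 hN]]] := missing_counter.
have good p : ~ E p -> forall (B : set R) r, (forall z, B z -> (rad z <= r)%N) ->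
    N (restrict_conf p (~` B)) = npoints B p.
  by move=> nE; apply: contrapT => h; apply: nE; apply: hN.
move=> d' T' P' Pi Z lawPi ptZ.
have mA : measurable (N @^-1` [set 1%E]) by rewrite -[X in measurable X]setTI; exact: mN.
exists (N @^-1` [set 1%E]); split => //.
  have nE : law.-negligible E by apply/negligibleP.
  apply/negligibleP => //; apply: negligibleS nE => p /= Np.
  apply: contrapT => /good /(_ set0 0%N); rewrite /npoints setI0 (counting0E set0).2 //.
  rewrite (_ : restrict_conf p (~` set0) = p).
    by rewrite Np => /(_ (fun z (h : False) => False_ind _ h)) /eqP; rewrite onee_eq0.
  by apply: conf_eq => /=; rewrite setC0 setIT.
have mR : measurable (remove_point Pi Z @^-1` (~` (N @^-1` [set 1%E]))).
  by apply: measurable_preimage; exact: measurableC.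
have PE : P' (Pi @^-1` E) = 0%E by exact: (eq_trans (lawPi E mE)).
have mPE : measurable (Pi @^-1` E) by exact: measurable_preimage.
apply/eqP; rewrite eq_le measure_ge0 andbT -[leRHS]PE.
apply: (@prob_le_ae _ _ _ P' (remove_point Pi Z @^-1` (~` (N @^-1` [set 1%E]))) (Pi @^-1` E)) => //.
apply: filterS ptZ => w pz /= N1; apply: contrapT => /good h; apply: N1.
have := h [set Z w] (rad (Z w)) _; rewrite /npoints.
have -> : restrict_conf (Pi w) (~` [set Z w]) = remove_point Pi Z w by exact: conf_eq.
have -> : points (Pi w) `&` [set Z w] = [set Z w].
  by apply/seteqP; split=> [z []|z ->].
by rewrite counting_set1; apply => z ->.
Qed.

End missing_points.

(** * The dichotomy *)

Lemma symmetric_stable_transform {R : realType} (alpha : R) (nu : probability R R) :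
  symmetric_stable alpha nu -> exists2 c : R, 0 < c &
  (forall t, \int[nu]_y cos (t * y) = stable_cf alpha c t) /\
  (forall t, \int[nu]_y sin (t * y) = 0).
Proof.
move=> [c c0 h]; exists c => //.
by split=> t; have := h t; rewrite /char_fun /stable_cf => -[].
Qed.

Theorem theorem1p4 (R : realType) (d : measure_display) (T : measurableType d)
    (P : probability T R) (alpha : R) (Y : int -> {RV P >-> R}) :
  0 < alpha <= 2 ->
  mutually_independent Y ->
  (forall x, has_law (Y x) (distribution P (Y 0))) ->
  symmetric_stable alpha (distribution P (Y 0)) ->
  let Pi := distribution P (perturbed_lattice [set: int] Y) in
  let Pi0 := distribution P (perturbed_lattice [set x | x != 0] Y) in
  (alpha < 1 ->
    [/\ deletion_tolerant Pi, insertion_tolerant Pi, Pi `<< Pi0 & Pi0 `<< Pi])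
  /\
  (1 <= alpha -> deletion_singular Pi /\ rigid Pi).
Proof.
move=> /andP[alpha0 _] indepY lawY /symmetric_stable_transform[c c0 [cosY sinY]] Pi Pi0.
have atomless a : distribution P (Y 0) [set a] = 0%E.
  exact: (stable_atomless alpha0 c0 cosY sinY).
split=> [alpha1|alpha1].
  have removed x A : measurable A -> P (perturbed_lattice setT Y @^-1` A) = 0%E ->
      P (perturbed_lattice (setT `\ x) Y @^-1` A) = 0%E.
    exact: (removed_null indepY lawY alpha0 c0 cosY sinY alpha1).
  have restored x A : measurable A -> P (perturbed_lattice (setT `\ x) Y @^-1` A) = 0%E ->
      P (perturbed_lattice setT Y @^-1` A) = 0%E.
    exact: (restored_null indepY lawY alpha0 c0 cosY sinY alpha1).
  have D0 : [set x : int | x != 0] = setT `\ (0 : int).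
    by apply/seteqP; split=> x /= => [/eqP|[_ /eqP]].
  split.
  - exact: (lattice_deletion_tolerant indepY lawY atomless removed).
  - apply: (lattice_insertion_tolerant indepY lawY restored) => x A.
    exact: (lebesgue_abs_continuous lawY alpha0 c0 cosY sinY alpha1).
  - rewrite /Pi0 D0; exact: (lattice_equivalent removed restored 0).1.
  - rewrite /Pi0 D0; exact: (lattice_equivalent removed restored 0).2.
have [Ct Ct0 tail] := stable_tail alpha0 c0 cosY sinY alpha1.
by split; [exact: (lattice_deletion_singular indepY lawY atomless Ct0 tail)|
  exact: (lattice_rigid indepY lawY atomless Ct0 tail)].
Qed.
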